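(* Let $\mathcal{U}$ denote the set of all conformal mappings on the unit disk $\mathbb{D}$. Let $p>0$, $\alpha>-1$. Then $$A_\alpha^p(\mathbb{D})\cap\mathcal{U}\subset H^q(\mathbb{D})\cap\mathcal{U}$$ for every $q\in\left(0,\frac{p}{\alpha+2}\right)$. Moreover, for $q>0$, $$H^q(\mathbb{D})\cap\mathcal{U}\subset A_\alpha^p(\mathbb{D})\cap\mathcal{U}$$ for every $p>0$, $\alpha>-1$ satisfying $\frac{p}{\alpha+2}\in(0,q]$.
   Context: A conformal mapping on $\mathbb{D}$ is an injective holomorphic function $f:\mathbb{D}\to\mathbb{C}$. For $p>0$, $\alpha>-1$, the weighted Bergman space $A_\alpha^p(\mathbb{D})$ is the set of holomorphic $f$ on $\mathbb{D}$ with $\int_{\mathbb{D}}|f(z)|^p(1-|z|^2)^\alpha\,dA(z)<\infty$, where $dA$ is Lebesgue area measure. The Hardy space $H^p(\mathbb{D})$ is the set of holomorphic $f$ on $\mathbb{D}$ with $\sup_{0<r<1}\int_0^{2\pi}|f(re^{it})|^p\,dt<\infty$. The symbol $\subset$ denotes (not necessarily strict) inclusion. *)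

(* Defs.v *)
From mathcomp Require Import all_boot all_order all_algebra.
From mathcomp Require Import complex.
From mathcomp Require Import all_classical all_reals all_analysis.

Set Implicit Arguments.
Unset Strict Implicit.
Unset Printing Implicit Defensive.

Import Order.TTheory GRing.Theory Num.Theory numFieldNormedType.Exports.

Local Open Scope classical_set_scope.
Local Open Scope ring_scope.
Local Open Scope complex_scope.

(* A function on the unit disk is represented by a total function
   [R[i] -> R[i]]; every condition below only constrains its values on the
   disk. *)

Definition unit_disk (R : realType) : set R[i] := [set z | `|z| < 1].

(* The scalar field of the normed module [R[i]^o] is [R[i]] itself, so the
   increment of the difference quotient is complex: differentiability here is
   complex differentiability, not a directional derivative. *)
Definition holomorphic_on (R : realType) (D : set R[i]) (f : R[i] -> R[i]) :
    Prop :=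
  forall z : R[i], D z -> derivable (f : R[i]^o -> R[i]^o) z 1.

Definition conformal_disk (R : realType) : set (R[i] -> R[i]) :=
  [set f | holomorphic_on (@unit_disk R) f /\
           {in @unit_disk R &, injective f}].

(* [Normc.normc z : R] is the modulus as a real number ([`|z|] lives in [R[i]]).
   Area measure is the product measure on R * R, with (x, y) standing for
   x + iy. *)
Definition bergman (R : realType) (p alpha : R) : set (R[i] -> R[i]) :=
  [set f | holomorphic_on (@unit_disk R) f /\
    (\int[@lebesgue_measure R \x @lebesgue_measure R]_(
        w in [set w : R * R | unit_disk (w.1 +i* w.2)])
      ((Normc.normc (f (w.1 +i* w.2)) `^ p *
        (1 - Normc.normc (w.1 +i* w.2) ^+ 2) `^ alpha)%R)%:E < +oo)%E].

Definition hardy (R : realType) (q : R) : set (R[i] -> R[i]) :=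
  [set f | holomorphic_on (@unit_disk R) f /\
    (ereal_sup [set \int[@lebesgue_measure R]_(t in `[0%R, (2 * pi)%R])
                      ((Normc.normc (f ((r * cos t) +i* (r * sin t))) `^ q)%R)%:E
               | r in `]0%R, 1%R[ ] < +oo)%E].

(* Main.v *)
(* From Bergman to Hardy: for univalent f the quotient g = (f - f 0)/z has no
   zero, so |g|^p is the modulus of a holomorphic function; the Cauchy formula on
   circles, averaged over the radius in polar coordinates, turns membership in
   A^p_alpha into |f z| <= C (1 - |z|)^(-b) with b = (alpha + 2)/p.  If f 0 = 0 and
   |f| >= tau forces |z| >= rho, Jensen's inequality for 1 - f/w, which vanishes at
   most once because f is univalent, averaged over |w| = tau gives
   int log+ (|f(r e^(it))|/tau) dt <= 2 pi log (1/rho).  Summing over dyadic tau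
   yields f in H^q whenever q b < 1.

   From Hardy to Bergman: with s = alpha + 2 it suffices to bound the integral of
   (1 + |h|^2)^s (1 - |z|)^(s - 2), where |h|^2 = c |g|^q has bounded circle means.
   Along each radius this integral is controlled by that of |h'|^2 (1 - |z|), through
   the derivative of (1 + |h|^2)^s (1 - r)^(s - 1), the growth
   |h'|^2 <= C (1 - |z|)^(-3) absorbing the excess powers; the latter integral is
   finite by Parseval.  This is done for Taylor polynomials, with bounds depending
   only on the sum of the squared coefficients, and Fatou's lemma concludes. *)

Require Import Defs.
From mathcomp Require Import all_boot all_order all_algebra.
From mathcomp Require Import complex.
From mathcomp Require Import all_classical all_reals all_analysis measurable_realfun.
From mathcomp Require Import ring lra.

Set Implicit Arguments.
Unset Strict Implicit.
Unset Printing Implicit Defensive.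

Import Order.TTheory GRing.Theory Num.Theory numFieldNormedType.Exports.

Local Open Scope classical_set_scope.
Local Open Scope ring_scope.

(** The endpoint shapes the two halves differently. In the first inclusion [q < p / (alpha + 2)] is
    strict, so a pointwise growth bound is enough: [|f| >= tau] forces [1 - |z|] to be at most of
    order tau^(-1/b), and the dyadic series has ratio 2^(q - 1/b) < 1. In the second inclusion
    [p = q (alpha + 2)] is allowed. There the growth |f| <= C (1 - |z|)^(-1/q) together with bounded
    circle means leaves the divergent weight 1 / (1 - r), which is why the derivative of h is
    brought in; the gain comes from differentiating (1 - r)^(s - 1), whose exponent is positive
    because alpha > -1. The summand 1 in 1 + |h|^2 keeps logarithms and real powers smooth where a
    Taylor polynomial of h vanishes. Univalence acts through zeros: f - f 0 and f' leave the
    difference quotient without zeros, and 1 - f / w has at most one. That one zero may lie on the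
    circle of integration, where the logarithm is -oo; hence the shifted kernel with value +oo and
    the use of Tonelli and Fatou for nonnegative functions. *)

Notation nc := Normc.normc.

(** * Complex calculus *)

Section modulus.
Context {R : realType}.
Local Open Scope complex_scope.
Implicit Types (z w d h : R[i]) (f g : R[i] -> R[i]).

Lemma ncE z : `|z| = (nc z)%:C.
Proof. by case: z. Qed.

Lemma ncD z w : nc (z + w) <= nc z + nc w.
Proof. exact: le_normcD. Qed.

Lemma ncN z : nc (- z) = nc z.
Proof. exact: normcN. Qed.

Lemma ncB z w : nc (z - w) = nc (w - z).
Proof. by rewrite -ncN opprB. Qed.

Lemma nc_ge0 z : 0 <= nc z.
Proof. by case: z => a b; exact: sqrtr_ge0. Qed.

Lemma nc_gt0 z : (0 < nc z) = (z != 0).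
Proof.
rewrite lt0r nc_ge0 andbT; congr (~~ _); apply/eqP/eqP => [/Normc.eq0_normc//|->].
exact: Normc.normc0.
Qed.

Lemma ncBD z w : nc z - nc w <= nc (z + w).
Proof. by rewrite lerBlDr -{1}(addrK w z) -(ncN w) ncD. Qed.

Lemma ncX z n : nc (z ^+ n) = nc z ^+ n.
Proof.
elim: n => [|n IH]; first by rewrite !expr0 Normc.normc1.
by rewrite !exprS Normc.normcM IH.
Qed.

Lemma nc_sum I (s : seq I) (u : I -> R[i]) :
  nc (\sum_(i <- s) u i) <= \sum_(i <- s) nc (u i).
Proof.
elim: s => [|i s IH]; first by rewrite !big_nil Normc.normc0.
by rewrite !big_cons (le_trans (ncD _ _))// lerD2l.
Qed.

Lemma nc_real (x : R) : nc (x%:C) = `|x|.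
Proof. by rewrite /= expr0n /= addr0 sqrtr_sqr. Qed.

Lemma nc_nat n : nc (n%:R : R[i]) = n%:R.
Proof. by rewrite -(rmorph_nat (real_complex R)) nc_real normr_nat. Qed.

Lemma nc_sqr z : nc z ^+ 2 = complex.Re z ^+ 2 + complex.Im z ^+ 2.
Proof. by case: z => a b /=; rewrite sqr_sqrtr// addr_ge0 ?sqr_ge0. Qed.

Lemma Re_le_nc z : `|complex.Re z| <= nc z.
Proof.
rewrite -(ler_pXn2r (n := 2)) ?nnegrE ?nc_ge0// nc_sqr.
by rewrite real_normK ?num_real// lerDl sqr_ge0.
Qed.

Lemma Im_le_nc z : `|complex.Im z| <= nc z.
Proof.
rewrite -(ler_pXn2r (n := 2)) ?nnegrE ?nc_ge0// nc_sqr.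
by rewrite real_normK ?num_real// lerDr sqr_ge0.
Qed.

Lemma nc_le_ReIm z : nc z <= `|complex.Re z| + `|complex.Im z|.
Proof.
rewrite -(ler_pXn2r (n := 2)) ?nnegrE ?nc_ge0 ?addr_ge0// nc_sqr.
rewrite sqrrD !real_normK ?num_real//.
have : 0 <= `|complex.Re z| * `|complex.Im z| by rewrite mulr_ge0.
lra.
Qed.

Lemma cReM z w :
  complex.Re (z * w) = complex.Re z * complex.Re w - complex.Im z * complex.Im w.
Proof. by case: z; case: w. Qed.

Lemma cImM z w :
  complex.Im (z * w) = complex.Re z * complex.Im w + complex.Im z * complex.Re w.
Proof. by case: z => a b; case: w => c e /=. Qed.

Lemma complex_eq z w :
  complex.Re z = complex.Re w -> complex.Im z = complex.Im w -> z = w.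
Proof. by case: z w => [a b] [c e] /= -> ->. Qed.

End modulus.

(* Complex derivatives and continuity are phrased with real estimates on the
   modulus, away from the complex-valued norm of [R[i]^o]; [derivable_cdiff] is
   the link with the library's [derivable]. *)
Section cdiff.
Context {R : realType}.
Local Open Scope complex_scope.
Implicit Types (z w d h : R[i]) (f g : R[i] -> R[i]).

Definition cdiff f z d := forall e : R, 0 < e -> exists2 r : R, 0 < r &
  forall h, nc h < r -> nc (f (z + h) - f z - d * h) <= e * nc h.

Definition ccont f z := forall e : R, 0 < e -> exists2 r : R, 0 < r &
  forall h, nc h < r -> nc (f (z + h) - f z) <= e.

Lemma cdiff_quot f z d : cdiff f z d <->
  (fun h : R[i]^o => h^-1 *: (f (h + z) - f z) : R[i]^o) @ 0^' --> (d : R[i]^o).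
Proof.
split=> [H | /cvgrPdist_le H e e0].
  apply/cvgrPdist_le => e e0.
  (* In the order of [R[i]], [0 < e] forces [e] to be real, so the complex tolerance of the filter
     limit is a real one. *)
  have Ie : complex.Im e = 0 by apply: ger0_Im; exact: ltW.
  have eE : e = (complex.Re e)%:C by case: e Ie {e0} => a b /= ->.
  have e0' : 0 < complex.Re e by rewrite -ltcR -eE.
  have [r r0 Hr] := H _ e0'.
  apply/(@nbhs_ballP R[i] R[i]^o); exists r%:C; first by rewrite /= ltcR.
  move=> h /=; rewrite -ball_normE /= sub0r normrN => hr h0.
  rewrite ncE ltcR in hr.
  rewrite eE ncE lecR -(@ler_pM2r _ (nc h)) ?nc_gt0//.
  apply: le_trans (Hr _ hr).
  rewrite -Normc.normcM -ncN (addrC z).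
  by rewrite /GRing.scale /= mulrBl mulrAC mulVf// mul1r opprB.
have e0' : 0 < e%:C by rewrite ltcR.
have /(@nbhs_ballP R[i] R[i]^o) [r r0 Hr] := H _ e0'.
have Ie : complex.Im r = 0 by apply: ger0_Im; exact: ltW.
have rE : r = (complex.Re r)%:C by case: r Ie {r0 Hr} => a b /= ->.
exists (complex.Re r); first by rewrite -ltcR -rE.
move=> h hr; have [->|h0] := eqVneq h 0.
  by rewrite addr0 mulr0 subr0 subrr Normc.normc0 mulr0.
have := Hr h; rewrite -ball_normE /= sub0r normrN ncE rE ltcR => /(_ hr h0).
rewrite ncE lecR -(@ler_pM2r _ (nc h)) ?nc_gt0//; apply: le_trans.
rewrite -Normc.normcM -[X in _ <= X]ncN (addrC z).
by rewrite /GRing.scale /= mulrBl mulrAC mulVf// mul1r opprB.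
Qed.

Lemma derivable_cdiff f z :
  derivable (f : R[i]^o -> R[i]^o) z 1 <-> exists d, cdiff f z d.
Proof.
rewrite /derivable.
have -> : (fun h : R[i]^o => h^-1 *: (f (h *: (1:R[i]^o) + z) - f z) : R[i]^o) =
          (fun h : R[i]^o => h^-1 *: (f (h + z) - f z) : R[i]^o).
  by apply/funext => h; rewrite /GRing.scale /= mulr1.
split=> [/cvg_ex [d H]|[d /cdiff_quot H]]; first by exists d; apply/cdiff_quot.
by apply/cvg_ex; exists d.
Qed.

Lemma cdiff_ext (r : R) f g z d : 0 < r -> (forall h, nc h < r -> f (z + h) = g (z + h)) ->
  cdiff f z d -> cdiff g z d.
Proof.
move=> r0 fg H e e0; have [s s0 Hs] := H e e0.
exists (Num.min r s); first by rewrite lt_min r0.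
move=> h; rewrite lt_min => /andP[hr hs].
rewrite -fg// -[in X in _ - X - _](addr0 z) -fg ?addr0 ?Normc.normc0//.
exact: Hs.
Qed.

Lemma cdiff_cst c z : cdiff (fun=> c) z 0.
Proof.
move=> e e0; exists 1 => // h _.
by rewrite subrr mul0r subr0 Normc.normc0 mulr_ge0 ?nc_ge0// ltW.
Qed.

Lemma cdiff_id z : cdiff id z 1.
Proof.
move=> e e0; exists 1 => // h _.
by rewrite mul1r (addrC z) addrK subrr Normc.normc0 mulr_ge0 ?nc_ge0// ltW.
Qed.

Lemma cdiff_lip f z d : cdiff f z d -> exists2 r : R, 0 < r &
  forall h, nc h < r -> nc (f (z + h) - f z) <= (nc d + 1) * nc h.
Proof.
move=> /(_ 1 ltr01) [r r0 H]; exists r => // h /H; rewrite mul1r => {}H.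
rewrite -(subrK (d * h) (f (z + h) - f z)) mulrDl mul1r -Normc.normcM.
by rewrite (le_trans (ncD _ _))// addrC lerD2l.
Qed.

Lemma cdiff_ccont f z d : cdiff f z d -> ccont f z.
Proof.
move=> /cdiff_lip [r r0 H] e e0.
have K0 : 0 < nc d + 1 by rewrite ltr_wpDl ?nc_ge0.
exists (Num.min r (e / (nc d + 1))); first by rewrite lt_min r0 divr_gt0.
move=> h; rewrite lt_min => /andP[/H hr hs]; rewrite (le_trans hr)//.
by rewrite mulrC -ler_pdivlMr// ltW.
Qed.

Lemma cdiffD f g z d d' : cdiff f z d -> cdiff g z d' ->
  cdiff (fun x => f x + g x) z (d + d').
Proof.
move=> H H' e e0; have e2 : 0 < e / 2 by rewrite divr_gt0.
have [r r0 Hr] := H _ e2; have [s s0 Hs] := H' _ e2.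
exists (Num.min r s); first by rewrite lt_min r0.
move=> h; rewrite lt_min => /andP[/Hr hr /Hs hs].
have -> : f (z + h) + g (z + h) - (f z + g z) - (d + d') * h =
  (f (z + h) - f z - d * h) + (g (z + h) - g z - d' * h) by ring.
by rewrite (le_trans (ncD _ _))//; move: hr hs; lra.
Qed.

Lemma cdiffM f g z d d' : cdiff f z d -> cdiff g z d' ->
  cdiff (fun x => f x * g x) z (d * g z + f z * d').
Proof.
move=> H H' e e0.
have [q q0 Hq] := cdiff_lip H; have [q' q'0 Hq'] := cdiff_lip H'.
set K := nc d + 1 in Hq; set K' := nc d' + 1 in Hq'.
have K0 : 0 < K by rewrite ltr_wpDl ?nc_ge0.
have K'0 : 0 < K' by rewrite ltr_wpDl ?nc_ge0.
have a0 : 0 < e / (3 * (nc (g z) + 1)).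
  by rewrite divr_gt0// mulr_gt0// ltr_wpDl ?nc_ge0.
have b0 : 0 < e / (3 * (nc (f z) + 1)).
  by rewrite divr_gt0// mulr_gt0// ltr_wpDl ?nc_ge0.
have [r r0 Hr] := H _ a0; have [s s0 Hs] := H' _ b0.
exists (Num.min (Num.min r s) (Num.min (Num.min q q') (e / (3 * (K * K'))))).
  by rewrite !lt_min r0 s0 q0 q'0 /= divr_gt0// !mulr_gt0.
move=> h; rewrite !lt_min => /andP[/andP[/Hr hr /Hs hs] /andP[/andP[/Hq hq /Hq' hq'] hh]].
have -> : f (z + h) * g (z + h) - f z * g z - (d * g z + f z * d') * h =
  (f (z + h) - f z - d * h) * g z + f z * (g (z + h) - g z - d' * h) +
  (f (z + h) - f z) * (g (z + h) - g z) by ring.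
have h0 := nc_ge0 h.
have e1 : nc ((f (z + h) - f z - d * h) * g z) <= e / 3 * nc h.
  rewrite Normc.normcM.
  have /le_trans := ler_wpM2r (nc_ge0 (g z)) hr; apply.
  have -> : e / (3 * (nc (g z) + 1)) * nc h * nc (g z) =
     e / 3 * nc h * (nc (g z) / (nc (g z) + 1)).
     by field; rewrite gt_eqF// ltr_wpDl ?nc_ge0.
  rewrite ler_piMr// ?mulr_ge0//; first by apply: ltW; lra.
  by rewrite ler_pdivrMr ?ltr_wpDl ?nc_ge0// mul1r lerDl.
have e2 : nc (f z * (g (z + h) - g z - d' * h)) <= e / 3 * nc h.
  rewrite Normc.normcM mulrC.
  have /le_trans := ler_wpM2r (nc_ge0 (f z)) hs; apply.
  have -> : e / (3 * (nc (f z) + 1)) * nc h * nc (f z) =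
     e / 3 * nc h * (nc (f z) / (nc (f z) + 1)).
     by field; rewrite gt_eqF// ltr_wpDl ?nc_ge0.
  rewrite ler_piMr// ?mulr_ge0//; first by apply: ltW; lra.
  by rewrite ler_pdivrMr ?ltr_wpDl ?nc_ge0// mul1r lerDl.
have e3 : nc ((f (z + h) - f z) * (g (z + h) - g z)) <= e / 3 * nc h.
  rewrite Normc.normcM (le_trans (ler_pM (nc_ge0 _) (nc_ge0 _) hq hq'))//.
  have -> : K * nc h * (K' * nc h) = nc h * (K * K') * nc h by ring.
  rewrite ler_wpM2r// -ler_pdivlMr ?mulr_gt0//.
  by rewrite -mulrA -invfM ltW.
rewrite (le_trans (ncD _ _))//; have := ncD ((f (z + h) - f z - d * h) * g z) (f z * (g (z + h) - g z - d' * h)).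
by move: e1 e2 e3; lra.
Qed.

Lemma cdiffZ c f z d : cdiff f z d -> cdiff (fun x => c * f x) z (c * d).
Proof. by move=> /(cdiffM (cdiff_cst c z)); rewrite mul0r add0r. Qed.

Lemma cdiffN f z d : cdiff f z d -> cdiff (fun x => - f x) z (- d).
Proof.
move=> H e e0; have [r r0 Hr] := H _ e0; exists r => // h /Hr.
by rewrite -ncN; congr (nc _ <= _); ring.
Qed.

Lemma cdiffB f g z d d' : cdiff f z d -> cdiff g z d' ->
  cdiff (fun x => f x - g x) z (d - d').
Proof. by move=> H /cdiffN; exact: cdiffD. Qed.

Lemma cdiff_comp f g z d d' : cdiff f z d -> cdiff g (f z) d' ->
  cdiff (g \o f) z (d' * d).
Proof.
move=> H H' e e0.
have [q q0 Hq] := cdiff_lip H; set K := nc d + 1 in Hq.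
have K0 : 0 < K by rewrite ltr_wpDl ?nc_ge0.
have L0 : 0 < nc d' + 1 by rewrite ltr_wpDl ?nc_ge0.
have a0 : 0 < e / (2 * K) by rewrite divr_gt0// mulr_gt0.
have b0 : 0 < e / (2 * (nc d' + 1)) by rewrite divr_gt0// mulr_gt0.
have [r r0 Hr] := H _ b0; have [s s0 Hs] := H' _ a0.
exists (Num.min (Num.min r q) (s / K)).
  by rewrite !lt_min r0 q0 /= divr_gt0.
move=> h; rewrite !lt_min => /andP[/andP[/Hr hr /Hq hq] hh].
have hs : nc (f (z + h) - f z) < s.
  by rewrite (le_lt_trans hq)// mulrC -ltr_pdivlMr.
have := Hs _ hs; rewrite (addrC (f z)) subrK => {}Hs.
have -> : (g \o f) (z + h) - (g \o f) z - d' * d * h =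
  (g (f (z + h)) - g (f z) - d' * (f (z + h) - f z)) +
  d' * (f (z + h) - f z - d * h) by rewrite /=; ring.
have e1 : nc (d' * (f (z + h) - f z - d * h)) <= e / 2 * nc h.
  rewrite Normc.normcM mulrC.
  have /le_trans := ler_wpM2r (nc_ge0 d') hr; apply.
  have -> : e / (2 * (nc d' + 1)) * nc h * nc d' =
     e / 2 * nc h * (nc d' / (nc d' + 1)).
     by field; rewrite gt_eqF// ltr_wpDl ?nc_ge0.
  rewrite ler_piMr// ?mulr_ge0// ?nc_ge0//; first by apply: ltW; lra.
  by rewrite ler_pdivrMr ?ltr_wpDl ?nc_ge0// mul1r lerDl.
have e2 : nc (g (f (z + h)) - g (f z) - d' * (f (z + h) - f z)) <= e / 2 * nc h.
  rewrite (le_trans Hs)//.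
  have /le_trans := ler_wpM2l (ltW a0) hq; apply.
  have -> // : e / (2 * K) * (K * nc h) = e / 2 * nc h by field; rewrite gt_eqF.
by rewrite (le_trans (ncD _ _))//; move: e1 e2; lra.
Qed.

Lemma cdiff_inv z : z != 0 -> cdiff GRing.inv z (- (z ^- 2)).
Proof.
move=> z0 e e0; have nz0 : 0 < nc z by rewrite nc_gt0.
exists (Num.min (nc z / 2) (e * nc z ^+ 3 / 2)).
  by rewrite lt_min !divr_gt0// mulr_gt0// exprn_gt0.
move=> h; rewrite lt_min => /andP[h1 h2].
have zh : nc z / 2 <= nc (z + h) by have := ncBD z h; move: h1; lra.
have zh0 : z + h != 0 by rewrite -nc_gt0 (lt_le_trans _ zh)// divr_gt0.
have -> : (z + h)^-1 - z^-1 - - z ^- 2 * h = h * h * (z ^- 2 * (z + h)^-1).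
  by field; rewrite zh0.
rewrite !Normc.normcM !Normc.normcV ncX mulrAC ler_wpM2r ?nc_ge0//.
rewrite -invfM ler_pdivrMr ?mulr_gt0 ?exprn_gt0//; last first.
  by rewrite (lt_le_trans _ zh)// divr_gt0.
rewrite (le_trans (ltW h2))// -mulrA ler_pM2l// exprSr -mulrA.
by rewrite ler_pM2l ?exprn_gt0.
Qed.

Lemma cdiffV f z d : f z != 0 -> cdiff f z d ->
  cdiff (fun x => (f x)^-1) z (- (d / f z ^+ 2)).
Proof.
move=> f0 H; have := cdiff_comp H (cdiff_inv f0).
by rewrite mulNr mulrC.
Qed.

Lemma cdiffX f z d n : cdiff f z d ->
  cdiff (fun x => f x ^+ n.+1) z (n.+1%:R * f z ^+ n * d).
Proof.
move=> H; elim: n => [|n IH]; first by rewrite expr0 mulr1 mul1r.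
have := cdiffM H IH.
have -> : d * f z ^+ n.+1 + f z * (n.+1%:R * f z ^+ n * d) =
  n.+2%:R * f z ^+ n.+1 * d by rewrite -[n.+2%:R]natr1 exprS; ring.
exact: cdiff_ext.
Qed.

End cdiff.

Section rdiff.
Context {R : realType}.
Implicit Types (x d : R) (f : R -> R).

(** Brings real derivatives to the same epsilon form as [cdiff], so that estimates on real and
    imaginary parts can be combined directly. *)
Lemma is_derive_eps f x d : is_derive x 1 f d <->
  forall e : R, 0 < e -> exists2 r : R, 0 < r &
    forall h, `|h| < r -> `|f (x + h) - f x - d * h| <= e * `|h|.
Proof.
have quot : (fun h : R => h^-1 *: (f (h *: (1:R) + x) - f x)) =
            (fun h => h^-1 * (f (h + x) - f x)).
  by apply/funext => h; rewrite /GRing.scale /= mulr1.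
have E (c h : R) : h != 0 -> `|c - h^-1 * (f (h + x) - f x)| * `|h| =
           `|f (x + h) - f x - c * h|.
  move=> h0; rewrite -normrM mulrBl mulrAC mulVf// mul1r distrC (addrC h).
  by congr `| _ |; ring.
split=> [[]|H].
  rewrite /derivable /derive quot => H <- e e0.
  have /cvgrPdist_le/(_ _ e0) /nbhs_ballP [r r0 Hr] := H.
  exists r => // h hr; have [->|h0] := eqVneq h 0.
    by rewrite addr0 mulr0 subr0 subrr normr0 mulr0.
  rewrite -E// ler_pM2r ?normr_gt0//; apply: Hr => //.
  by rewrite -ball_normE /= sub0r normrN.
have C : h^-1 * (f (h + x) - f x) @[h --> 0^'] --> d.
  apply/cvgrPdist_le => e e0; have [r r0 Hr] := H _ e0.
  apply/nbhs_ballP; exists r => // h.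
  rewrite -ball_normE /= sub0r normrN => hr h0.
  by rewrite -(@ler_pM2r _ `|h|) ?normr_gt0// E//; exact: Hr.
apply: DeriveDef; rewrite /derivable /derive quot.
  by apply/cvg_ex; exists d.
exact/cvg_lim.
Qed.

Lemma cvg_eps f x : {for x, continuous f} <->
  forall e : R, 0 < e -> exists2 r : R, 0 < r &
    forall h, `|h| < r -> `|f (x + h) - f x| <= e.
Proof.
split=> [/cvgrPdist_le H e e0|H].
  have /nbhs_ballP [r r0 Hr] := H _ e0; exists r => // h hr.
  by rewrite distrC; apply: Hr; rewrite -ball_normE /= opprD addNKr normrN.
apply/cvgrPdist_le => e e0; have [r r0 Hr] := H _ e0.
apply/(@nbhs_ballP R R^o); exists r => // y; rewrite -ball_normE /= => xy.
by have := Hr (y - x); rewrite (addrC x) subrK (distrC y) (distrC (f y)); apply.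
Qed.

End rdiff.

(** * The complex exponential *)

Section cexp.
Context {R : realType}.
Local Open Scope complex_scope.
Implicit Types (z w : R[i]).

Definition unit_pt (t : R) : R[i] := cos t +i* sin t.

Definition cexp z : R[i] := (expR (complex.Re z))%:C * unit_pt (complex.Im z).

Lemma unit_ptD s t : unit_pt (s + t) = unit_pt s * unit_pt t.
Proof. by apply: complex_eq => /=; rewrite ?cosD ?sinD//; ring. Qed.

Lemma unit_pt0 : unit_pt 0 = 1.
Proof. by rewrite /unit_pt cos0 sin0. Qed.

Lemma nc_unit_pt t : nc (unit_pt t) = 1.
Proof. by rewrite /= cos2Dsin2 sqrtr1. Qed.

Lemma unit_pt_neq0 t : unit_pt t != 0.
Proof. by rewrite -nc_gt0 nc_unit_pt. Qed.

Lemma unit_ptN t : unit_pt (- t) = (unit_pt t)^-1.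
Proof.
by apply: (mulfI (unit_pt_neq0 t)); rewrite -unit_ptD subrr unit_pt0 divff// unit_pt_neq0.
Qed.

Lemma unit_pt2pi : unit_pt (2 * pi) = 1.
Proof. by rewrite /unit_pt mulr_natl cos2pi sin2pi. Qed.

Lemma cexpD z w : cexp (z + w) = cexp z * cexp w.
Proof.
rewrite /cexp; rewrite !raddfD /= expRD unit_ptD.
by rewrite (rmorphM (real_complex R)) mulrACA.
Qed.

Lemma cexp0 : cexp 0 = 1.
Proof. by rewrite /cexp /= expR0 unit_pt0 mulr1. Qed.

Lemma nc_cexp z : nc (cexp z) = expR (complex.Re z).
Proof. by rewrite Normc.normcM nc_unit_pt mulr1 nc_real ger0_norm// expR_ge0. Qed.

Lemma cexp_neq0 z : cexp z != 0.
Proof. by rewrite -nc_gt0 nc_cexp expR_gt0. Qed.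

Lemma cexpN z : cexp (- z) = (cexp z)^-1.
Proof.
by apply: (mulfI (cexp_neq0 z)); rewrite -cexpD subrr cexp0 divff// cexp_neq0.
Qed.

(** The derivatives at [0] of [expR], [cos] and [sin] are glued by writing both components of
    [cexp h - 1 - h] as sums of products with one small factor each. *)
Lemma cdiff_cexp0 : cdiff cexp 0 (1 : R[i]).
Proof.
move=> e e0.
have /is_derive_eps De : is_derive (0:R) 1 expR 1.
  by rewrite -[X in is_derive _ _ _ X](expR0 R); exact: is_derive_expR.
have /is_derive_eps Dc : is_derive (0:R) 1 cos 0.
  by rewrite -[X in is_derive _ _ _ X]oppr0 -[X in - X](sin0 R); exact: is_derive_cos.
have /is_derive_eps Ds : is_derive (0:R) 1 sin 1.
  by rewrite -[X in is_derive _ _ _ X](cos0 R); exact: is_derive_sin.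
(* The four error terms below are at most [u n], [2 u n], [4 u n] and [u n], which add up to
   [8 u n]. *)
pose u : R := Num.min 1 (e / 8).
have u0 : 0 < u by rewrite lt_min ltr01 divr_gt0.
have u1 : u <= 1 by rewrite ge_min lexx.
have ue : u <= e / 8 by rewrite ge_min lexx orbT.
clearbody u.
have [r1 r10 H1] := De _ u0; have [r2 r20 H2] := Dc _ u0; have [r3 r30 H3] := Ds _ u0.
exists (Num.min u (Num.min r1 (Num.min r2 r3))); first by rewrite !lt_min u0 r10 r20 r30.
case=> x y; rewrite !lt_min => /andP[hu /and3P[h1 h2 h3]].
have xh := Re_le_nc (x +i* y); have yh := Im_le_nc (x +i* y).
rewrite add0r cexp0 mul1r.
set n := nc _ in hu h1 h2 h3 xh yh *.
rewrite /= in xh yh.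
have {H1} := H1 x (le_lt_trans xh h1); rewrite add0r expR0 mul1r => H1.
have {H2} := H2 y (le_lt_trans yh h2); rewrite add0r cos0 mul0r subr0 => H2.
have {H3} := H3 y (le_lt_trans yh h3); rewrite add0r sin0 mul1r subr0 => H3.
have n0 : 0 <= n by exact: nc_ge0.
have un : u * n <= e / 8 * n by rewrite ler_wpM2r.
have K1 : `|expR x - 1 - x| <= u * n by rewrite (le_trans H1)// ler_wpM2l// ltW.
have K2 : `|cos y - 1| <= u * n by rewrite (le_trans H2)// ler_wpM2l// ltW.
have K3 : `|sin y - y| <= u * n by rewrite (le_trans H3)// ler_wpM2l// ltW.
have E1 : `|expR x - 1| <= 2 * u.
  have -> : expR x - 1 = (expR x - 1 - x) + x by ring.
  rewrite (le_trans (ler_normD _ _))//.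
  have : u * n <= 1 * n by rewrite ler_wpM2r.
  have : u * n <= u * 1 by rewrite ler_wpM2l//; move: hu u1 u0; lra.
  by move: K1 xh hu; lra.
have E2 : `|sin y| <= 2 * n.
  have -> : sin y = (sin y - y) + y by ring.
  rewrite (le_trans (ler_normD _ _))//.
  have : u * n <= 1 * n by rewrite ler_wpM2r.
  by move: K3 yh hu; lra.
apply: (le_trans (nc_le_ReIm _)) => /=; rewrite mul0r subr0 mul0r addr0 oppr0 addr0.
have -> : expR x * cos y - 1 - x = (expR x - 1 - x) * cos y + (1 + x) * (cos y - 1) by ring.
have -> : expR x * sin y - y = (expR x - 1) * sin y + (sin y - y) by ring.
have A1 : `|(expR x - 1 - x) * cos y| <= u * n.
  rewrite normrM -[X in _ <= X]mulr1 ler_pM//; exact: cos_max.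
have A2 : `|(1 + x) * (cos y - 1)| <= 2 * (u * n).
  rewrite normrM ler_pM// (le_trans (ler_normD _ _))// normr1.
  by move: xh hu u1; lra.
have A3 : `|(expR x - 1) * sin y| <= 2 * u * (2 * n) by rewrite normrM ler_pM.
have := ler_normD ((expR x - 1 - x) * cos y) ((1 + x) * (cos y - 1)).
have := ler_normD ((expR x - 1) * sin y) (sin y - y).
move: A1 A2 A3 K3 un; lra.
Qed.

(** The functional equation [cexpD] carries the derivative from [0] to [z]. *)
Lemma cdiff_cexp z : cdiff cexp z (cexp z).
Proof.
move=> e e0.
have a0 : 0 < e / nc (cexp z) by rewrite divr_gt0// nc_gt0 cexp_neq0.
have [r r0 H] := cdiff_cexp0 a0; exists r => // h /H.
rewrite add0r cexp0 mul1r mulrAC ler_pdivlMr ?nc_gt0 ?cexp_neq0// -Normc.normcM.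
by apply: le_trans; rewrite cexpD le_eqVlt; apply/orP; left; apply/eqP; congr nc; ring.
Qed.

End cexp.

(** * Integrals of complex-valued functions over real intervals *)

Section cint.
Context {R : realType}.
Local Open Scope complex_scope.
Implicit Types (z w c : R[i]) (F G : R -> R[i]) (f g : R -> R) (a b t : R).
Local Notation mu := (@lebesgue_measure R).

Definition pcont F t := forall e : R, 0 < e -> exists2 r : R, 0 < r &
  forall s : R, `|s| < r -> nc (F (t + s) - F t) <= e.

Lemma eq_continuous_for f g t : f =1 g -> {for t, continuous f} -> {for t, continuous g}.
Proof. by move=> /funext ->. Qed.

Lemma pcont_Re F t : pcont F t -> {for t, continuous (fun s => complex.Re (F s))}.
Proof.
move=> H; apply/cvg_eps => e e0; have [r r0 Hr] := H _ e0; exists r => // h /Hr.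
by apply: le_trans; have := Re_le_nc (F (t + h) - F t); rewrite raddfB.
Qed.

Lemma pcont_Im F t : pcont F t -> {for t, continuous (fun s => complex.Im (F s))}.
Proof.
move=> H; apply/cvg_eps => e e0; have [r r0 Hr] := H _ e0; exists r => // h /Hr.
by apply: le_trans; have := Im_le_nc (F (t + h) - F t); rewrite raddfB.
Qed.

Lemma pcont_nc F t : pcont F t -> {for t, continuous (fun s => nc (F s))}.
Proof.
move=> H; apply/cvg_eps => e e0; have [r r0 Hr] := H _ e0; exists r => // h /Hr.
apply: le_trans; rewrite ler_norml.
have := ncBD (F t) (F (t + h) - F t); have := ncBD (F (t + h)) (F t - F (t + h)).
rewrite !(addrC _ (_ - _)) !subrK (ncB (F t)); lra.
Qed.

Lemma pcont_pair F t : {for t, continuous (fun s => complex.Re (F s))} ->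
  {for t, continuous (fun s => complex.Im (F s))} -> pcont F t.
Proof.
move=> /cvg_eps H /cvg_eps H' e e0.
have e2 : 0 < e / 2 by rewrite divr_gt0.
have [r r0 Hr] := H _ e2; have [s s0 Hs] := H' _ e2.
exists (Num.min r s); first by rewrite lt_min r0.
move=> h; rewrite lt_min => /andP[/Hr hr /Hs hs].
by rewrite (le_trans (nc_le_ReIm _))// !raddfB /=; move: hr hs; lra.
Qed.

Lemma pcont_comp (f : R[i] -> R[i]) F t : ccont f (F t) -> pcont F t -> pcont (fun s => f (F s)) t.
Proof.
move=> H H' e e0; have [r r0 Hr] := H _ e0.
have r2 : 0 < r / 2 by rewrite divr_gt0.
have [s s0 Hs] := H' _ r2; exists s => // h /Hs hs.
have := Hr (F (t + h) - F t); rewrite (addrC (F t)) subrK; apply.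
by move: hs; lra.
Qed.

Lemma pcontM F G t : pcont F t -> pcont G t -> pcont (fun s => F s * G s) t.
Proof.
move=> HF HG.
apply: pcont_pair.
  apply: (@eq_continuous_for (fun s => complex.Re (F s) * complex.Re (G s) - complex.Im (F s) * complex.Im (G s)) _ _ (fun s => esym (cReM (F s) (G s)))).
  by apply: cvgB; apply: cvgM; do ?[exact: pcont_Re | exact: pcont_Im].
apply: (@eq_continuous_for (fun s => complex.Re (F s) * complex.Im (G s) + complex.Im (F s) * complex.Re (G s)) _ _ (fun s => esym (cImM (F s) (G s)))).
by apply: cvgD; apply: cvgM; do ?[exact: pcont_Re | exact: pcont_Im].
Qed.

Lemma pcontD F G t : pcont F t -> pcont G t -> pcont (fun s => F s + G s) t.
Proof.
move=> HF HG.
move=> e e0; have e2 : 0 < e / 2 by rewrite divr_gt0.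
have [r r0 Hr] := HF _ e2; have [s s0 Hs] := HG _ e2.
exists (Num.min r s); first by rewrite lt_min r0.
move=> h; rewrite lt_min => /andP[/Hr hr /Hs hs].
rewrite opprD addrACA (le_trans (ncD _ _))//; move: hr hs; lra.
Qed.

Lemma pcont_cst c t : pcont (fun=> c) t.
Proof. by move=> e e0; exists 1 => // s _; rewrite subrr Normc.normc0 ltW. Qed.

Lemma pcontN F t : pcont F t -> pcont (fun s => - F s) t.
Proof.
by move=> H e /H [r r0 Hr]; exists r => // s /Hr; rewrite -opprD ncN.
Qed.

Lemma pcontB F G t : pcont F t -> pcont G t -> pcont (fun s => F s - G s) t.
Proof. by move=> HF /pcontN; exact: pcontD. Qed.

Lemma pcont_unit_pt t : pcont (@unit_pt R) t.
Proof. by apply: pcont_pair => /=; [exact: continuous_cos|exact: continuous_sin]. Qed.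

Lemma pcont_real f t : {for t, continuous f} -> pcont (fun s => (f s)%:C) t.
Proof. by move=> H; apply: pcont_pair => //=; exact: cvg_cst. Qed.

Definition cint a b F : R[i] :=
  (\int[mu]_(t in `[a, b]) complex.Re (F t)) +i* (\int[mu]_(t in `[a, b]) complex.Im (F t)).

Lemma cont_integrable a b f : (forall t, a <= t <= b -> {for t, continuous f}) ->
  mu.-integrable `[a, b] (EFin \o f).
Proof.
move=> H; apply: continuous_compact_integrable; first exact: segment_compact.
apply: continuous_in_subspaceT => t; rewrite inE /= in_itv /=; exact: H.
Qed.

Section lin.
Variables (a b : R) (F G : R -> R[i]).
Hypothesis cF : forall t, a <= t <= b -> pcont F t.
Hypothesis cG : forall t, a <= t <= b -> pcont G t.

Let iRe F' : (forall t, a <= t <= b -> pcont F' t) ->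
  mu.-integrable `[a, b] (EFin \o (fun t => complex.Re (F' t))).
Proof. by move=> H; apply: cont_integrable => t /H /pcont_Re. Qed.

Let iIm F' : (forall t, a <= t <= b -> pcont F' t) ->
  mu.-integrable `[a, b] (EFin \o (fun t => complex.Im (F' t))).
Proof. by move=> H; apply: cont_integrable => t /H /pcont_Im. Qed.

Lemma cintD : cint a b (fun t => F t + G t) = cint a b F + cint a b G.
Proof.
apply: complex_eq; rewrite /= -RintegralD ?iRe ?iIm//.
  by apply: eq_Rintegral => t _; rewrite raddfD.
by apply: eq_Rintegral => t _; rewrite raddfD.
Qed.

Lemma cintZ c : cint a b (fun t => c * F t) = c * cint a b F.
Proof.
apply: complex_eq; rewrite ?(cReM, cImM) /= -!RintegralZl ?iRe ?iIm//.
  rewrite -RintegralB//=.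
  - by apply: eq_Rintegral => t _; rewrite cReM.
  - by apply: cont_integrable => t /cF Ft; apply: cvgM; [exact: cvg_cst|exact: pcont_Re].
  - by apply: cont_integrable => t /cF Ft; apply: cvgM; [exact: cvg_cst|exact: pcont_Im].
rewrite -RintegralD//=.
- by apply: eq_Rintegral => t _; rewrite cImM.
- by apply: cont_integrable => t /cF Ft; apply: cvgM; [exact: cvg_cst|exact: pcont_Im].
- by apply: cont_integrable => t /cF Ft; apply: cvgM; [exact: cvg_cst|exact: pcont_Re].
Qed.

(** Multiplying the integral [I] by its conjugate [J] makes it real, so [|I|^2] is the integral of a
    real part, which is bounded by the modulus [|I| |F|]. *)
Lemma cint_nc : nc (cint a b F) <= \int[mu]_(t in `[a, b]) nc (F t).
Proof.
have nF : mu.-integrable `[a, b] (EFin \o (fun t => nc (F t))).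
  by apply: cont_integrable => t /cF /pcont_nc.
set I := cint a b F; have [I0|I0] := eqVneq I 0.
  by rewrite I0 Normc.normc0 Rintegral_ge0// => t _; exact: nc_ge0.
have n0 : 0 < nc I by rewrite nc_gt0.
pose J := complex.Re I -i* complex.Im I.
have E : nc I * nc I = complex.Re (cint a b (fun t => J * F t)).
  by rewrite cintZ -/I -[LHS]/(nc I ^+ 2) nc_sqr cReM /= !expr2 mulNr opprK.
rewrite -(ler_pM2l n0) -RintegralZl// E.
set n := nc I; apply: le_Rintegral => //.
- apply: cont_integrable => t /cF Ft; apply: pcont_Re.
  by apply: pcontM => //; exact: pcont_cst.
- by apply: cont_integrable => t /cF Ft; apply: cvgM; [exact: cvg_cst|exact: pcont_nc].
- move=> t _; apply: (le_trans (ler_norm _)); apply: (le_trans (Re_le_nc _)).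
  by rewrite Normc.normcM ler_wpM2r ?nc_ge0// /n /J; case: (I) => u v /=; rewrite sqrrN.
Qed.

Lemma cint_bound M : a <= b -> (forall t, a <= t <= b -> nc (F t) <= M) ->
  nc (cint a b F) <= M * (b - a).
Proof.
move=> ab H; apply: (le_trans cint_nc).
have -> : M * (b - a) = \int[mu]_(t in `[a, b]) M.
  rewrite Rintegral_cst//= lebesgue_measure_itv /= lte_fin.
  move: ab; rewrite le_eqVlt => /predU1P[->|->//]; by rewrite ltxx subrr mulr0.
apply: le_Rintegral => //=.
- by apply: cont_integrable => t /cF /pcont_nc.
- by apply: cont_integrable => t _; exact: cvg_cst.
Qed.

End lin.

Lemma eq_cint a b F G : (forall t, a <= t <= b -> F t = G t) -> cint a b F = cint a b G.
Proof.
by move=> H; apply: complex_eq => /=; apply: eq_Rintegral => t;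
  rewrite inE /= in_itv /= => /H ->.
Qed.

Lemma cint_cst a b c : a <= b -> cint a b (fun=> c) = (b - a)%:C * c.
Proof.
move=> ab.
have E (r : R) : \int[mu]_(t in `[a, b]) r = (b - a) * r.
  rewrite Rintegral_cst//= lebesgue_measure_itv /= lte_fin mulrC.
  by move: ab; rewrite le_eqVlt => /predU1P[->|->//]; rewrite ltxx subrr mul0r.
by apply: complex_eq; rewrite !(cReM, cImM) /= E mul0r ?subr0 ?addr0.
Qed.

Lemma cintB a b F G : (forall t, a <= t <= b -> pcont F t) ->
  (forall t, a <= t <= b -> pcont G t) ->
  cint a b (fun t => F t - G t) = cint a b F - cint a b G.
Proof.
move=> cF cG; rewrite cintD//; last by move=> t /cG /pcontN.
congr (_ + _); rewrite -[RHS]mulN1r -cintZ//.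
by apply: eq_cint => t _; rewrite mulN1r.
Qed.

Lemma Rint_split a (c : R) b f : a <= c -> c <= b ->
  (forall t, a <= t <= b -> {for t, continuous f}) ->
  \int[mu]_(t in `[a, b]) f t =
  \int[mu]_(t in `[a, c]) f t + \int[mu]_(t in `[c, b]) f t.
Proof.
move=> ac cb H; have iab := cont_integrable H.
have icb : mu.-integrable `[c, b] (EFin \o f).
  by apply: cont_integrable => t /andP[ct tb]; apply: H; rewrite tb (le_trans ac).
rewrite -[X in _ = _ + X]Rintegral_itv_obnd_cbnd; last first.
  by apply: integrableS icb => //; apply: subset_itvr; rewrite bnd_simp.
rewrite -(@Rintegral_itvB R f (BLeft a) (BRight b) c)//.
by rewrite addrC subrK.
Qed.

Lemma cint_split a (c : R) b F : a <= c -> c <= b -> (forall t, a <= t <= b -> pcont F t) ->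
  cint a b F = cint a c F + cint c b F.
Proof.
move=> ac cb H; apply: complex_eq => /=; apply: Rint_split => // t /H.
  exact: pcont_Re.
exact: pcont_Im.
Qed.

End cint.

Arguments Normc.normc : simpl never.

(** * Cauchy's formula and Taylor series *)

Section goursat.
Context {R : realType}.
Local Open Scope complex_scope.
Implicit Types (z w : R[i]) (G : R[i] -> R[i]) (a b c d x y : R).

(** The counterclockwise boundary integral of the rectangle, with opposite sides paired; the factor
    ['i] is the direction of the vertical sides. *)
Definition rectI G a b c d := cint a b (fun x => G (x +i* c) - G (x +i* d)) +
  'i * cint c d (fun y => G (b +i* y) - G (a +i* y)).

Arguments rectI : simpl never.

Lemma pcont_hor c t : pcont (fun x : R => x +i* c) t.
Proof. by apply: pcont_pair => /=; [exact: cvg_id|exact: cvg_cst]. Qed.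

Lemma pcont_ver c t : pcont (fun x : R => c +i* x) t.
Proof. by apply: pcont_pair => /=; [exact: cvg_cst|exact: cvg_id]. Qed.

Section rect.
Variables (G : R[i] -> R[i]) (a b c d : R).
Hypothesis cG : forall x y, a <= x <= b -> c <= y <= d -> ccont G (x +i* y).

Let ph y x : c <= y <= d -> a <= x <= b -> pcont (fun s => G (s +i* y)) x.
Proof. by move=> yc xa; apply: pcont_comp (pcont_hor _ _); exact: cG. Qed.

Let pv x y : a <= x <= b -> c <= y <= d -> pcont (fun s => G (x +i* s)) y.
Proof. by move=> yc xa; apply: pcont_comp (pcont_ver _ _); exact: cG. Qed.

Lemma rectI_splitx m : a <= m <= b -> c <= d ->
  rectI G a b c d = rectI G a m c d + rectI G m b c d.
Proof.
move=> /andP[am mb] cd; have ab := le_trans am mb.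
rewrite /rectI (@cint_split _ a m b)//; last first.
  by move=> t tab; apply: pcontB; apply: ph; rewrite ?lexx ?cd.
have V x y : a <= x <= b -> a <= y <= b -> cint c d (fun s => G (x +i* s) - G (y +i* s)) =
    cint c d (fun s => G (x +i* s)) - cint c d (fun s => G (y +i* s)).
  by move=> xa ya; rewrite cintB// => t; exact: pv.
by rewrite !V ?lexx ?ab ?am ?mb//; ring.
Qed.

Lemma rectI_splity m : c <= m <= d -> a <= b ->
  rectI G a b c d = rectI G a b c m + rectI G a b m d.
Proof.
move=> /andP[am mb] cd; have ab := le_trans am mb.
rewrite /rectI (@cint_split _ c m d)//; last first.
  by move=> t tab; apply: pcontB; apply: pv; rewrite ?lexx ?cd.
have V x y : c <= x <= d -> c <= y <= d -> cint a b (fun s => G (s +i* x) - G (s +i* y)) =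
    cint a b (fun s => G (s +i* x)) - cint a b (fun s => G (s +i* y)).
  by move=> xa ya; rewrite cintB// => t; exact: ph.
by rewrite !V ?lexx ?ab ?am ?mb//; ring.
Qed.

Lemma rectI_bound M : a <= b -> c <= d ->
  (forall x y, a <= x <= b -> c <= y <= d -> nc (G (x +i* y)) <= M) ->
  nc (rectI G a b c d) <= 2 * M * ((b - a) + (d - c)).
Proof.
move=> ab cd H; apply: (le_trans (ncD _ _)); rewrite mulrDr lerD//.
  apply: cint_bound => // t tab.
    by apply: pcontB; apply: ph; rewrite ?lexx ?cd.
  apply: (le_trans (ncD _ _)); rewrite ncN.
  have := H t c tab; have := H t d tab; rewrite !lexx cd => /(_ isT) + /(_ isT).
  lra.
have nci : nc ('i : R[i]) = 1 by rewrite /nc expr0n expr1n add0r sqrtr1.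
rewrite Normc.normcM nci mul1r.
apply: cint_bound => // t tab.
  by apply: pcontB; apply: pv; rewrite ?lexx ?ab.
apply: (le_trans (ncD _ _)); rewrite ncN.
have := H a t _ tab; have := H b t _ tab; rewrite !lexx ab => /(_ isT) + /(_ isT).
lra.
Qed.

End rect.

Lemma rectI_affine (u v : R[i]) a b c d : a <= b -> c <= d ->
  rectI (fun z => u + v * z) a b c d = 0.
Proof.
move=> ab cd; rewrite /rectI.
rewrite (@eq_cint _ _ _ _ (fun=> v * ((c - d) *i))); last first.
  move=> t _; have -> : u + v * (t +i* c) - (u + v * (t +i* d)) =
    v * ((t +i* c) - (t +i* d)) by ring.
  by congr (_ * _); apply: complex_eq => /=; ring.
rewrite [X in _ + _ * X](@eq_cint _ _ _ _ (fun=> v * (b - a)%:C)); last first.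
  move=> t _; have -> : u + v * (b +i* t) - (u + v * (a +i* t)) =
    v * ((b +i* t) - (a +i* t)) by ring.
  by congr (_ * _); apply: complex_eq => /=; ring.
rewrite !cint_cst//.
have -> : (c - d) *i = - ((d - c)%:C * 'i) :> R[i].
  by apply: complex_eq => /=; ring.
ring.
Qed.

Lemma rectI_addf G H a b c d : a <= b -> c <= d ->
  (forall x y, a <= x <= b -> c <= y <= d -> ccont G (x +i* y)) ->
  (forall x y, a <= x <= b -> c <= y <= d -> ccont H (x +i* y)) ->
  rectI (fun z => G z + H z) a b c d = rectI G a b c d + rectI H a b c d.
Proof.
move=> ab cd cG cH; rewrite /rectI.
have hG y x : c <= y <= d -> a <= x <= b -> pcont (fun s => G (s +i* y)) x.
  by move=> yc xa; apply: pcont_comp (pcont_hor _ _); exact: cG.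
have hH y x : c <= y <= d -> a <= x <= b -> pcont (fun s => H (s +i* y)) x.
  by move=> yc xa; apply: pcont_comp (pcont_hor _ _); exact: cH.
have vG x y : a <= x <= b -> c <= y <= d -> pcont (fun s => G (x +i* s)) y.
  by move=> yc xa; apply: pcont_comp (pcont_ver _ _); exact: cG.
have vH x y : a <= x <= b -> c <= y <= d -> pcont (fun s => H (x +i* s)) y.
  by move=> yc xa; apply: pcont_comp (pcont_ver _ _); exact: cH.
have caa : a <= a <= b by rewrite lexx.
have cab : a <= b <= b by rewrite lexx ab.
have ccc : c <= c <= d by rewrite lexx.
have ccd : c <= d <= d by rewrite lexx cd.
rewrite (@eq_cint _ _ _ _ (fun x => (G (x +i* c) - G (x +i* d)) +
  (H (x +i* c) - H (x +i* d)))); last by move=> t _; ring.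
rewrite [X in _ + _ * X](@eq_cint _ _ _ _ (fun y => (G (b +i* y) - G (a +i* y)) +
  (H (b +i* y) - H (a +i* y)))); last by move=> t _; ring.
rewrite !cintD; first by ring.
all: move=> t ht; do ?[apply: pcontB | apply: pcontN]; auto.
Qed.

Lemma nested_interval (x l : nat -> R) : (forall n, 0 <= l n) ->
  (forall n, x n <= x n.+1) -> (forall n, x n.+1 + l n.+1 <= x n + l n) ->
  exists s, forall n, x n <= s <= x n + l n.
Proof.
move=> l0 x1 x2.
have X n k : x n <= x (n + k)%N.
  by elim: k => [|k IH]; rewrite ?addn0// addnS (le_trans IH).
have Y n k : x (n + k)%N + l (n + k)%N <= x n + l n.
  by elim: k => [|k IH]; rewrite ?addn0// addnS (le_trans _ IH).
have Z n m : x n <= x m + l m.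
  case/orP: (leq_total n m) => /subnK; rewrite addnC => E.
    by rewrite -E (le_trans (X n (m - n)%N))// lerDl.
  by rewrite -[in X in X <= _]E (le_trans _ (Y m (n - m)%N))// lerDl.
have hs : has_sup (range x).
  by split; [exists (x 0%N), 0%N|exists (x 0%N + l 0%N) => _ [n _ <-]].
exists (sup (range x)) => n; apply/andP; split.
  by apply: sup_ubound; [exact: hs.2|exists n].
by apply: sup_le_ub; [exact: hs.1|move=> _ [m _ <-]].
Qed.

Lemma half_pow_small (K r : R) : 0 < r -> exists n : nat, K / 2 ^+ n < r.
Proof.
move=> r0; exists (`|Num.ceil (K / r)|.+1)%N.
rewrite ltr_pdivrMr ?exprn_gt0// mulrC -ltr_pdivrMr//.
apply: (le_lt_trans (ceil_ge _)).
apply: (@le_lt_trans _ _ (`|Num.ceil (K / r)|%N%:R)).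
  by rewrite natr_absz ler_int ler_norm.
rewrite -natrX ltr_nat; apply: (@leq_trans `|Num.ceil (K / r)|.+1)%N => //.
by rewrite ltnW// ltn_expl.
Qed.

(** Repeated bisection: one quarter always keeps at least a quarter of the boundary integral, and
    the quarters shrink to a point, where differentiability leaves only a remainder that is small
    compared with the side. *)
Theorem goursat G a b c d : a <= b -> c <= d ->
  (forall x y, a <= x <= b -> c <= y <= d -> exists D, cdiff G (x +i* y) D) ->
  rectI G a b c d = 0.
Proof.
move=> ab cd dG.
have cG x y : a <= x <= b -> c <= y <= d -> ccont G (x +i* y).
  by move=> xab ycd; have [D /cdiff_ccont] := dG x y xab ycd.
pose wd n := (b - a) / 2 ^+ n; pose ht n := (d - c) / 2 ^+ n.
have wd0 n : 0 <= wd n by rewrite divr_ge0 ?subr_ge0 ?exprn_ge0.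
have ht0 n : 0 <= ht n by rewrite divr_ge0 ?subr_ge0 ?exprn_ge0.
have wdS n : wd n = wd n.+1 + wd n.+1 by rewrite /wd exprS; field; rewrite expf_neq0.
have htS n : ht n = ht n.+1 + ht n.+1 by rewrite /ht exprS; field; rewrite expf_neq0.
(* At level [n] all rectangles have sides [wd n] and [ht n], so the lower left corner [p] determines
   them. *)
pose E n (p : R * R) := rectI G p.1 (p.1 + wd n) p.2 (p.2 + ht n).
pose inn n (p : R * R) := [/\ a <= p.1, p.1 + wd n <= b, c <= p.2 & p.2 + ht n <= d].
have step n p : inn n p -> exists p' : R * R,
   [/\ inn n.+1 p', p.1 <= p'.1 <= p.1 + wd n.+1, p.2 <= p'.2 <= p.2 + ht n.+1 &
   nc (E n p) <= 4 * nc (E n.+1 p')].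
  case: p => x y [/= ax xb cy yd].
  have := wd0 n.+1; have := ht0 n.+1; have := wdS n; have := htS n.
  set w := wd n.+1; set h := ht n.+1 => hS wS h0 w0.
  have inr x' y' : x <= x' <= x + wd n -> y <= y' <= y + ht n -> ccont G (x' +i* y').
    by move=> /andP[? ?] /andP[? ?]; apply: cG; lra.
  have q (s t : R) : (s == 0) || (s == w) -> (t == 0) || (t == h) ->
      [/\ inn n.+1 (x + s, y + t), x <= x + s <= x + w & y <= y + t <= y + h].
    rewrite /inn /= -/w -/h.
    by move=> /orP[] /eqP -> /orP[] /eqP ->; rewrite ?addr0; (split; [split| | ]; lra).
  have q1 := q 0 0; have q2 := q 0 h; have q3 := q w 0; have q4 := q w h.
  rewrite !addr0 !eqxx ?orbT in q1 q2 q3 q4.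
  have split4 : E n (x, y) = E n.+1 (x, y) + E n.+1 (x, y + h) + E n.+1 (x + w, y) +
      E n.+1 (x + w, y + h).
    rewrite /E /= -/w -/h.
    rewrite (@rectI_splitx _ _ _ _ _ inr (x + w)); [|lra|lra].
    rewrite (@rectI_splity _ _ _ _ _ _ (y + h)); [| |lra|lra]; last first.
      by move=> x' y' *; apply: inr; lra.
    rewrite [X in _ + X](@rectI_splity _ _ _ _ _ _ (y + h)); [| |lra|lra]; last first.
      by move=> x' y' *; apply: inr; lra.
    by rewrite wS hS !addrA.
  have [n1|n1] := leP (nc (E n (x, y))) (4 * nc (E n.+1 (x, y))).
    by exists (x, y); have [] := q1 isT isT; split.
  have [n2|n2] := leP (nc (E n (x, y))) (4 * nc (E n.+1 (x, y + h))).
    by exists (x, y + h); have [] := q2 isT isT; split.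
  have [n3|n3] := leP (nc (E n (x, y))) (4 * nc (E n.+1 (x + w, y))).
    by exists (x + w, y); have [] := q3 isT isT; split.
  exists (x + w, y + h); have [? ? ?] := q4 isT isT; split=> //; clear q q1 q2 q3 q4.
  move: n1 n2 n3; rewrite split4.
  move: (E n.+1 (x, y)) (E n.+1 (x, y + h)) (E n.+1 (x + w, y)) (E n.+1 (x + w, y + h)).
  move=> e1 e2 e3 e4 n1 n2 n3.
  have := ncD (e1 + e2 + e3) e4; have := ncD (e1 + e2) e3; have := ncD e1 e2.
  by move: n1 n2 n3; lra.
have [u [u0 uP]] : exists u : nat -> R * R, u 0%N = (a, c) /\ forall n,
   [/\ inn n.+1 (u n.+1), (u n).1 <= (u n.+1).1 <= (u n).1 + wd n.+1,
   (u n).2 <= (u n.+1).2 <= (u n).2 + ht n.+1 &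
   nc (E n (u n)) <= 4 * nc (E n.+1 (u n.+1))].
  (* Containment in the original rectangle is carried by the type, so that the choice of a quarter
     can be iterated by recursion. *)
  pose T n := {p : R * R | inn n p}.
  have nx n (p : T n) : {q : T n.+1 | [/\ (sval p).1 <= (sval q).1 <= (sval p).1 + wd n.+1,
     (sval p).2 <= (sval q).2 <= (sval p).2 + ht n.+1 &
     nc (E n (sval p)) <= 4 * nc (E n.+1 (sval q))]}.
    apply: cid; case: p => p /= /step [p' [ip' h1 h2 h3]].
    by exists (exist _ p' ip').
  have i0 : inn 0%N (a, c).
    by split => //=; rewrite ?/wd ?/ht expr0 divr1 addrC subrK.
  pose v := fix v n : T n := if n is m.+1 then sval (nx m (v m)) else exist _ (a, c) i0.
  exists (fun n => sval (v n)); split => // n.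
  have [h1 h2 h3] := svalP (nx n (v n)).
  by split => //; exact: (svalP (v n.+1)).
have inu n : inn n (u n).
  case: n => [|n]; last by have [] := uP n.
  by rewrite u0; split => //=; rewrite ?/wd ?/ht expr0 divr1 addrC subrK.
have [xs xsP] : exists s, forall n, (u n).1 <= s <= (u n).1 + wd n.
  apply: nested_interval => // n; have [_ /andP[h1 h2] _ _] := uP n => //.
  by rewrite [X in _ <= _ + X]wdS addrA lerD2r.
have [ys ysP] : exists s, forall n, (u n).2 <= s <= (u n).2 + ht n.
  apply: nested_interval => // n; have [_ _ /andP[h1 h2] _] := uP n => //.
  by rewrite [X in _ <= _ + X]htS addrA lerD2r.
have NE n : nc (rectI G a b c d) <= 4 ^+ n * nc (E n (u n)).
  elim: n => [|n IH].
    rewrite u0 expr0 mul1r /E /= /wd /ht !expr0 !divr1 [a + _]addrC [c + _]addrC.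
    by rewrite !subrK.
  apply: (le_trans IH); rewrite exprSr -mulrA ler_wpM2l ?exprn_ge0//.
  by have [] := uP n.
have xsab : a <= xs <= b.
  by have := xsP 0%N; have := inu 0%N; move=> [h1 h2 _ _] /andP[h3 h4]; lra.
have ysab : c <= ys <= d.
  by have := ysP 0%N; have := inu 0%N; move=> [_ _ h1 h2] /andP[h3 h4]; lra.
have [D HD] := dG xs ys xsab ysab.
pose K := (b - a) + (d - c).
have K0 : 0 <= K by rewrite addr_ge0// subr_ge0.
(* On a rectangle of half-perimeter [s = K / 2^n] a remainder of size [e s] integrates to at most
   [2 (e s) s]; the [4^n] lost in the bisections cancels the [4^n] in [s^2]. *)
suff H e : 0 < e -> nc (rectI G a b c d) <= 2 * e * K ^+ 2.
  apply: Normc.eq0_normc; apply/eqP; rewrite eq_le nc_ge0 andbT.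
  apply/ler_addgt0Pl => e e0; rewrite addr0.
  have e1 : 0 < e / (2 * (K ^+ 2 + 1)) by rewrite divr_gt0// mulr_gt0// ltr_wpDl ?sqr_ge0.
  apply: (le_trans (H _ e1)).
  have -> : 2 * (e / (2 * (K ^+ 2 + 1))) * K ^+ 2 = e * (K ^+ 2 / (K ^+ 2 + 1)).
    by field; rewrite gt_eqF// ltr_wpDl ?sqr_ge0.
  by rewrite ler_piMr ?ltW// ltr_pdivrMr ?ltr_wpDl ?sqr_ge0// mul1r ltrDl.
move=> e0; have [r r0 Hr] := HD _ e0.
have [n nr] := half_pow_small K r0.
pose s := K / 2 ^+ n.
have sE : s = wd n + ht n by rewrite /s /K mulrDl.
have s0 : 0 <= s by rewrite sE addr_ge0.
have [/= h1 h2 h3 h4] := inu n.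
have close x y : (u n).1 <= x <= (u n).1 + wd n -> (u n).2 <= y <= (u n).2 + ht n ->
    nc ((x +i* y) - (xs +i* ys)) <= s.
  move=> /andP[? ?] /andP[? ?]; apply: (le_trans (nc_le_ReIm _)) => /=.
  have /andP[? ?] := xsP n; have /andP[? ?] := ysP n.
  by rewrite sE lerD// ler_norml; lra.
(* The affine approximation of [G] at the limit point has zero boundary integral, so only the
   remainder [G - A] counts. *)
pose A z := (G (xs +i* ys) - D * (xs +i* ys)) + D * z.
have cA z : ccont A z.
  apply: (@cdiff_ccont _ _ _ (0 + D * 1)); apply: cdiffD; first exact: cdiff_cst.
  by apply: cdiffZ; exact: cdiff_id.
have cu x y : (u n).1 <= x <= (u n).1 + wd n -> (u n).2 <= y <= (u n).2 + ht n ->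
    ccont G (x +i* y).
  by move=> /andP[? ?] /andP[? ?]; apply: cG; lra.
have cGA x y : (u n).1 <= x <= (u n).1 + wd n -> (u n).2 <= y <= (u n).2 + ht n ->
    ccont (fun z => G z - A z) (x +i* y).
  move=> xn yn; have xab : a <= x <= b by move: xn => /andP[? ?]; lra.
  have yab : c <= y <= d by move: yn => /andP[? ?]; lra.
  have [D' HD'] := dG x y xab yab.
  apply: (@cdiff_ccont _ _ _ (D' - (0 + D * 1))); apply: cdiffB => //.
  apply: cdiffD; first exact: cdiff_cst.
  by apply: cdiffZ; exact: cdiff_id.
have EGA : E n (u n) = rectI (fun z => G z - A z) (u n).1 ((u n).1 + wd n) (u n).2 ((u n).2 + ht n).
  rewrite -[RHS]addr0 -(@rectI_affine (G (xs +i* ys) - D * (xs +i* ys)) D (u n).1 ((u n).1 + wd n) (u n).2 ((u n).2 + ht n)) ?lerDl//.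
  rewrite -rectI_addf ?lerDl//; do ?by move=> *; exact: cA.
  have -> // : (fun z => G z - A z + (G (xs +i* ys) - D * (xs +i* ys) + D * z)) = G.
  by apply/funext => z; rewrite -/(A z) subrK.
apply: (le_trans (NE n)).
have := @rectI_bound _ _ _ _ _ cGA (e * s); rewrite !lerDl => /(_ (wd0 n) (ht0 n)).
rewrite -EGA => B.
have {B} /B B : forall x y, (u n).1 <= x <= (u n).1 + wd n -> (u n).2 <= y <= (u n).2 + ht n ->
   nc (G (x +i* y) - A (x +i* y)) <= e * s.
  move=> x y xn yn; have := close x y xn yn; set h := _ - _ => hs.
  have -> : x +i* y = xs +i* ys + h by rewrite /h addrC subrK.
  have := Hr h (le_lt_trans hs nr); rewrite /A.
  have -> : G (xs +i* ys + h) - G (xs +i* ys) - D * h = G (xs +i* ys + h) -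
     (G (xs +i* ys) - D * (xs +i* ys) + D * (xs +i* ys + h)) by ring.
  by move/le_trans; apply; rewrite ler_pM2l.
have P4 : 0 <= (4 : R) ^+ n by rewrite exprn_ge0.
have /le_trans := ler_wpM2l P4 B; apply.
have -> : (4 : R) ^+ n = 2 ^+ n * 2 ^+ n by rewrite -exprMn; congr (_ ^+ _); ring.
have -> : (u n).1 + wd n - (u n).1 + ((u n).2 + ht n - (u n).2) = s by rewrite sE; ring.
rewrite /s le_eqVlt; apply/orP; left; apply/eqP; field.
by rewrite expf_neq0.
Qed.

End goursat.

(** * Integrals over circles *)

Section circle.
Context {R : realType}.
Local Open Scope complex_scope.
Implicit Types (z w : R[i]) (F : R[i] -> R[i]) (r t : R).

(** The integral is taken in the angle, without the factor [i z] of [dz]; this is why Cauchy's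
    kernel appears below as [z / (z - a)]. *)
Definition circ F r := cint 0 (2 * pi) (fun t => F (r%:C * unit_pt t)).

Lemma pcont_circ F r t : ccont F (r%:C * unit_pt t) ->
  pcont (fun s => F (r%:C * unit_pt s)) t.
Proof.
by move=> H; apply: pcont_comp => //; apply: pcontM; [exact: pcont_cst|exact: pcont_unit_pt].
Qed.

Lemma nc_circ r t : 0 <= r -> nc (r%:C * unit_pt t) = r.
Proof. by move=> r0; rewrite Normc.normcM nc_unit_pt mulr1 nc_real ger0_norm. Qed.

(** The exponential maps the rectangle [[ln r1, ln r2] x [0, 2 pi]] onto the annulus. Goursat
    applies to [F \o cexp], and the two horizontal sides cancel by periodicity. *)
Theorem circ_annulus F r1 r2 (rho1 rho2 : R) : 0 <= rho1 -> rho1 < r1 -> r1 <= r2 -> r2 < rho2 ->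
  (forall z, rho1 < nc z < rho2 -> exists d, cdiff F z d) ->
  circ F r1 = circ F r2.
Proof.
move=> p0 p1 r12 p2 H.
have r10 : 0 < r1 by exact: le_lt_trans p1.
have r20 : 0 < r2 by exact: lt_le_trans r12.
pose G w := F (cexp w).
have pi0 : 0 <= 2 * pi :> R by rewrite mulr_ge0// pi_ge0.
have l12 : ln r1 <= ln r2 by rewrite ler_ln.
have dG x y : ln r1 <= x <= ln r2 -> (0:R) <= y <= 2 * pi -> exists D, cdiff G (x +i* y) D.
  move=> /andP[h1 h2] _; have [|d Hd] := H (cexp (x +i* y)).
    rewrite nc_cexp /=; apply/andP; split.
      by rewrite (lt_le_trans p1)// -[X in X <= _]lnK ?posrE// ler_expR.
    by rewrite (le_lt_trans _ p2)// -[X in _ <= X]lnK ?posrE// ler_expR.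
  by exists (d * cexp (x +i* y)); apply: cdiff_comp => //; exact: cdiff_cexp.
have := goursat l12 pi0 dG.
have cG r y : r1 <= r <= r2 -> pcont (fun t => F (r%:C * unit_pt t)) y.
  move=> /andP[h1 h2]; apply: pcont_circ.
  have [|d /cdiff_ccont//] := H (r%:C * unit_pt y).
  by rewrite nc_circ ?(le_trans (ltW r10))// (lt_le_trans p1)//= (le_lt_trans h2).
rewrite /rectI (@eq_cint _ _ _ _ (fun=> 0)); last first.
  by move=> x _; rewrite /G /cexp /= unit_pt2pi unit_pt0 subrr.
rewrite cint_cst// mulr0 add0r /G /cexp /= !lnK ?posrE// => /eqP.
rewrite mulf_eq0 => /orP[/eqP[] /eqP|]; first by rewrite oner_eq0.
rewrite cintB; [|by move=> *; apply: cG; rewrite lexx r12|by move=> *; apply: cG; rewrite lexx r12].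
by rewrite subr_eq0 => /eqP.
Qed.

End circle.

Section circle_continuity.
Context {R : realType}.
Local Open Scope complex_scope.
Implicit Types (z w : R[i]) (G F : R[i] -> R[i]) (r t : R).
Local Notation mu := (@lebesgue_measure R).

(** Compactness of the rectangle of polar parameters; the bound later dominates circle integrals and
    Cauchy integrals. *)
Lemma polar_bounded G (r1 r2 : R) : r1 <= r2 ->
  (forall r t, r1 <= r <= r2 -> ccont G (r%:C * unit_pt t)) ->
  exists B, forall r t, r1 <= r <= r2 -> 0 <= t <= 2 * pi ->
    nc (G (r%:C * unit_pt t)) <= B.
Proof.
move=> r12 cG.
pose A : set (R * R) := `[r1, r2]%classic `*` `[0, 2 * pi]%classic.
pose g (p : R * R) := nc (G (p.1%:C * unit_pt p.2)).
have cA : compact A by apply: compact_setX; exact: segment_compact.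
have A0 : A !=set0.
  by exists (r1, 0); split; rewrite /= in_itv /= lexx ?r12// mulr_ge0// pi_ge0.
have [|p pA Hp] := @compact_EVT_max _ R g A A0 cA.
  apply: continuous_in_subspaceT => p; rewrite inE => -[/=].
  rewrite !in_itv /= => hp _.
  apply/cvgrPdist_le => e e0; have [r' r'0 H] := cG p.1 p.2 hp e e0.
  have h2 : 0 < r' / 2 by rewrite divr_gt0.
  have ca : (fun q : R * R => q.1 * cos q.2) q @[q --> p] --> p.1 * cos p.2.
    apply: cvgM; first exact: cvg_fst.
    by apply: continuous_comp; [exact: cvg_snd|exact: continuous_cos].
  have cb : (fun q : R * R => q.1 * sin q.2) q @[q --> p] --> p.1 * sin p.2.
    apply: cvgM; first exact: cvg_fst.
    by apply: continuous_comp; [exact: cvg_snd|exact: continuous_sin].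
  move/cvgrPdist_lt : ca => /(_ _ h2) ca; move/cvgrPdist_lt : cb => /(_ _ h2) cb.
  near=> q.
  have qa : `|p.1 * cos p.2 - q.1 * cos q.2| < r' / 2 by near: q.
  have qb : `|p.1 * sin p.2 - q.1 * sin q.2| < r' / 2 by near: q.
  have hq : nc (q.1%:C * unit_pt q.2 - p.1%:C * unit_pt p.2) < r'.
    have -> : q.1%:C * unit_pt q.2 - p.1%:C * unit_pt p.2 =
      (q.1 * cos q.2 - p.1 * cos p.2) +i* (q.1 * sin q.2 - p.1 * sin p.2).
      by apply: complex_eq => /=; ring.
    apply: (le_lt_trans (nc_le_ReIm _)) => /=.
    by rewrite distrC [X in _ + X]distrC; move: qa qb; lra.
  have := H _ hq; rewrite (addrC (p.1%:C * _)) subrK distrC /g.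
  move: (G (q.1%:C * _)) (G (p.1%:C * _)) => u v K.
  have := ncBD v (u - v); have := ncBD u (v - u); rewrite !(addrC _ (_ - _)) !subrK.
  by rewrite (ncB v) => h3 h4; rewrite ler_norml; lra.
exists (g p) => r t hr ht; apply: (Hp (r, t)).
by rewrite inE; split; rewrite /= in_itv.
Unshelve. all: by end_near.
Qed.

(** Dominated convergence. It extends the value of circle integrals to a circle through a point
    where the integrand is known only to be continuous. *)
Lemma circ_lim G (r1 r2 : R) (u : nat -> R) (r0 : R) c :
  (forall r t, r1 <= r <= r2 -> ccont G (r%:C * unit_pt t)) ->
  (forall n, r1 <= u n <= r2) -> u n @[n --> \oo] --> r0 -> r1 <= r0 <= r2 ->
  (forall n, circ G (u n) = c) -> circ G r0 = c.
Proof.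
move=> cG ur cu r0r E.
have [|B HB] := polar_bounded _ cG.
  by have /andP[h1 h2] := ur 0%N; exact: le_trans h2.
have B0 : 0 <= B.
  by apply: le_trans (HB r0 0 r0r _); rewrite ?nc_ge0// lexx mulr_ge0 ?pi_ge0.
have pc r t : r1 <= r <= r2 -> pcont (fun s => G (r%:C * unit_pt s)) t.
  by move=> h; apply: pcont_circ; exact: cG.
have key (P : R[i] -> R) : (forall (F : R -> R[i]) t, pcont F t -> {for t, continuous (fun s => P (F s))}) ->
    (forall z, `|P z| <= nc z) -> (forall z w, P (z - w) = P z - P w) ->
    (forall n, \int[mu]_(t in `[0, 2 * pi]) P (G ((u n)%:C * unit_pt t)) = P c) ->
    \int[mu]_(t in `[0, 2 * pi]) P (G (r0%:C * unit_pt t)) = P c.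
  move=> Pc Pn PB EP.
  have iP r : r1 <= r <= r2 ->
      mu.-integrable `[0, 2 * pi] (EFin \o (fun t => P (G (r%:C * unit_pt t)))).
    by move=> hr; apply: cont_integrable => t _; apply: Pc; exact: pc.
  have [|||||_ _] := @dominated_convergence _ _ R mu `[0, 2 * pi]%classic (measurable_itv _)
    (fun n t => (P (G ((u n)%:C * unit_pt t)))%:E) (fun t => (P (G (r0%:C * unit_pt t)))%:E)
    (cst B%:E).
  - by move=> n; exact: measurable_int (iP _ (ur n)).
  - exact: measurable_int (iP _ r0r).
  - apply: aeW => t _; apply: cvg_EFin; first by near=> n.
    apply/cvgrPdist_le => e e0; have [d d0 Hd] := cG r0 t r0r e e0.
    move/cvgrPdist_lt : cu => /(_ _ d0) cu.
    near=> n; rewrite /= -PB; apply: (le_trans (Pn _)); rewrite ncB.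
    have -> : (u n)%:C * unit_pt t = r0%:C * unit_pt t + ((u n)%:C - r0%:C) * unit_pt t by ring.
    apply: Hd; rewrite Normc.normcM nc_unit_pt mulr1 -raddfB nc_real distrC.
    by near: n.
  - apply/integrableP; split; first exact: measurable_cst.
    rewrite integral_cst//= lebesgue_measure_itv /=.
    by case: ifP => _; rewrite ?mule0 ?ltry// -EFinM ltry.
  - apply: aeW => t n tI; rewrite lee_fin; apply: (le_trans (Pn _)); apply: HB => //.
  move=> H; rewrite /Rintegral.
  have -> : (\int[mu]_(t in `[0%R, (2 * pi)%R]) (P (G (r0%:C * unit_pt t)))%:E)%E = (P c)%:E.
    apply/esym; apply: cvg_unique H => //.
    rewrite [X in X @ _](_ : _ = cst (P c)%:E); first exact: cvg_cst.
    apply/funext => n /=; rewrite -(EP n) fineK//; apply: integrable_fin_num => //.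
    exact: iP.
  by [].
apply: complex_eq => /=.
  apply: (key (@complex.Re R)) => [F t|z|z w|n]; [exact: pcont_Re|exact: Re_le_nc|by rewrite raddfB|].
  by rewrite -(E n).
apply: (key (@complex.Im R)) => [F t|z|z w|n]; [exact: pcont_Im|exact: Im_le_nc|by rewrite raddfB|].
by rewrite -(E n).
Unshelve. all: by end_near.
Qed.

End circle_continuity.

Section circ_lin.
Context {R : realType}.
Local Open Scope complex_scope.
Implicit Types (z w c : R[i]) (G F : R[i] -> R[i]) (r t : R).

Let tpi0 : 0 <= 2 * pi :> R. Proof. by rewrite mulr_ge0// pi_ge0. Qed.

Lemma eq_circ F G r : 0 <= r -> (forall z, nc z = r -> F z = G z) -> circ F r = circ G r.
Proof. by move=> r0 H; apply: eq_cint => t _; apply: H; rewrite nc_circ. Qed.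

Lemma circ_bound F r M : 0 <= r -> (forall z, nc z = r -> ccont F z) ->
  (forall z, nc z = r -> nc (F z) <= M) -> nc (circ F r) <= M * (2 * pi).
Proof.
move=> r0 cF bF; rewrite -[2 * pi]subr0; apply: cint_bound => // t _.
  by apply: pcont_circ; apply: cF; rewrite nc_circ.
by apply: bF; rewrite nc_circ.
Qed.

Lemma circD F G r : 0 <= r -> (forall z, nc z = r -> ccont F z) ->
  (forall z, nc z = r -> ccont G z) -> circ (fun z => F z + G z) r = circ F r + circ G r.
Proof.
by move=> r0 cF cG; apply: cintD => t _; apply: pcont_circ; [apply: cF|apply: cG]; rewrite nc_circ.
Qed.

Lemma circB F G r : 0 <= r -> (forall z, nc z = r -> ccont F z) ->
  (forall z, nc z = r -> ccont G z) -> circ (fun z => F z - G z) r = circ F r - circ G r.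
Proof.
by move=> r0 cF cG; apply: cintB => t _; apply: pcont_circ; [apply: cF|apply: cG]; rewrite nc_circ.
Qed.

Lemma circZ c F r : 0 <= r -> (forall z, nc z = r -> ccont F z) ->
  circ (fun z => c * F z) r = c * circ F r.
Proof.
by move=> r0 cF; apply: cintZ => t _; apply: pcont_circ; apply: cF; rewrite nc_circ.
Qed.

Lemma circ_cst c r : circ (fun=> c) r = (2 * pi)%:C * c.
Proof. by rewrite /circ cint_cst// subr0. Qed.

Lemma polar_form z : exists2 t : R, 0 <= t <= 2 * pi & z = (nc z)%:C * unit_pt t.
Proof.
have [->|z0] := eqVneq z 0.
  by exists 0; rewrite ?lexx// Normc.normc0 mul0r.
have n0 : 0 < nc z by rewrite nc_gt0.
set x := complex.Re z; set y := complex.Im z; set n := nc z.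
have xn : -1 <= x / n <= 1.
  have := Re_le_nc z; rewrite -/x -/n ler_norml => /andP[h1 h2].
  by rewrite ler_pdivlMr// ler_pdivrMr// mul1r mulN1r h1.
have nE : n ^+ 2 = x ^+ 2 + y ^+ 2 by exact: nc_sqr.
have sE : Num.sqrt (1 - (x / n) ^+ 2) = `|y| / n.
  have -> : 1 - (x / n) ^+ 2 = (`|y| / n) ^+ 2.
    rewrite !expr_div_n real_normK ?num_real// nE; field.
    by rewrite -nE expf_neq0// gt_eqF.
  by rewrite sqrtr_sqr ger0_norm// divr_ge0// ltW.
have zE t : cos t = x / n -> sin t = y / n -> z = n%:C * unit_pt t.
  move=> ct st; rewrite /unit_pt ct st; apply: complex_eq => /=.
    by rewrite mul0r subr0 mulrC divfK// gt_eqF.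
  by rewrite mul0r addr0 mulrC divfK// gt_eqF.
have a0 := acos_ge0 xn; have a1 := acos_lepi xn; have p0 := @pi_ge0 R.
have [y0|y0] := leP 0 y.
  exists (acos (x / n)); first by rewrite a0 /=; lra.
  by apply: zE; rewrite ?acosK ?in_itv// sin_acos// sE ger0_norm.
exists (2 * pi - acos (x / n)); first by lra.
have E : 2 * pi - acos (x / n) = - acos (x / n) + pi *+ 2 by rewrite -mulr_natl; ring.
apply: zE; rewrite E.
  by rewrite cosD2pi cosN acosK ?in_itv.
by rewrite sinD2pi sinN sin_acos// sE ltr0_norm// mulNr opprK.
Qed.

End circ_lin.

Section geometric.
Context {R : realType}.

Lemma geo_small (q e : R) : 0 <= q < 1 -> 0 < e ->
  exists N, forall n, (N <= n)%N -> q ^+ n <= e.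
Proof.
move=> /andP[q0 q1] e0.
have /cvgrPdist_le/(_ _ e0) [N _ HN] := @cvg_expr R q (etrans (congr1 (fun x => x < 1) (ger0_norm q0)) q1).
exists N => n Nn; have := HN n Nn; rewrite /= sub0r normrN ger0_norm// exprn_ge0//.
Qed.

End geometric.

(** * Cauchy's formula *)

Section cauchy.
Context {R : realType}.
Local Open Scope complex_scope.
Implicit Types (z w a : R[i]) (f G F : R[i] -> R[i]) (r t : R).

Definition cholo f z := exists d, cdiff f z d.

Definition csums (u : nat -> R[i]) (l : R[i]) := forall e : R, 0 < e ->
  exists N, forall n, (N <= n)%N -> nc (\sum_(0 <= k < n) u k - l) <= e.

Let tpi0 : 0 <= 2 * pi :> R. Proof. by rewrite mulr_ge0// pi_ge0. Qed.
Let tpi1 : 0 < 2 * pi :> R. Proof. by rewrite mulr_gt0// pi_gt0. Qed.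

Lemma cholo_ccont f z : cholo f z -> ccont f z.
Proof. by case=> d /cdiff_ccont. Qed.

Lemma le_of_eps (x K : R) : 0 <= K -> (forall e, 0 < e -> x <= e * K) -> x <= 0.
Proof.
move=> K0 H; apply/ler_addgt0Pl => e e0; rewrite addr0.
have K1 : 0 < K + 1 by rewrite ltr_wpDl.
apply: (le_trans (H _ (divr_gt0 e0 K1))); rewrite mulrAC ler_pdivrMr//.
by rewrite ler_pM2l// lerDl.
Qed.

(** The integral does not depend on the radius outside [|a|], and the kernel tends to [1] as the
    radius tends to infinity. *)
Lemma circ_kernel a r : nc a < r -> circ (fun z => z / (z - a)) r = (2 * pi)%:C.
Proof.
move=> ar; have a0 := nc_ge0 a; have r0 : 0 < r by exact: le_lt_trans ar.
have za z : nc a < nc z -> z - a != 0.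
  by rewrite subr_eq0; apply: contraTneq => ->; rewrite ltxx.
have dK z : nc a < nc z -> cholo (fun z => z / (z - a)) z.
  move=> /za h; eexists; apply: cdiffM; first exact: cdiff_id.
  by apply: cdiffV => //; apply: cdiffB; [exact: cdiff_id|exact: cdiff_cst].
have E s : r <= s -> circ (fun z => z / (z - a)) r = circ (fun z => z / (z - a)) s.
  move=> rs; apply: (@circ_annulus _ _ _ _ (nc a) (s + 1)) => //.
    by rewrite ltrDl.
  by move=> z /andP[h _]; exact: dK.
apply/eqP; rewrite -subr_eq0 -[_ == 0]negbK -nc_gt0 -leNgt.
apply: (@le_of_eps _ (nc a * (2 * pi))); first by rewrite mulr_ge0.
(* This radius keeps [|z - a|] above [e^-1], so that [z / (z - a) - 1 = a / (z - a)] is at most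
   [e |a|]. *)
move=> e e0; pose s := nc a + r + e^-1.
have s0 : 0 < e^-1 by rewrite invr_gt0.
have rs : r <= s by rewrite /s; move: s0 a0 r0; lra.
have as' : nc a < s by rewrite (lt_le_trans ar).
rewrite (E s rs) -[(2 * pi)%:C]mulr1 -(circ_cst 1 s) -circB; last 3 first.
- by rewrite (le_trans (ltW r0)).
- by move=> z zs; apply: cholo_ccont; apply: dK; rewrite zs.
- by move=> z _; apply: cdiff_ccont; exact: cdiff_cst.
rewrite mulrA; apply: circ_bound; first by rewrite (le_trans (ltW r0)).
  move=> z zs; apply: cholo_ccont.
  have [d Hd] : cholo (fun z => z / (z - a)) z by apply: dK; rewrite zs.
  by exists (d - 0); apply: cdiffB => //; exact: cdiff_cst.
move=> z zs; have h : z - a != 0 by apply: za; rewrite zs.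
have -> : z / (z - a) - 1 = a / (z - a) by field.
rewrite Normc.normcM Normc.normcV mulrC ler_wpM2r//.
have h2 : e^-1 <= nc (z - a).
  have := ncBD z (- a); rewrite ncN zs /s; move: r0 s0; lra.
by rewrite -[X in _ <= X]invrK lef_pV2// posrE ?(lt_le_trans s0).
Qed.

Section punctured.
Variables (f : R[i] -> R[i]).
Hypothesis df : forall z, 0 < nc z < 1 -> cholo f z.
Hypothesis cf : ccont f 0.

(** The difference quotient [G] at [a], times [z], has circle integral zero: this holds on circles
    inside [|a|], passes to the circle through [a] by continuity, and persists outside. At the
    origin only continuity of [f] is used, which is what later removes singularities. *)
Lemma cauchy_formula a r : 0 < nc a -> nc a < r -> r < 1 ->
  circ (fun z => f z * (z / (z - a))) r = (2 * pi)%:C * f a.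
Proof.
move=> a0 ar r1; have a1 : nc a < 1 by exact: lt_trans r1.
have r0 : 0 < r by exact: lt_trans ar.
have [d Hd] : cholo f a by apply: df; rewrite a0.
(* The factor [z] comes from integrating in the angle; it also makes [G] small near the origin. *)
pose G z := if z == a then d * a else (f z - f a) / (z - a) * z.
have GE z : z != a -> G z = (f z - f a) / (z - a) * z by move=> /negbTE h; rewrite /G h.
have za z : nc z != nc a -> z != a by apply: contraNneq => ->.
have dG z : 0 < nc z < 1 -> z != a -> cholo G z.
  move=> z01 zna; have [d' Hd'] := df z01.
  eexists; apply: (@cdiff_ext _ (nc (z - a)) (fun z => (f z - f a) / (z - a) * z)).
  - by rewrite nc_gt0 subr_eq0.
  - move=> h hr; rewrite GE//; apply/eqP => E; move: hr.
    by rewrite -E opprD addNKr ncN ltxx.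
  - apply: cdiffM; last exact: cdiff_id.
    apply: cdiffM; first by apply: cdiffB; [exact: Hd'|exact: cdiff_cst].
    apply: cdiffV; first by rewrite subr_eq0.
    by apply: cdiffB; [exact: cdiff_id|exact: cdiff_cst].
have cGa : ccont G a.
  move=> e e0; pose K := nc a + 1; have K0 : 0 < K by rewrite ltr_wpDl ?nc_ge0.
  have e1 : 0 < e / (2 * K) by rewrite divr_gt0// mulr_gt0.
  have [s s0 Hs] := Hd _ e1.
  have nd : 0 < nc d + 1 by rewrite ltr_wpDl ?nc_ge0.
  exists (Num.min s (Num.min 1 (e / (2 * (nc d + 1))))).
    by rewrite !lt_min s0 ltr01 /= divr_gt0// mulr_gt0.
  move=> h; rewrite !lt_min => /and3P[/Hs hs h1 h2].
  have [->|h0] := eqVneq h 0; first by rewrite addr0 subrr Normc.normc0 ltW.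
  rewrite GE; last by rewrite -subr_eq0 addrC addKr.
  have -> : G a = d * a by rewrite /G eqxx.
  have -> : (f (a + h) - f a) / (a + h - a) * (a + h) - d * a =
    (f (a + h) - f a - d * h) / h * (a + h) + d * h.
    by rewrite (addrC a) addrK; field.
  apply: (le_trans (ncD _ _)); rewrite !Normc.normcM Normc.normcV.
  have q1 : nc (f (a + h) - f a - d * h) / nc h <= e / (2 * K).
    by rewrite ler_pdivrMr ?nc_gt0.
  have q2 : nc (a + h) <= K by rewrite (le_trans (ncD _ _))// lerD2l ltW.
  have q3 : nc (f (a + h) - f a - d * h) / nc h * nc (a + h) <= e / 2.
    have -> : e / 2 = e / (2 * K) * K by field; rewrite gt_eqF.
    by rewrite ler_pM// ?nc_ge0// divr_ge0 ?nc_ge0.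
  have q4 : nc d * nc h <= e / 2.
    have -> : e / 2 = (nc d + 1) * (e / (2 * (nc d + 1))) by field; rewrite gt_eqF.
    by rewrite ler_pM ?nc_ge0 ?lerDl// ltW.
  by move: q3 q4; lra.
have cG z : 0 < nc z < 1 -> ccont G z.
  move=> z01; have [->//|zna] := eqVneq z a; exact/cholo_ccont/dG.
(* Inside [|a|] the integral is constant in the radius, and on [|z| = u] the factor [z] bounds [G]
   by [M u]; so the constant is zero. *)
have Gin s : 0 < s -> s < nc a -> circ G s = 0.
  move=> s0 sa.
  have E u : 0 < u -> u <= s -> circ G u = circ G s.
    move=> u0 us; apply: (@circ_annulus _ _ _ _ 0 (nc a)) => // z /andP[h1 h2].
    by apply: dG; [rewrite h1 (lt_trans h2)|apply: za; rewrite lt_eqF].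
  apply/eqP; rewrite -[_ == 0]negbK -nc_gt0 -leNgt.
  have [p p0 Hp] := cf ltr01.
  pose M := (nc (f 0) + 1 + nc (f a)) / (nc a / 2).
  have M0 : 0 <= M by rewrite !(divr_ge0, addr_ge0)// nc_ge0.
  apply: (@le_of_eps _ (M * (2 * pi))); first by rewrite mulr_ge0.
  move=> e e0; pose u := Num.min (Num.min e s) (Num.min (p / 2) (nc a / 2)).
  have u0 : 0 < u by rewrite !lt_min e0 s0 !divr_gt0.
  have [ue us up ua] : [/\ u <= e, u <= s, u <= p / 2 & u <= nc a / 2].
    by rewrite /u; split; rewrite !ge_min lexx ?orbT.
  rewrite -(E u)// mulrA; apply: circ_bound; first exact: ltW.
    move=> z zu; apply: cG; rewrite zu u0 (le_lt_trans us)// (lt_trans sa)//.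
  move=> z zu; rewrite GE; last by apply: za; rewrite zu; move: ua a0; lra.
  rewrite !Normc.normcM Normc.normcV zu mulrC ler_pM//.
  - exact: ltW.
  - by rewrite divr_ge0// nc_ge0.
  rewrite /M ler_pM ?nc_ge0// ?invr_ge0 ?nc_ge0//.
    apply: (le_trans (ncD _ _)); rewrite ncN lerD2r.
    have := Hp z; rewrite zu add0r => /(_ _) K.
    have {}K : nc (f z - f 0) <= 1 by apply: K; move: up p0; lra.
    by have := ncD (f z - f 0) (f 0); rewrite subrK; move: K; lra.
  have h : nc a / 2 <= nc (z - a).
    by have := ncBD a (- z); rewrite ncN zu ncB; move: ua; lra.
  by rewrite lef_pV2// posrE ?(lt_le_trans _ h)// divr_gt0.
pose sq (n : nat) : R := (n.+1%:R)^-1.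
have sq0 n : 0 < sq n by rewrite invr_gt0.
have sq1 n : sq n <= 1 by rewrite invf_le1// ler1n.
have csq c : (nc a + c * sq n) @[n --> \oo] --> nc a.
  rewrite -[X in _ --> X]addr0; apply: cvgD; first exact: cvg_cst.
  rewrite -[X in _ --> X](mulr0 c); apply: cvgM; first exact: cvg_cst.
  exact: cvg_harmonic.
have cGr r1' r2' : 0 < r1' -> r2' < 1 -> forall s t, r1' <= s <= r2' ->
    ccont G (s%:C * unit_pt t).
  move=> h1 h2 s t /andP[h3 h4]; apply: cG; rewrite nc_circ ?(lt_le_trans h1)//=.
    exact: le_lt_trans h2.
  by rewrite (le_trans (ltW h1)).
(* The annulus argument stops at [|a|], where [G] is only continuous; radii increasing to [|a|]
   reach this circle, and radii decreasing to [|a|] leave it again. *)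
have Ga : circ G (nc a) = 0.
  have a2 : 0 < nc a / 2 by rewrite divr_gt0.
  have B n : nc a / 2 <= nc a + - (nc a / 2) * sq n < nc a.
    have := sq0 n; have := sq1 n => h1 h2.
    have : nc a / 2 * sq n <= nc a / 2 * 1 by rewrite ler_pM2l.
    have : 0 < nc a / 2 * sq n by rewrite mulr_gt0.
    by rewrite mulNr; lra.
  apply: (@circ_lim _ G (nc a / 2) (nc a) (fun n => nc a + - (nc a / 2) * sq n)).
  - exact: cGr.
  - by move=> n; have /andP[-> /ltW] := B n.
  - exact: csq.
  - by move: a2; lra.
  - by move=> n; have /andP[h1 h2] := B n; apply: Gin => //; apply: lt_le_trans h1.
have Gr : circ G r = 0.
  rewrite -Ga; apply/esym.
  have B n : nc a < nc a + (r - nc a) * sq n <= r.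
    have := sq0 n; have := sq1 n => h1 h2.
    have ra : 0 < r - nc a by rewrite subr_gt0.
    have : (r - nc a) * sq n <= (r - nc a) * 1 by rewrite ler_pM2l.
    have : 0 < (r - nc a) * sq n by rewrite mulr_gt0.
    by lra.
  apply: (@circ_lim _ G (nc a) r (fun n => nc a + (r - nc a) * sq n)).
  - exact: cGr.
  - by move=> n; have /andP[/ltW -> ] := B n.
  - exact: csq.
  - by rewrite lexx ltW.
  - move=> n; have /andP[h1 h2] := B n.
    apply: (@circ_annulus _ _ _ _ (nc a) 1); rewrite ?nc_ge0// => z /andP[h3 h4].
    by apply: dG; [rewrite (lt_trans a0)|apply: za; rewrite gt_eqF].
have ck z : nc z = r -> ccont (fun z => z / (z - a)) z.
  move=> zr; apply: cholo_ccont; eexists; apply: cdiffM; first exact: cdiff_id.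
  apply: cdiffV; first by rewrite subr_eq0; apply: za; rewrite zr gt_eqF.
  by apply: cdiffB; [exact: cdiff_id|exact: cdiff_cst].
have cfk z : nc z = r -> ccont (fun z => f z * (z / (z - a))) z.
  move=> zr; apply: cholo_ccont; have [|d' Hd'] := @df z; first by rewrite zr r0.
  eexists; apply: cdiffM; first exact: Hd'.
  apply: cdiffM; first exact: cdiff_id.
  apply: cdiffV; first by rewrite subr_eq0; apply: za; rewrite zr gt_eqF.
  by apply: cdiffB; [exact: cdiff_id|exact: cdiff_cst].
have cak z : nc z = r -> ccont (fun z => f a * (z / (z - a))) z.
  move=> zr; apply: cholo_ccont; eexists; apply: cdiffZ; apply: cdiffM; first exact: cdiff_id.
  apply: cdiffV; first by rewrite subr_eq0; apply: za; rewrite zr gt_eqF.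
  by apply: cdiffB; [exact: cdiff_id|exact: cdiff_cst].
rewrite [RHS]mulrC -(circ_kernel ar) -circZ ?ltW//.
apply/eqP; rewrite -subr_eq0 -circB ?ltW// -Gr; apply/eqP; apply: eq_circ; first exact: ltW.
by move=> z zr; rewrite GE; [ring|apply: za; rewrite zr gt_eqF].
Qed.

End punctured.

End cauchy.

(** * Power series convergent in the unit disk *)

Section power_series.
Context {R : realType}.
Local Open Scope complex_scope.
Implicit Types (z w h : R[i]) (f G F : R[i] -> R[i]) (r t : R) (a : nat -> R[i]).

(** Radius of convergence at least one, stated by boundedness: a slightly larger radius turns the
    bound into geometric decay. *)
Definition ps_coef a := forall r, 0 < r < 1 -> exists K, forall n, nc (a n) * r ^+ n <= K.

Definition dcoef a n : R[i] := n.+1%:R * a n.+1.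

Definition psum a z : R[i] := xget 0 [set l | csums (fun n => a n * z ^+ n) l].

Lemma csums_exists (u : nat -> R[i]) (K q : R) : 0 <= q < 1 ->
  (forall n, nc (u n) <= K * q ^+ n) -> exists l, csums u l.
Proof.
move=> /andP[q0 q1] H.
have K0 : 0 <= K by have := H 0%N; rewrite expr0 mulr1; apply: le_trans; exact: nc_ge0.
have key (P : R[i] -> R) : (forall z, `|P z| <= nc z) ->
    exists l, forall e, 0 < e -> exists N, forall n, (N <= n)%N ->
    `|\sum_(0 <= k < n) P (u k) - l| <= e.
  move=> Pn.
  have : cvgn (series (fun n => P (u n))).
    apply: (@normed_cvg R R^o); apply: series_le_cvg (@is_cvg_geometric_series R K q _).
    - by move=> n /=; exact: normr_ge0.
    - by move=> n; rewrite /geometric /= mulr_ge0// exprn_ge0.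
    - by move=> n; apply: (le_trans (Pn _)); exact: H.
    - by rewrite ger0_norm.
  move=> /cvg_ex [l Hl]; exists l => e e0.
  move/cvgrPdist_le : Hl => /(_ _ e0) [N _ HN]; exists N => n Nn.
  by rewrite distrC; exact: (HN n Nn).
have [l1 H1] := key _ (@Re_le_nc R); have [l2 H2] := key _ (@Im_le_nc R).
exists (l1 +i* l2) => e e0; have e2 : 0 < e / 2 by rewrite divr_gt0.
have [N HN] := H1 _ e2; have [M HM] := H2 _ e2.
exists (maxn N M) => n; rewrite geq_max => /andP[/HN h1 /HM h2].
apply: (le_trans (nc_le_ReIm _)); rewrite !raddfB /= !raddf_sum /=.
by move: h1 h2; lra.
Qed.

Lemma ps_geo a z : ps_coef a -> nc z < 1 -> exists K q, 0 <= q < 1 /\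
  forall n, nc (a n * z ^+ n) <= K * q ^+ n.
Proof.
move=> pa z1; have z0 := nc_ge0 z.
have [|K HK] := pa ((nc z + 1) / 2); first by move: z0 z1; lra.
have r0 : 0 < (nc z + 1) / 2 by move: z0; lra.
exists K, (nc z / ((nc z + 1) / 2)); split.
  by rewrite divr_ge0 ?(ltW r0)//= ltr_pdivrMr// mul1r; move: z1; lra.
move=> n; rewrite Normc.normcM ncX expr_div_n mulrA ler_pdivlMr ?exprn_gt0//.
by rewrite mulrAC ler_wpM2r ?exprn_ge0.
Qed.

Lemma psumP a z : ps_coef a -> nc z < 1 -> csums (fun n => a n * z ^+ n) (psum a z).
Proof.
move=> pa z1; have [K [q [q01 H]]] := ps_geo pa z1.
have [l Hl] := csums_exists q01 H.
by apply: (@xgetPex _ 0 [set l | csums (fun n => a n * z ^+ n) l]); exists l.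
Qed.

(** Two terms of the binomial expansion. It absorbs the factor [n.+1] of a derived series at the
    price of a larger radius. *)
Lemma nexp_le (x y : R) n : 0 <= x -> 0 <= y -> n.+1%:R * x ^+ n * y <= (x + y) ^+ n.+1.
Proof.
move=> x0 y0; suff : x ^+ n.+1 + n.+1%:R * x ^+ n * y <= (x + y) ^+ n.+1.
  by apply: le_trans; rewrite lerDr exprn_ge0.
elim: n => [|n IH]; first by rewrite expr0 !expr1; lra.
rewrite [X in _ <= X]exprS; apply: le_trans (ler_wpM2l (addr_ge0 x0 y0) IH).
have : 0 <= n.+1%:R * x ^+ n * y * y by rewrite !mulr_ge0// exprn_ge0.
rewrite -[n.+2%:R]natr1 !exprS; move: (n.+1%:R * x ^+ n) (x ^+ n) => u v; nra.
Qed.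

Lemma dcoef_ps a : ps_coef a -> ps_coef (dcoef a).
Proof.
move=> pa r /andP[r0 r1]; have [|K HK] := pa ((r + 1) / 2); first by lra.
have e0 : 0 < (1 - r) / 2 by lra.
exists (K / ((1 - r) / 2)) => n; rewrite ler_pdivlMr// /dcoef Normc.normcM.
rewrite nc_nat; apply: le_trans (HK n.+1).
rewrite [n.+1%:R * _]mulrC -!mulrA ler_wpM2l ?nc_ge0//.
have -> : (r + 1) / 2 = r + (1 - r) / 2 by lra.
by rewrite mulrA; apply: nexp_le; exact: ltW.
Qed.

(** In the binomial remainder every power of [h] is at least the second, and
    [|h|^k <= (|h| / y)^2 y^k] for [k >= 2]. The bound is thus quadratic in [h] and geometric in
    [n]. *)
Lemma exp_taylor2 z h n (y : R) : nc h <= y -> 0 < y ->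
  nc ((z + h) ^+ n - z ^+ n - n%:R * z ^+ n.-1 * h) <= (nc h / y) ^+ 2 * (nc z + y) ^+ n.
Proof.
move=> hy y0.
suff H : nc ((z + h) ^+ n - z ^+ n - n%:R * z ^+ n.-1 * h) <=
    (nc h / y) ^+ 2 * ((nc z + y) ^+ n - nc z ^+ n - n%:R * nc z ^+ n.-1 * y).
  apply: (le_trans H); rewrite ler_wpM2l ?sqr_ge0// -addrA gerDl -opprD oppr_le0.
  by rewrite addr_ge0 ?exprn_ge0 ?nc_ge0// !mulr_ge0 ?exprn_ge0 ?nc_ge0// ltW.
elim: n => [|n IH].
  by rewrite !expr0 !mul0r !subr0 !subrr Normc.normc0 mulr0.
(* A recurrence for the second-order remainder, stated over any commutative ring because it is
   applied both to [z, h] and to the moduli [nc z, y]. *)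
have step (T : comRingType) (u v : T) : (u + v) ^+ n.+1 - u ^+ n.+1 - n.+1%:R * u ^+ n * v =
  (u + v) * ((u + v) ^+ n - u ^+ n - n%:R * u ^+ n.-1 * v) + n%:R * u ^+ n.-1 * v * v.
  case: (n) => [|m] /=; first by rewrite !expr0 !expr1; ring.
  by rewrite -[m.+2%:R]natr1 !exprS; ring.
rewrite /= !step; apply: (le_trans (ncD _ _)); rewrite [X in _ <= X]mulrDr lerD//.
  rewrite Normc.normcM mulrCA ler_pM ?nc_ge0//.
  by rewrite (le_trans (ncD _ _))// lerD2l.
rewrite !Normc.normcM nc_nat ncX le_eqVlt; apply/orP; left; apply/eqP.
by field; rewrite gt_eqF.
Qed.

Lemma geo_sum_le (q : R) n : 0 <= q < 1 -> \sum_(0 <= k < n) q ^+ k <= (1 - q)^-1.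
Proof.
move=> /andP[q0 q1]; have d0 : 0 < 1 - q by rewrite subr_gt0.
rewrite -[X in _ <= X]mul1r ler_pdivlMr//.
have -> : (\sum_(0 <= k < n) q ^+ k) * (1 - q) = 1 - q ^+ n.
  elim: n => [|n IH]; first by rewrite big_geq// mul0r expr0 subrr.
  by rewrite big_nat_recr//= mulrDl IH exprS; ring.
by rewrite gerBl exprn_ge0.
Qed.

(** The remainder of every partial sum is at most [B |h|^2] with [B] independent of its length, so
    the limit inherits the bound. Taking [f] and [g] as arbitrary sums lets the lemma apply to a
    given function as well as to [psum]. *)
Lemma ps_cdiff a f g z : ps_coef a ->
  (forall w, nc w < 1 -> csums (fun n => a n * w ^+ n) (f w)) ->
  (forall w, nc w < 1 -> csums (fun n => dcoef a n * w ^+ n) (g w)) ->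
  nc z < 1 -> cdiff f z (g z).
Proof.
move=> pa Hf Hg z1; have z0 := nc_ge0 z.
pose y := (1 - nc z) / 2; have y0 : 0 < y by rewrite /y; lra.
pose rho := nc z + y; have rho1 : rho < 1 by rewrite /rho /y; lra.
have rho0 : 0 < rho by rewrite /rho; lra.
have [|K HK] := pa ((rho + 1) / 2); first by lra.
have r0 : 0 < (rho + 1) / 2 by lra.
pose q := rho / ((rho + 1) / 2).
have q01 : 0 <= q < 1.
  by rewrite divr_ge0 ?(ltW r0) ?(ltW rho0)//= ltr_pdivrMr// mul1r; lra.
have d0 : 0 < 1 - q by have /andP[_] := q01; rewrite subr_gt0.
have K0 : 0 <= K by apply: le_trans (HK 0%N); rewrite expr0 mulr1 nc_ge0.
have aK n : nc (a n) * rho ^+ n <= K * q ^+ n.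
  rewrite /q expr_div_n mulrA ler_pdivlMr ?exprn_gt0// mulrAC.
  by rewrite ler_wpM2r// exprn_ge0// ltW.
pose B := K / (1 - q) / y ^+ 2.
have B0 : 0 <= B by rewrite !divr_ge0 ?sqr_ge0// ltW.
have bound h : nc h <= y -> nc h < 1 - nc z -> nc (f (z + h) - f z - g z * h) <= B * nc h ^+ 2.
  move=> hy hz; rewrite -subr_le0; apply: (@le_of_eps _ _ (2 + nc h)).
    by rewrite addr_ge0 ?nc_ge0.
  move=> e e0; rewrite lerBlDr.
  have zh1 : nc (z + h) < 1 by apply: (le_lt_trans (ncD _ _)); lra.
  have [N1 H1] := Hf _ zh1 e e0; have [N2 H2] := Hf _ z1 e e0; have [N3 H3] := Hg _ z1 e e0.
  pose N := maxn N1 (maxn N2 N3).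
  have {}H1 := H1 N.+1 (leqW (leq_maxl _ _)).
  have {}H2 := H2 N.+1 (leqW (leq_trans (leq_maxl _ _) (leq_maxr _ _))).
  have {}H3 := H3 N (leq_trans (leq_maxr _ _) (leq_maxr _ _)).
  move: H1 H2 H3; set S1 := \sum_(_ <= _ < _) _; set S2 := \sum_(_ <= _ < _) _.
  set S3 := \sum_(_ <= _ < _) _ => H1 H2 H3.
  have -> : f (z + h) - f z - g z * h = (S1 - S2 - S3 * h) +
    (S2 - f z) + ((S3 - g z) * h - (S1 - f (z + h))) by ring.
  apply: (le_trans (ncD _ _)).
  have E1 : nc (S1 - S2 - S3 * h) <= B * nc h ^+ 2.
    have S3E : S3 * h = \sum_(0 <= k < N.+1) a k * (k%:R * z ^+ k.-1 * h).
      rewrite big_nat_recl//= !mul0r mulr0 add0r mulr_suml; apply: eq_bigr => k _.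
      by rewrite /dcoef; ring.
    rewrite S3E /S1 /S2 -!sumrB; apply: (le_trans (nc_sum _ _)).
    have -> : B * nc h ^+ 2 = (K / (1 - q)) * (nc h / y) ^+ 2.
      have gen (k m n v : R) : k / m / v * n = k / m * (n / v).
        by rewrite -mulrA [_^-1 * n]mulrC.
      by rewrite /B [(nc h / y) ^+ 2]expr_div_n gen.
    apply: (@le_trans _ _ (\sum_(0 <= k < N.+1) (K * (nc h / y) ^+ 2) * q ^+ k)).
      apply: ler_sum => k _.
      have -> : a k * (z + h) ^+ k - a k * z ^+ k - a k * (k%:R * z ^+ k.-1 * h) =
        a k * ((z + h) ^+ k - z ^+ k - k%:R * z ^+ k.-1 * h) by ring.
      rewrite Normc.normcM.
      have /le_trans := ler_wpM2l (nc_ge0 (a k)) (exp_taylor2 z k hy y0); apply.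
      rewrite mulrCA [X in _ <= X]mulrAC [X in _ <= X]mulrC ler_wpM2l ?sqr_ge0//.
    rewrite -mulr_sumr [X in _ <= X]mulrAC (ler_wpM2l (mulr_ge0 K0 (sqr_ge0 _)))//.
    exact: geo_sum_le.
  have := ncD (S1 - S2 - S3 * h) (S2 - f z).
  have := ncD ((S3 - g z) * h) (- (S1 - f (z + h))).
  rewrite ncN Normc.normcM.
  have : nc (S3 - g z) * nc h <= e * nc h by rewrite ler_wpM2r// nc_ge0.
  by move: E1 H1 H2; lra.
move=> e e0; have B1 : 0 < B + 1 by rewrite ltr_wpDl.
exists (Num.min y (e / (B + 1))); first by rewrite lt_min y0 divr_gt0.
move=> h; rewrite lt_min => /andP[hy he].
apply: (le_trans (bound h (ltW hy) _)); first by move: hy; rewrite /y; lra.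
rewrite expr2 mulrA ler_wpM2r ?nc_ge0//.
move: he; rewrite ltr_pdivlMr// => he; have := nc_ge0 h; nra.
Qed.

Lemma psum_cdiff a z : ps_coef a -> nc z < 1 -> cdiff (psum a) z (psum (dcoef a) z).
Proof.
move=> pa z1; apply: (ps_cdiff pa) => // w w1; apply: psumP => //.
exact: dcoef_ps.
Qed.

End power_series.

(** * Taylor expansion and removable singularities *)

Section taylor.
Context {R : realType}.
Local Open Scope complex_scope.
Implicit Types (z w h : R[i]) (f G F : R[i] -> R[i]) (r t : R) (a : nat -> R[i]).

Let tpi0 : 0 <= 2 * pi :> R. Proof. by rewrite mulr_ge0// pi_ge0. Qed.
Let tpi1 : 0 < 2 * pi :> R. Proof. by rewrite mulr_gt0// pi_gt0. Qed.
Let tpiC : (2 * pi)%:C != 0 :> R[i].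
Proof. by rewrite -nc_gt0 nc_real ger0_norm. Qed.

(** Cauchy's integral for the coefficient; the radius [2^-1] is one choice among all of []0, 1[]. *)
Definition tcoef f n : R[i] := ((2 * pi)%:C)^-1 * circ (fun z => f z * z ^- n) 2^-1.

Definition holoD f := forall z, nc z < 1 -> cholo f z.

Lemma cdiff_exprn z n : cdiff (fun x => x ^+ n) z (n%:R * z ^+ n.-1).
Proof.
case: n => [|n]; first by rewrite mul0r; under eq_fun do rewrite expr0; exact: cdiff_cst.
by have := @cdiffX R id z 1 n (cdiff_id z); rewrite mulr1.
Qed.

Lemma cdiff_exprVn z n : z != 0 -> cholo (fun x => x ^- n) z.
Proof.
by move=> z0; eexists; apply: cdiffV; [rewrite expf_neq0|exact: cdiff_exprn].
Qed.

Lemma cholo_M f G z : cholo f z -> cholo G z -> cholo (fun x => f x * G x) z.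
Proof. by move=> [d Hd] [e He]; eexists; exact: cdiffM Hd He. Qed.

Section punctured.
Variables (f : R[i] -> R[i]).
Hypothesis df : forall z, 0 < nc z < 1 -> cholo f z.
Hypothesis cf : ccont f 0.

Let nc_neq0 z r : 0 < r -> nc z = r -> z != 0.
Proof. by move=> r0 zr; rewrite -nc_gt0 zr. Qed.

Lemma circle_bound r : 0 < r < 1 -> exists B, forall z, nc z = r -> nc (f z) <= B.
Proof.
move=> /andP[r0 r1].
have [|B HB] := @polar_bounded _ f r r (lexx _).
  move=> s t; rewrite -eq_le => /eqP <-; apply: cholo_ccont; apply: df.
  by rewrite nc_circ ?ltW// r0.
exists B => z zr; have [t ht ->] := polar_form z.
by rewrite zr; apply: HB => //; rewrite lexx.
Qed.

Lemma tcoefE r n : 0 < r < 1 ->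
  tcoef f n = ((2 * pi)%:C)^-1 * circ (fun z => f z * z ^- n) r.
Proof.
move=> /andP[r0 r1].
have H s s' : 0 < s -> s <= s' -> s' < 1 ->
    circ (fun z => f z * z ^- n) s = circ (fun z => f z * z ^- n) s'.
  move=> s0 ss' s1; apply: (@circ_annulus _ _ _ _ 0 1) => // z /andP[h1 h2].
  by apply: cholo_M; [apply: df; rewrite h1|apply: cdiff_exprVn; rewrite -nc_gt0].
have h0 : 0 < 2^-1 :> R by rewrite invr_gt0.
have h1 : 2^-1 < 1 :> R by rewrite invf_lt1// ltr1n.
by rewrite /tcoef; case/orP : (le_total 2^-1 r) => ?; [rewrite (H 2^-1 r)|rewrite (H r 2^-1)].
Qed.

Lemma tcoef_ps : ps_coef (tcoef f).
Proof.
move=> r /[dup] r01 /andP[r0 r1]; have [B HB] := circle_bound r01.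
exists B => n; rewrite (tcoefE _ r01) Normc.normcM Normc.normcV nc_real ger0_norm//.
rewrite -mulrA ler_pdivrMl//.
have rn0 : 0 < r ^+ n by rewrite exprn_gt0.
rewrite -ler_pdivlMr//.
have -> : 2 * pi * B / r ^+ n = (B / r ^+ n) * (2 * pi) by rewrite mulrAC [RHS]mulrC mulrA mulrAC.
apply: circ_bound; first exact: ltW.
  move=> z zr; apply: cholo_ccont; apply: cholo_M; first by apply: df; rewrite zr r0.
  by apply: cdiff_exprVn; rewrite (nc_neq0 r0).
by move=> z zr; rewrite Normc.normcM Normc.normcV ncX zr ler_pM2r ?invr_gt0// HB.
Qed.

(** Letting the radius of the mean value tend to zero uses only continuity at the origin. *)
Lemma taylor0 : tcoef f 0 = f 0.
Proof.
apply/eqP; rewrite -subr_eq0 -[_ == 0]negbK -nc_gt0 -leNgt.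
apply: (@le_of_eps _ _ 1) => // e e0; rewrite mulr1.
have [s s0 Hs] := cf e0.
pose r := Num.min (s / 2) 2^-1.
have r0 : 0 < r by rewrite lt_min invr_gt0 ltr0n divr_gt0.
have rs : r < s by rewrite gt_min; apply/orP; left; lra.
have r1 : r < 1 by rewrite gt_min; apply/orP; right; lra.
rewrite (@tcoefE r); last by rewrite r0.
have cfr z : nc z = r -> ccont (fun z => f z * z ^- 0) z.
  move=> zr; apply: cholo_ccont; apply: cholo_M; first by apply: df; rewrite zr r0.
  by apply: cdiff_exprVn; rewrite (nc_neq0 r0).
have -> : ((2 * pi)%:C)^-1 * circ (fun z => f z * z ^- 0) r - f 0 =
  ((2 * pi)%:C)^-1 * (circ (fun z => f z * z ^- 0) r - circ (fun=> f 0) r).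
  by rewrite circ_cst mulrBr mulKf.
rewrite -circB ?(ltW r0)//; last by move=> z _; apply: cdiff_ccont; exact: cdiff_cst.
rewrite Normc.normcM Normc.normcV nc_real ger0_norm// mulrC ler_pdivrMr//.
apply: circ_bound; first exact: ltW.
  move=> z zr; apply: cholo_ccont.
  have [d Hd] : cholo (fun z => f z * z ^- 0) z.
    apply: cholo_M; first by apply: df; rewrite zr r0.
    by apply: cdiff_exprVn; rewrite (nc_neq0 r0).
  by exists (d - 0); apply: cdiffB => //; exact: cdiff_cst.
move=> z zr; rewrite expr0 invr1 mulr1.
by have := Hs z; rewrite add0r zr => /(_ rs).
Qed.

(** Iterating [z / (z - a) = 1 + (a / z) (z / (z - a))] in Cauchy's formula gives an exact
    remainder, of size [(|a| / r)^n]. *)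
Theorem taylor (a : R[i]) : nc a < 1 -> csums (fun n => tcoef f n * a ^+ n) (f a).
Proof.
move=> a1; have [->|a0] := eqVneq a 0.
  move=> e e0; exists 1%N => -[|n] // _.
  rewrite big_nat_recl//= expr0 mulr1 taylor0 big1 ?addr0 ?subrr ?Normc.normc0 ?ltW//.
  by move=> k _; rewrite exprS mul0r mulr0.
have na0 : 0 < nc a by rewrite nc_gt0.
pose r := (nc a + 1) / 2.
have ar : nc a < r by rewrite /r; lra.
have r1 : r < 1 by rewrite /r; lra.
have r0 : 0 < r by exact: lt_trans ar.
have r01 : 0 < r < 1 by rewrite r0.
clearbody r.
have [B HB] := circle_bound r01.
have B0 : 0 <= B by apply: le_trans (HB (r%:C) _); rewrite ?nc_ge0// nc_real ger0_norm// ltW.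
have za z : nc z = r -> z - a != 0.
  by move=> zr; rewrite subr_eq0; apply: contraTneq ar => <-; rewrite zr ltxx.
have hk z : nc z = r -> cholo (fun z => z / (z - a)) z.
  move=> zr; eexists; apply: cdiffM; first exact: cdiff_id.
  by apply: cdiffV; [exact: za|apply: cdiffB; [exact: cdiff_id|exact: cdiff_cst]].
have hf z : nc z = r -> cholo f z by move=> zr; apply: df; rewrite zr r0.
have hn z n : nc z = r -> cholo (fun z => z ^- n) z.
  by move=> zr; apply: cdiff_exprVn; rewrite (nc_neq0 r0).
(* For [n = 0] this is Cauchy's formula; each further step splits off one Taylor coefficient. *)
have PS n : \sum_(0 <= k < n) tcoef f k * a ^+ k - f a =
   - (((2 * pi)%:C)^-1 * (a ^+ n * circ (fun z => f z * z ^- n * (z / (z - a))) r)).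
  elim: n => [|n IH].
    rewrite big_geq// sub0r expr0 mul1r.
    under [X in circ X]eq_fun do rewrite expr0 invr1 mulr1.
    by rewrite cauchy_formula// mulKf.
  rewrite big_nat_recr//= addrAC IH (tcoefE _ r01) -mulrA (mulrC _ (a ^+ n)).
  have -> : circ (fun z => f z * z ^- n * (z / (z - a))) r =
     circ (fun z => f z * z ^- n) r + a * circ (fun z => f z * z ^- n.+1 * (z / (z - a))) r.
    rewrite -circZ ?ltW//; last first.
      by move=> z zr; apply: cholo_ccont; apply: cholo_M (hk _ zr); apply: cholo_M; auto.
    rewrite -circD ?ltW//; last 2 first.
    - by move=> z zr; apply: cholo_ccont; apply: cholo_M; auto.
    - move=> z zr; apply: cholo_ccont; apply: cholo_M; last by apply: cholo_M (hk _ zr); apply: cholo_M; auto.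
      by exists 0; exact: cdiff_cst.
    apply: eq_circ; first exact: ltW.
    move=> z zr; rewrite exprS; field.
    by rewrite za// expf_neq0 ?(nc_neq0 r0).
  by rewrite exprS; ring.
pose q := nc a / r.
have q01 : 0 <= q < 1 by rewrite divr_ge0 ?nc_ge0 ?ltW//= ltr_pdivrMr// mul1r.
pose M := B * (r / (r - nc a)).
have ra0 : 0 < r - nc a by rewrite subr_gt0.
have M0 : 0 <= M by rewrite mulr_ge0// divr_ge0 ?(ltW r0) ?(ltW ra0).
have M1 : 0 < M + 1 by rewrite ltr_wpDl.
move=> e e0; have [N HN] := geo_small q01 (divr_gt0 e0 M1).
exists N => n /HN Hn; rewrite PS ncN !Normc.normcM Normc.normcV nc_real ger0_norm// ncX.
rewrite mulrC ler_pdivrMr//.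
have CB : nc (circ (fun z => f z * z ^- n * (z / (z - a))) r) <= M / r ^+ n * (2 * pi).
  apply: circ_bound; first exact: ltW.
    by move=> z zr; apply: cholo_ccont; apply: cholo_M (hk _ zr); apply: cholo_M; auto.
  move=> z zr; rewrite !Normc.normcM !Normc.normcV ncX zr /M.
  have -> : B * (r / (r - nc a)) / r ^+ n = (B / r ^+ n) * (r / (r - nc a)) by ring.
  have nza : r - nc a <= nc (z - a) by have := ncBD z (- a); rewrite ncN zr.
  have nz0 : 0 < nc (z - a) by exact: lt_le_trans nza.
  rewrite ler_pM ?mulr_ge0 ?invr_ge0 ?nc_ge0 ?exprn_ge0 ?(ltW r0)//.
    by rewrite ler_wpM2r ?invr_ge0 ?exprn_ge0 ?(ltW r0)// HB.
  by rewrite ler_wpM2l ?(ltW r0)// lef_pV2.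
have an0 : 0 <= nc a ^+ n by rewrite exprn_ge0// nc_ge0.
have /le_trans := ler_wpM2l an0 CB; apply.
have -> : nc a ^+ n * (M / r ^+ n * (2 * pi)) = (q ^+ n * M) * (2 * pi).
  by rewrite /q expr_div_n; ring.
rewrite ler_pM2r//; have : q ^+ n * M <= e / (M + 1) * M by rewrite ler_wpM2r.
move/le_trans; apply; rewrite mulrAC ler_pdivrMr// ler_pM2l// lerDl//.
Qed.

Lemma taylor_cdiff z : nc z < 1 -> cdiff f z (psum (dcoef (tcoef f)) z).
Proof.
move=> z1; apply: (ps_cdiff tcoef_ps) => // w w1; first exact: taylor.
by apply: psumP => //; exact/dcoef_ps/tcoef_ps.
Qed.

(** The Taylor expansion also holds at the origin, where [f] was only continuous, and a sum of a
    power series is differentiable there. *)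
Lemma removable : holoD f.
Proof. by move=> z z1; eexists; exact: taylor_cdiff. Qed.

End punctured.

Lemma holoD_punct f : holoD f -> (forall z, 0 < nc z < 1 -> cholo f z) /\ ccont f 0.
Proof.
move=> H; split=> [z /andP[_ /H]//|]; apply: cholo_ccont; apply: H.
by rewrite Normc.normc0.
Qed.

Lemma holoD_taylor f : holoD f -> ps_coef (tcoef f) /\
  forall z, nc z < 1 -> csums (fun n => tcoef f n * z ^+ n) (f z).
Proof.
move=> /holoD_punct[df cf]; split; first exact: tcoef_ps.
by move=> z z1; exact: taylor.
Qed.

Lemma holoD_deriv f : holoD f -> exists2 g, holoD g & forall z, nc z < 1 -> cdiff f z (g z).
Proof.
move=> /holoD_punct[df cf]; exists (psum (dcoef (tcoef f))).
  move=> z z1; eexists; apply: psum_cdiff => //.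
  exact/dcoef_ps/tcoef_ps.
by move=> z z1; exact: taylor_cdiff.
Qed.

Lemma holoD_primitive f : holoD f -> exists F, forall z, nc z < 1 -> cdiff F z (f z).
Proof.
move=> /holoD_taylor[pa Hf].
pose b n : R[i] := if n is m.+1 then tcoef f m / m.+1%:R else 0.
have db : dcoef b = tcoef f.
  by apply/funext => n; rewrite /dcoef /b mulrC divfK// pnatr_eq0.
have pb : ps_coef b.
  move=> r /[dup] r01 /andP[r0 r1]; have [K HK] := pa r r01.
  exists K => -[|n] /=; first by rewrite Normc.normc0 mul0r (le_trans _ (HK 0%N))// mulr_ge0 ?nc_ge0 ?exprn_ge0 ?ltW.
  apply: le_trans (HK n); rewrite Normc.normcM Normc.normcV nc_nat exprS.
  rewrite -mulrA ler_wpM2l ?nc_ge0// mulrA ler_piMl ?exprn_ge0 ?(ltW r0)//.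
  by rewrite mulrC ler_pdivrMr ?ltr0n// mul1r (le_trans (ltW r1))// ler1n.
exists (psum b) => z z1; apply: (ps_cdiff pb) => // w w1; first exact: psumP.
by rewrite db; exact: Hf.
Qed.

End taylor.

(** * Zero-free and univalent functions *)

Section log_branch.
Context {R : realType}.
Local Open Scope complex_scope.
Implicit Types (z w h : R[i]) (f G F : R[i] -> R[i]) (r t : R).
Local Notation mu := (@lebesgue_measure R).

Let tpi0 : 0 <= 2 * pi :> R. Proof. by rewrite mulr_ge0// pi_ge0. Qed.
Let tpi1 : 0 < 2 * pi :> R. Proof. by rewrite mulr_gt0// pi_gt0. Qed.
Let tpiC : (2 * pi)%:C != 0 :> R[i].
Proof. by rewrite -nc_gt0 nc_real ger0_norm. Qed.

Lemma circ_mean f r : holoD f -> 0 < r < 1 -> circ f r = (2 * pi)%:C * f 0.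
Proof.
move=> /holoD_punct[df cf] r01.
rewrite -(taylor0 df cf) (tcoefE df _ r01) mulVKf//.
apply: eq_circ; first by case/andP : r01 => /ltW.
by move=> z _; rewrite expr0 invr1 mulr1.
Qed.

Lemma ray_derive_Re f r w d : cdiff f (r%:C * w) d ->
  is_derive r 1 (fun s => complex.Re (f (s%:C * w))) (complex.Re (d * w)).
Proof.
move=> H; apply/is_derive_eps => e e0.
have K0 : 0 < nc w + 1 by rewrite ltr_wpDl ?nc_ge0.
have [s s0 Hs] := H _ (divr_gt0 e0 K0).
exists (s / (nc w + 1)); first exact: divr_gt0.
move=> h; rewrite ltr_pdivlMr// => hs.
have hw : nc (h%:C * w) = `|h| * nc w by rewrite Normc.normcM nc_real.
have := Hs (h%:C * w); rewrite hw => /(_ _)/le_trans K.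
have {}K : nc (f (r%:C * w + h%:C * w) - f (r%:C * w) - d * (h%:C * w)) <= e * `|h|.
  apply: K; first by apply: le_lt_trans hs; rewrite ler_wpM2l// lerDl.
  rewrite mulrAC ler_pdivrMr// -mulrA ler_pM2l//.
  by rewrite ler_wpM2l// lerDl.
apply: le_trans K; apply: le_trans (Re_le_nc _).
rewrite !raddfB /= -mulrDl -rmorphD /=.
by rewrite le_eqVlt; apply/orP; left; apply/eqP; congr `| _ |; congr (_ - _); rewrite mulrCA !cReM /= ; ring.
Qed.

Lemma ray_derive_Im f r w d : cdiff f (r%:C * w) d ->
  is_derive r 1 (fun s => complex.Im (f (s%:C * w))) (complex.Im (d * w)).
Proof.
move=> H; have := @ray_derive_Re (fun z => - 'i * f z) r w (- 'i * d) (cdiffZ _ H).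
have E x : complex.Re (- 'i * x) = complex.Im x :> R by rewrite cReM /= !oppr0 mul0r sub0r mulN1r opprK.
by rewrite -mulrA E; under eq_fun do rewrite E.
Qed.

Lemma cdiff0_cst f (rho : R) : (forall z, nc z < rho -> cdiff f z 0) ->
  forall z, nc z < rho -> f z = f 0.
Proof.
move=> H z zr.
have sz s : 0 <= s <= 1 -> nc (s%:C * z) < rho.
  move=> /andP[s0 s1]; rewrite Normc.normcM nc_real ger0_norm//.
  by apply: le_lt_trans zr; rewrite ler_piMl ?nc_ge0.
have key (P : R -> R) : (forall s : R, 0 <= s <= 1 -> is_derive s 1 P 0) -> P 1 = P 0.
  move=> dP.
  have [||c _] := @MVT_segment R P (fun=> 0) 0 1 ler01.
  - by move=> s /=; rewrite in_itv /= => /andP[/ltW s0 /ltW s1]; apply: dP; rewrite s0.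
  - apply: continuous_in_subspaceT => s; rewrite inE /= in_itv /= => s01.
    by apply: differentiable_continuous; apply/derivable1_diffP; have [] := dP s s01.
  by rewrite mul0r => /eqP; rewrite subr_eq0 => /eqP.
have h1 : f z = f (1%:C * z) by rewrite mul1r.
have h0 : f 0 = f (0%:C * z) by rewrite mul0r.
rewrite h1 h0; apply: complex_eq.
  apply: (key (fun s => complex.Re (f (s%:C * z)))) => s s01.
  have := @ray_derive_Re f s z 0 (H _ (sz _ s01)); by rewrite mul0r.
apply: (key (fun s => complex.Im (f (s%:C * z)))) => s s01.
have := @ray_derive_Im f s z 0 (H _ (sz _ s01)); by rewrite mul0r.
Qed.

(** [L] is the primitive of [G' / G] vanishing at [0]; then [G exp (- L)] has zero derivative, hence
    is constant. *)
Lemma log_branch G : holoD G -> (forall z, nc z < 1 -> G z != 0) ->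
  exists L, [/\ holoD L, L 0 = 0 & forall z, nc z < 1 -> G z = G 0 * cexp (L z)].
Proof.
move=> hG G0; have [dG hdG HdG] := holoD_deriv hG.
have hQ : holoD (fun z => dG z / G z).
  move=> z z1; have [d Hd] := hdG z z1; eexists; apply: cdiffM; first exact: Hd.
  by apply: cdiffV (HdG _ z1); exact: G0.
have [F HF] := holoD_primitive hQ.
have dL z : nc z < 1 -> cdiff (fun z => F z - F 0) z (dG z / G z).
  by move=> z1; rewrite -[X in cdiff _ _ X]subr0; apply: cdiffB (HF _ z1) _; exact: cdiff_cst.
exists (fun z => F z - F 0); split; [by move=> z z1; eexists; exact: dL|by rewrite subrr|].
have := @cdiff0_cst (fun z => G z * cexp (- (F z - F 0))) 1.
move=> K z z1; have {K} := K _ z z1.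
rewrite subrr oppr0 cexp0 mulr1 cexpN => K.
rewrite -K; first by rewrite divfK// cexp_neq0.
move=> {K z1}z z1; have := cdiffM (HdG z z1) (cdiff_comp (cdiffN (dL z z1)) (cdiff_cexp _)).
congr (cdiff _ _ _); rewrite /=; field; exact: G0.
Qed.

(** By [log_branch], [ln |G|] is a constant plus the real part of a holomorphic function, which has
    the mean value property. *)
Lemma jensen_zero_free G r : holoD G -> (forall z, nc z < 1 -> G z != 0) -> 0 < r < 1 ->
  mu.-integrable `[0, 2 * pi] (EFin \o (fun t => ln (nc (G (r%:C * unit_pt t))))) /\
  \int[mu]_(t in `[0, 2 * pi]) ln (nc (G (r%:C * unit_pt t))) = 2 * pi * ln (nc (G 0)).
Proof.
move=> hG G0 /[dup] r01 /andP[r0 r1]; have [L [hL L0 GL]] := log_branch hG G0.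
have n1 t : nc (r%:C * unit_pt t) < 1 by rewrite nc_circ// ltW.
have E t : ln (nc (G (r%:C * unit_pt t))) =
    ln (nc (G 0)) + complex.Re (L (r%:C * unit_pt t)).
  rewrite GL// Normc.normcM nc_cexp lnM ?posrE ?expR_gt0 ?expRK// nc_gt0 G0//.
  by rewrite Normc.normc0.
have pL t : pcont (fun s => L (r%:C * unit_pt s)) t.
  by apply: pcont_circ; apply: cholo_ccont; exact: hL.
have iL : mu.-integrable `[0, 2 * pi] (EFin \o (fun t => complex.Re (L (r%:C * unit_pt t)))).
  by apply: cont_integrable => t _; apply: pcont_Re; exact: pL.
have ic : mu.-integrable `[0, 2 * pi] (EFin \o (fun t : R => ln (nc (G 0)))).
  by apply: cont_integrable => t _; exact: cvg_cst.
split.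
  have -> : (fun t => ln (nc (G (r%:C * unit_pt t)))) =
    (fun t => ln (nc (G 0)) + complex.Re (L (r%:C * unit_pt t))) by apply/funext => t; rewrite E.
  apply: cont_integrable => t _; apply: cvgD; first exact: cvg_cst.
  by apply: pcont_Re; exact: pL.
under eq_Rintegral do rewrite E.
rewrite RintegralD//.
have := circ_mean hL r01; rewrite L0 mulr0 => /(congr1 (@complex.Re R)) /= ->.
rewrite addr0 Rintegral_cst//= lebesgue_measure_itv /= lte_fin tpi1 /= subr0.
by rewrite mulrC.
Qed.

End log_branch.

(** * Difference quotients of univalent functions *)

Section univalent.
Context {R : realType}.
Local Open Scope complex_scope.
Implicit Types (z w h a d : R[i]) (f G F : R[i] -> R[i]) (r t : R).

Let tpi0 : 0 <= 2 * pi :> R. Proof. by rewrite mulr_ge0// pi_ge0. Qed.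
Let tpi1 : 0 < 2 * pi :> R. Proof. by rewrite mulr_gt0// pi_gt0. Qed.

Definition injD f := forall z w, nc z < 1 -> nc w < 1 -> f z = f w -> z = w.

Definition dquot f a d z := if z == a then d else (f z - f a) / (z - a).

Lemma cholo_comp f F z : cholo f z -> cholo F (f z) -> cholo (fun x => F (f x)) z.
Proof. by move=> [d Hd] [e He]; eexists; exact: cdiff_comp Hd He. Qed.

Lemma cdiff_affine a d z : cdiff (fun x => a + d * x) z d.
Proof.
have := cdiffD (cdiff_cst a z) (cdiffZ d (cdiff_id z)).
by rewrite mulr1 add0r.
Qed.

(** Away from [a] this is the quotient rule. Near [a], a disk about [a] is rescaled to the unit disk
    so that [removable], which concerns the origin, applies. *)
Lemma dquot_holo f a d : holoD f -> nc a < 1 -> cdiff f a d -> holoD (dquot f a d).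
Proof.
move=> hf a1 Hd.
have off z : nc z < 1 -> z != a -> cholo (dquot f a d) z.
  move=> z1 za; have [d' Hd'] := hf z z1; eexists.
  apply: (@cdiff_ext _ (nc (z - a)) (fun z => (f z - f a) / (z - a))).
  - by rewrite nc_gt0 subr_eq0.
  - move=> h hr; rewrite /dquot; case: eqP => // E; move: hr.
    by rewrite -E opprD addNKr ncN ltxx.
  - apply: cdiffM; first by apply: cdiffB; [exact: Hd'|exact: cdiff_cst].
    apply: cdiffV; first by rewrite subr_eq0.
    by apply: cdiffB; [exact: cdiff_id|exact: cdiff_cst].
move=> z z1; have [->|za] := eqVneq z a; last exact: off.
pose r := (1 - nc a) / 2; have r0 : 0 < r by rewrite /r; move: a1; lra.
have rC : r%:C != 0 by rewrite -nc_gt0 nc_real gtr0_norm.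
pose F w := dquot f a d (a + r%:C * w).
have in1 w : nc w < 1 -> nc (a + r%:C * w) < 1.
  move=> w1; apply: (le_lt_trans (ncD _ _)); rewrite Normc.normcM nc_real gtr0_norm//.
  have : r * nc w <= r * 1 by rewrite ler_pM2l// ltW.
  by rewrite /r; move: a1; lra.
have hF : holoD F.
  apply: removable => [w /andP[w0 w1]|].
    apply: cholo_comp; first by eexists; exact: cdiff_affine.
    apply: off; first exact: in1.
    by rewrite -subr_eq0 addrC addKr mulf_neq0// -nc_gt0.
  move=> e e0; have [s s0 Hs] := Hd e e0.
  exists (s / r); first exact: divr_gt0.
  move=> h hs; rewrite add0r /F mulr0 addr0 {2}/dquot eqxx.
  have [->|h0] := eqVneq h 0; first by rewrite mulr0 addr0 /dquot eqxx subrr Normc.normc0 ltW.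
  have rh : r%:C * h != 0 by rewrite mulf_neq0.
  rewrite /dquot ifF; last by apply/negbTE; rewrite -subr_eq0 addrC addKr.
  rewrite (addrC a) addrK (addrC _ a).
  have := Hs (r%:C * h); rewrite Normc.normcM nc_real gtr0_norm// mulrC -ltr_pdivlMr// => /(_ hs).
  rewrite -[X in _ <= _ * X]mulrC.
  have -> : r * nc h = nc (r%:C * h) by rewrite Normc.normcM nc_real gtr0_norm.
  rewrite -ler_pdivrMr ?nc_gt0// -Normc.normcV -Normc.normcM.
  by rewrite mulrBl mulfK.
have := hF 0; rewrite Normc.normc0 => /(_ ltr01) HF0.
have [D HD] : cholo (fun x => F (- (a / r%:C) + (r%:C)^-1 * x)) a.
  apply: cholo_comp; first by eexists; exact: cdiff_affine.
  by have -> : - (a / r%:C) + r%:C^-1 * a = 0 by rewrite mulrC addNr.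
exists D; apply: (@cdiff_ext _ 1 _ _ _ _ ltr01 _ HD).
move=> h _; rewrite /F; congr dquot; field; exact: rC.
Qed.

(* Otherwise every [f' a] with [f' a != 0] makes [1 / dquot f a (f' a)] holomorphic,
   which bounds [|f a / a|] below and contradicts [f' 0 = 0] near [0]; so [f] would
   be constant near [0]. *)
Lemma univalent_deriv0 f d : holoD f -> injD f -> cdiff f 0 d -> d != 0.
Proof.
move=> hf fi H0; apply/eqP => d0; rewrite d0 in H0.
have h0 : 0 < 2^-1 :> R by rewrite invr_gt0.
have h1 : 2^-1 < 1 :> R by rewrite invf_lt1// ltr1n.
have h01 : (0 < 2^-1 :> R) && (2^-1 < 1 :> R) by rewrite h0 h1.
have n0 : nc (0 : R[i]) < 1 by rewrite Normc.normc0.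
(* The minimum of [|f - f 0|] on [|z| = 1/2], positive by injectivity. *)
have [dl dl0 Hdl] : exists2 dl : R, 0 < dl & forall z, nc z = 2^-1 -> dl <= nc (f z - f 0).
  pose g t := nc (f ((2^-1)%:C * unit_pt t) - f 0).
  have [|c c01 Hc] := @EVT_min R g 0 (2 * pi) tpi0.
    apply: continuous_in_subspaceT => t _; apply: pcont_nc; apply: pcontB; last exact: pcont_cst.
    by apply: pcont_circ; apply: cholo_ccont; apply: hf; rewrite nc_circ ?ltW.
  exists (g c).
    rewrite nc_gt0 subr_eq0; apply/eqP => /fi.
    rewrite nc_circ ?ltW// => /(_ h1 n0)/(congr1 (@Normc.normc R)); rewrite nc_circ ?ltW// Normc.normc0 => E.
    by move: h0; rewrite E ltxx.
  move=> z zr; have [t ht ->] := polar_form z; rewrite zr; apply: Hc.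
  by rewrite in_itv.
(* The vanishing derivative gives [|f a - f 0| <= (dl / 4) |a|] near [0]; the mean value below would
   force at least [(dl / 2) |a|]. *)
have [s s0 Hs] := H0 _ (divr_gt0 dl0 (ltr0Sn R 3)).
pose eta := Num.min s (4^-1).
have eta0 : 0 < eta by rewrite lt_min s0 invr_gt0 ltr0n.
have small a : nc a < eta -> nc (f a - f 0) <= dl / 4 * nc a /\ nc a < 4^-1.
  rewrite lt_min => /andP[/Hs]; rewrite add0r mul0r subr0 => -> ->; split=> //.
have da a : nc a < eta -> cdiff f a 0.
  move=> ae; have [s1 s2] := small a ae.
  have a1 : nc a < 1 by apply: (lt_trans s2); rewrite invf_lt1// ltr1n.
  have [->//|a0] := eqVneq a 0.
  have na0 : 0 < nc a by rewrite nc_gt0.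
  have [D HD] := hf a a1; have [<-//|D0] := eqVneq D 0.
  exfalso; pose G := dquot f a D.
  have hG : holoD G by exact: dquot_holo.
  have G0 z : nc z < 1 -> G z != 0.
    move=> z1; rewrite /G /dquot; case: ifPn => // za.
    rewrite mulf_neq0 ?invr_eq0 ?subr_eq0//; apply: contra za => /eqP/fi E.
    by apply/eqP; exact: E.
  have hV : holoD (fun z => (G z)^-1).
    by move=> z z1; have [D' HD'] := hG z z1; eexists; apply: cdiffV (HD'); exact: G0.
  (* On [|z| = 1/2] one has [|f z - f a| >= dl / 2] and [|z - a| <= 1], so [|1 / G| <= 2 / dl] there
     and hence at [0], where [G 0 = (f a - f 0) / a]. *)
  have := circ_mean hV h01.
  have := @circ_bound _ (fun z => (G z)^-1) 2^-1 (2 / dl) (ltW h0).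
  move=> B E; move: B; rewrite E Normc.normcM nc_real ger0_norm//.
  have -> : nc (G 0)^-1 = (nc (f a - f 0) / nc a)^-1.
    rewrite Normc.normcV /G /dquot ifF; last by apply/negbTE; rewrite eq_sym.
    by rewrite Normc.normcM Normc.normcV sub0r ncN ncB.
  rewrite [2 * pi * _]mulrC ler_pM2r// => B.
  have {}B : (nc (f a - f 0) / nc a)^-1 <= 2 / dl.
    apply: B => [z zr|z zr].
      by apply: cholo_ccont; apply: hV; rewrite zr.
    have dz := Hdl z zr.
    have za : z != a by apply: contraTneq s2 => <-; rewrite zr -leNgt lef_pV2 ?posrE// ler_nat.
    rewrite Normc.normcV /G /dquot (negbTE za) Normc.normcM Normc.normcV invfM invrK.
    have e1 : dl / 2 <= nc (f z - f a).
      have := ncBD (f z - f 0) (- (f a - f 0)); rewrite ncN.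
      have -> : f z - f 0 - (f a - f 0) = f z - f a by ring.
      have : dl / 4 * nc a <= dl / 4 * 1 by rewrite ler_pM2l ?divr_gt0// ltW.
      by move: dz s1 dl0; lra.
    have e2 : nc (z - a) <= 1.
      by apply: (le_trans (ncD _ _)); rewrite ncN zr; move: s2; lra.
    have -> : 2 / dl = (dl / 2)^-1 * 1 by rewrite invfM invrK mulr1 mulrC.
    rewrite ler_pM ?invr_ge0 ?nc_ge0// lef_pV2// posrE; last exact: divr_gt0.
    by apply: lt_le_trans e1; exact: divr_gt0.
  have fa : 0 < nc (f a - f 0).
    by rewrite nc_gt0 subr_eq0; apply: contra a0 => /eqP/fi -> //.
  have q1 : nc (f a - f 0) / nc a <= dl / 4 by rewrite ler_pdivrMr.
  have q0 : 0 < nc (f a - f 0) / nc a by rewrite divr_gt0.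
  move: B; rewrite -[2 / dl]invrK lef_pV2 ?posrE ?invr_gt0 ?divr_gt0// invf_div => B.
  by move: q1 B dl0; lra.
have := cdiff0_cst da; pose b : R[i] := (eta / 2)%:C.
have b0 : nc b = eta / 2 by rewrite nc_real ger0_norm// divr_ge0// ltW.
have be : nc b < eta by rewrite b0; move: eta0; lra.
move=> /(_ b be)/fi; have [_ b4] := small b be.
have b1 : nc b < 1 by apply: (lt_trans b4); rewrite invf_lt1// ltr1n.
move=> /(_ b1 n0) /(congr1 (@Normc.normc R)); rewrite b0 Normc.normc0; move: eta0; lra.
Qed.

(** The affine map [w -> a + r w] sends the unit disk into itself and moves the claim to the
    origin. *)
Lemma univalent_deriv f a d : holoD f -> injD f -> nc a < 1 -> cdiff f a d -> d != 0.
Proof.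
move=> hf fi a1 Hd.
pose r := (1 - nc a) / 2; have r0 : 0 < r by rewrite /r; move: a1; lra.
have rC : r%:C != 0 by rewrite -nc_gt0 nc_real gtr0_norm.
have in1 w : nc w < 1 -> nc (a + r%:C * w) < 1.
  move=> w1; apply: (le_lt_trans (ncD _ _)); rewrite Normc.normcM nc_real gtr0_norm//.
  have : r * nc w <= r * 1 by rewrite ler_pM2l// ltW.
  by rewrite /r; move: a1; lra.
have : d * r%:C != 0.
  apply: (@univalent_deriv0 (fun w => f (a + r%:C * w))).
  - move=> w w1; apply: cholo_comp; first by eexists; exact: cdiff_affine.
    by apply: hf; exact: in1.
  - by move=> z w z1 w1 /(fi _ _ (in1 _ z1) (in1 _ w1)) /addrI; exact: mulfI.
  - apply: (@cdiff_comp _ (fun w => a + r%:C * w) f); first exact: cdiff_affine.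
    by rewrite mulr0 addr0.
by rewrite mulf_eq0 negb_or => /andP[].
Qed.

Lemma dquot_zero_free f a d : holoD f -> injD f -> nc a < 1 -> cdiff f a d ->
  forall z, nc z < 1 -> dquot f a d z != 0.
Proof.
move=> hf fi a1 Hd z z1; rewrite /dquot; case: ifPn => [_|za].
  exact: univalent_deriv Hd.
rewrite mulf_neq0 ?invr_eq0 ?subr_eq0//; apply: contra za => /eqP/fi E.
by apply/eqP; exact: E.
Qed.

End univalent.

(** * Jensen's inequality averaged over circles of values *)

Section measurable_complex.
Context {R : realType}.
Local Open Scope complex_scope.
Context d (T : measurableType d).
Implicit Types (F G : T -> R[i]).

Definition cmeas F := measurable_fun setT (fun x => complex.Re (F x)) /\
  measurable_fun setT (fun x => complex.Im (F x)).

Lemma cmeasM F G : cmeas F -> cmeas G -> cmeas (fun x => F x * G x).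
Proof.
move=> [mF nF] [mG nG]; split.
  under eq_fun do rewrite cReM.
  by apply: measurable_funB; apply: measurable_funM.
under eq_fun do rewrite cImM.
by apply: measurable_funD; apply: measurable_funM.
Qed.

Lemma cmeasD F G : cmeas F -> cmeas G -> cmeas (fun x => F x + G x).
Proof.
move=> [mF nF] [mG nG]; split; under eq_fun do rewrite raddfD /=.
  exact: measurable_funD.
exact: measurable_funD.
Qed.

Lemma cmeasB F G : cmeas F -> cmeas G -> cmeas (fun x => F x - G x).
Proof.
move=> [mF nF] [mG nG]; split; under eq_fun do rewrite raddfB /=.
  exact: measurable_funB.
exact: measurable_funB.
Qed.

Lemma cmeas_cst c : cmeas (fun=> c).
Proof. by split; exact: measurable_cst. Qed.

Lemma cmeas_nc F : cmeas F -> measurable_fun setT (fun x => nc (F x)).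
Proof.
move=> [mF nF].
have -> : (fun x => nc (F x)) = (fun x => (complex.Re (F x) ^+ 2 + complex.Im (F x) ^+ 2) `^ 2^-1).
  apply/funext => x; rewrite powR12_sqrt ?addr_ge0 ?sqr_ge0//.
  by rewrite -nc_sqr sqrtr_sqr ger0_norm// nc_ge0.
apply: (measurableT_comp (measurable_powR _)).
by apply: measurable_funD; exact: measurable_funX.
Qed.

End measurable_complex.

Lemma cmeas_comp {R : realType} d (T : measurableType d) d' (T' : measurableType d')
  (F : T -> R[i]%C) (g : T' -> T) :
  measurable_fun setT g -> cmeas F -> cmeas (F \o g).
Proof. by move=> mg [mF nF]; split; [exact: (measurableT_comp mF mg)|exact: (measurableT_comp nF mg)]. Qed.

(** * Mean values of ln |1 - a e^(it)| *)

Section log_kernel.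
Context {R : realType}.
Local Open Scope complex_scope.
Implicit Types (z w h a : R[i]) (f G F : R[i] -> R[i]) (r t : R).
Local Notation mu := (@lebesgue_measure R).

Let tpi0 : 0 <= 2 * pi :> R. Proof. by rewrite mulr_ge0// pi_ge0. Qed.
Let tpi1 : 0 < 2 * pi :> R. Proof. by rewrite mulr_gt0// pi_gt0. Qed.

Lemma pcont_cmeas (F : R -> R[i]) : (forall t, pcont F t) -> cmeas F.
Proof.
by move=> pF; split; apply: continuous_measurable_fun => t; [exact: pcont_Re|exact: pcont_Im].
Qed.

Definition conj z : R[i] := complex.Re z -i* complex.Im z.

Lemma nc_conj z : nc (conj z) = nc z.
Proof. by case: z => a b; rewrite /conj /nc /= sqrrN. Qed.

Lemma conjM z w : conj (z * w) = conj z * conj w.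
Proof. by apply: complex_eq; rewrite /conj /= !(cReM, cImM) /=; ring. Qed.

Lemma conjB z w : conj (z - w) = conj z - conj w.
Proof. by apply: complex_eq; rewrite /conj /= !raddfB /=; ring. Qed.

Lemma conj1 : conj 1 = 1.
Proof. by apply: complex_eq; rewrite /conj /= ?oppr0. Qed.

Lemma conj_unit_pt t : conj (unit_pt (- t)) = unit_pt t.
Proof. by rewrite /conj /unit_pt /= cosN sinN opprK. Qed.

Lemma conjK z : conj (conj z) = z.
Proof. by apply: complex_eq; rewrite /conj //= opprK. Qed.

Lemma ln_nc_continuous (F : R -> R[i]) t : pcont F t -> F t != 0 ->
  {for t, continuous (fun s => ln (nc (F s)))}.
Proof.
move=> pF F0; apply: continuous_comp; first exact: pcont_nc.
by apply: continuous_ln; rewrite nc_gt0.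
Qed.

Lemma Rint_EFin (g : R -> R) (a b : R) : (forall t, a <= t <= b -> {for t, continuous g}) ->
  (\int[mu]_(t in `[a, b]) (g t)%:E)%E = (\int[mu]_(t in `[a, b]) g t)%:E.
Proof.
move=> cg; rewrite /Rintegral fineK//; apply: integrable_fin_num => //.
exact: cont_integrable.
Qed.

Lemma Rint_cst (c : R) : \int[mu]_(t in `[0, 2 * pi]) c = 2 * pi * c.
Proof. by rewrite Rintegral_cst//= lebesgue_measure_itv /= lte_fin tpi1 /= subr0 mulrC. Qed.

Lemma pcont_1Ba a t : pcont (fun s => 1 - a * unit_pt s) t.
Proof.
by apply: pcontB; [exact: pcont_cst|apply: pcontM; [exact: pcont_cst|exact: pcont_unit_pt]].
Qed.

Lemma oneB_neq0 a z : nc (a * z) != 1 -> 1 - a * z != 0.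
Proof. by rewrite subr_eq0; apply: contraNneq => <-; rewrite Normc.normc1. Qed.

Lemma oneBunit_neq0 a t : nc a != 1 -> 1 - a * unit_pt t != 0.
Proof. by move=> a1; apply: oneB_neq0; rewrite Normc.normcM nc_unit_pt mulr1. Qed.

(** The integrand is the restriction to [|z| = s] of [ln |1 - (a / s) z|], with [|a| < s < 1]; this
    function has no zero in the disk and equals [1] at the origin. *)
Lemma log_int_lt1 a : nc a < 1 ->
  \int[mu]_(t in `[0, 2 * pi]) ln (nc (1 - a * unit_pt t)) = 0.
Proof.
move=> a1; have a0 := nc_ge0 a.
pose s := (nc a + 1) / 2; have s0 : 0 < s by rewrite /s; lra.
have s1 : s < 1 by rewrite /s; lra.
have sa : nc a < s by rewrite /s; lra.
clearbody s.
pose G z := 1 - a / s%:C * z.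
have hG : holoD G.
  move=> z _; eexists; apply: cdiffB; first exact: cdiff_cst.
  by apply: cdiffZ; exact: cdiff_id.
have G0 z : nc z < 1 -> G z != 0.
  move=> z1; apply: oneB_neq0; rewrite !Normc.normcM Normc.normcV nc_real gtr0_norm//.
  rewrite lt_eqF//; have : nc a / s < 1 by rewrite ltr_pdivrMr// mul1r.
  have : 0 <= nc a / s by apply: divr_ge0 => //; exact: ltW.
  have := nc_ge0 z; move: (nc a / s) (nc z) z1 => u v; nra.
have [|_] := jensen_zero_free hG G0 (r := s); first by rewrite s0.
rewrite {2}/G mulr0 subr0 Normc.normc1 ln1 mulr0 => E; rewrite -[RHS]E.
apply: eq_Rintegral => t _; congr (ln (nc _)); rewrite /G mulrA divfK//.
by rewrite -nc_gt0 nc_real gtr0_norm.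
Qed.

(** Factoring out [- a e^(it)] leaves [1 - a^-1 e^(-it)], whose modulus is that of its conjugate;
    the case [|a| < 1] finishes. *)
Lemma log_int_gt1 a : 1 < nc a ->
  \int[mu]_(t in `[0, 2 * pi]) ln (nc (1 - a * unit_pt t)) = 2 * pi * ln (nc a).
Proof.
move=> a1; have a0 : a != 0 by rewrite -nc_gt0 (lt_trans _ a1).
have b1 : nc (conj a^-1) < 1 by rewrite nc_conj Normc.normcV invf_lt1// (lt_trans _ a1).
have E t : ln (nc (1 - a * unit_pt t)) = ln (nc a) + ln (nc (1 - conj a^-1 * unit_pt t)).
  have -> : 1 - a * unit_pt t = - (a * unit_pt t) * (1 - a^-1 * unit_pt (- t)).
    rewrite unit_ptN; field; rewrite unit_pt_neq0 a0//.
  rewrite Normc.normcM ncN Normc.normcM nc_unit_pt mulr1.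
  have -> : nc (1 - a^-1 * unit_pt (- t)) = nc (1 - conj a^-1 * unit_pt t).
    by rewrite -nc_conj conjB conj1 conjM conj_unit_pt.
  rewrite lnM ?posrE ?nc_gt0//; apply: oneBunit_neq0; first by rewrite lt_eqF.
under eq_Rintegral do rewrite E.
rewrite RintegralD//.
- by rewrite log_int_lt1// addr0 Rint_cst.
- by apply: cont_integrable => t _; exact: cvg_cst.
- apply: cont_integrable => t _; apply: ln_nc_continuous; first exact: pcont_1Ba.
  by apply: oneBunit_neq0; rewrite lt_eqF.
Qed.

Lemma nc_sB (u : R[i]) (s : R) : nc u = 1 ->
  nc (1 - s%:C * u) ^+ 2 = (1 - s) ^+ 2 + s * nc (1 - u) ^+ 2.
Proof.
move=> u1; have : nc u ^+ 2 = 1 by rewrite u1 expr1n.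
rewrite !nc_sqr; case: u {u1} => x y /=; rewrite !mul0r !subr0 !addr0 => H.
have y2 : y ^+ 2 = 1 - x ^+ 2 by rewrite -H; ring.
by rewrite !sub0r !sqrrN !exprMn y2; ring.
Qed.

(** Off the unit circle the logarithm itself is continuous and serves as [U]. On the circle it has a
    pole to [-oo]; a continuous majorant costs at most [ln rr] in mean value. *)
Lemma log_majorant a (rr : R) : nc a <= rr -> 1 < rr ->
  exists U : R -> R, [/\ forall t, {for t, continuous U},
    forall t, 1 - a * unit_pt t != 0 -> ln (nc (1 - a * unit_pt t)) <= U t &
    \int[mu]_(t in `[0, 2 * pi]) U t <= 2 * pi * ln rr].
Proof.
move=> ar r1; have rr0 : 0 < rr by exact: lt_trans r1.
have lr : 0 < ln rr by exact: ln_gt0.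
have [a1|a1|a1] := ltgtP (nc a) 1.
- exists (fun t => ln (nc (1 - a * unit_pt t))); split=> //.
    by move=> t; apply: ln_nc_continuous; [exact: pcont_1Ba|apply: oneBunit_neq0; rewrite lt_eqF].
  by rewrite log_int_lt1// mulr_ge0// ltW.
- exists (fun t => ln (nc (1 - a * unit_pt t))); split=> //.
    by move=> t; apply: ln_nc_continuous; [exact: pcont_1Ba|apply: oneBunit_neq0; rewrite gt_eqF].
  by rewrite log_int_gt1// ler_pM2l// ler_ln ?posrE// (lt_trans _ a1).
(* By [nc_sB], [s |1 - u|^2 <= |1 - s u|^2] for [|u| = 1], so
   [ln |1 - u| <= ln |1 - s u| - (ln s) / 2]; this [s] makes the last term exactly [ln rr]. *)
- pose s := rr ^- 2; have s0 : 0 < s by rewrite invr_gt0 exprn_gt0.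
  have s1 : s < 1 by rewrite invf_lt1 ?exprn_gt0// exprn_egt1.
  have ls : ln s = - (2 * ln rr) by rewrite lnV ?posrE ?exprn_gt0// lnXn// mulr_natl.
  clearbody s.
  have na : nc (s%:C * a) < 1 by rewrite Normc.normcM a1 mulr1 nc_real gtr0_norm.
  have nz t : 1 - s%:C * a * unit_pt t != 0 by apply: oneBunit_neq0; rewrite lt_eqF.
  have cU t : {for t, continuous (fun t => ln (nc (1 - s%:C * a * unit_pt t)))}.
    by apply: ln_nc_continuous => //; exact: pcont_1Ba.
  exists (fun t => ln (nc (1 - s%:C * a * unit_pt t)) + ln rr); split.
  + by move=> t; apply: cvgD; [exact: cU|exact: cvg_cst].
  + move=> t t0; have u1 : nc (a * unit_pt t) = 1 by rewrite Normc.normcM nc_unit_pt a1 mulr1.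
    have := nc_sB s u1; rewrite mulrA => E.
    have n0 : 0 < nc (1 - a * unit_pt t) by rewrite nc_gt0.
    have m0 : 0 < nc (1 - s%:C * a * unit_pt t) by rewrite nc_gt0.
    have le : s * nc (1 - a * unit_pt t) ^+ 2 <= nc (1 - s%:C * a * unit_pt t) ^+ 2.
      by rewrite E lerDr sqr_ge0.
    move: le; rewrite -ler_ln ?posrE ?mulr_gt0 ?exprn_gt0//.
    rewrite lnM ?posrE ?exprn_gt0// ls lnXn// lnXn// !mulr2n.
    by move: (ln (nc (1 - a * unit_pt t))) (ln (nc (1 - s%:C * a * unit_pt t))) => u v; lra.
  + rewrite RintegralD//; last 2 first.
    * by apply: cont_integrable => t _; exact: cU.
    * by apply: cont_integrable => t _; exact: cvg_cst.
    by rewrite log_int_lt1// add0r Rint_cst.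
Qed.

(* The value at [0] is set by hand, since [ln 0 = 0]; [K] only makes the kernel
   nonnegative, as Tonelli requires. *)
Definition psi (K x : R) : \bar R := if x == 0 then +oo%E else (K - ln x)%:E.

Lemma psi_ge0 (K x : R) : 0 <= x -> x <= expR K -> (0 <= psi K x)%E.
Proof.
move=> x0 xK; rewrite /psi; case: eqP => [_|/eqP xn0]; first exact: leey.
have x1 : 0 < x by rewrite lt_neqAle eq_sym xn0.
by rewrite lee_fin subr_ge0 -[X in _ <= X]expRK ler_ln ?posrE ?expR_gt0.
Qed.

Lemma measurable_psi (K : R) d (T : measurableType d) (g : T -> R) :
  measurable_fun setT g -> measurable_fun setT (fun x => psi K (g x)).
Proof.
move=> mg; apply: measurable_fun_ifT.
- by apply: measurable_fun_eqr => //; exact: measurable_cst.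
- exact: measurable_cst.
- apply/measurable_EFinP; apply: measurable_funB; first exact: measurable_cst.
  by apply: measurableT_comp => //; exact: measurable_ln.
Qed.

Definition lnp (x : R) : R := Num.max 0 (ln x).

Lemma psi_int_neq1 (K : R) a : nc a != 1 ->
  (\int[mu]_(t in `[0%R, (2 * pi)%R]) psi K (nc (1 - a * unit_pt t)%R) =
   (2 * pi * (K - lnp (nc a)))%R%:E)%E.
Proof.
move=> a1; have cl t : {for t, continuous (fun t => ln (nc (1 - a * unit_pt t)))}.
  by apply: ln_nc_continuous; [exact: pcont_1Ba|exact: oneBunit_neq0].
under eq_integral do rewrite /psi (negbTE (lt0r_neq0 (etrans (nc_gt0 _) (oneBunit_neq0 _ a1)))).
rewrite Rint_EFin; last by move=> t _; apply: cvgB; [exact: cvg_cst|exact: cl].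
rewrite RintegralB//; last 2 first.
- by apply: cont_integrable => t _; exact: cvg_cst.
- by apply: cont_integrable => t _; exact: cl.
rewrite Rint_cst mulrBr; congr (_ - _)%:E; rewrite /lnp.
have [a2|a2|a2] := ltgtP (nc a) 1; last by rewrite a2 eqxx in a1.
  have l0 : ln (nc a) <= 0 by exact/ln_le0/ltW.
  by rewrite log_int_lt1// (max_l l0) mulr0.
have l0 : 0 <= ln (nc a) by exact/ln_ge0/ltW.
by rewrite log_int_gt1// (max_r l0).
Qed.

(** For [|a| = 1] the kernel is approached along [s n * a] with [s n] increasing to [1], whose
    integrals are all [2 pi K]. Fatou gives an inequality, and this direction is the one that the
    averaging argument uses. *)
Lemma psi_int_le (K : R) a : 1 + nc a <= expR K ->
  (\int[mu]_(t in `[0%R, (2 * pi)%R]) psi K (nc (1 - a * unit_pt t)%R) <=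
   (2 * pi * (K - lnp (nc a)))%R%:E)%E.
Proof.
move=> aK; have [a1|a1] := eqVneq (nc a) 1; last by rewrite psi_int_neq1.
have -> : lnp (nc a) = 0 by rewrite a1 /lnp ln1 maxxx.
rewrite subr0.
pose s n : R := 1 - n.+1%:R^-1.
have s01 n : 0 <= s n < 1.
  by rewrite subr_ge0 invf_le1// ler1n /= ltrBlDr ltrDl invr_gt0.
have ns n : nc ((s n)%:C * a) = s n.
  by rewrite Normc.normcM a1 mulr1 nc_real ger0_norm//; have /andP[] := s01 n.
have mp b : measurable_fun setT (fun t => psi K (nc (1 - b * unit_pt t))).
  by apply: measurable_psi; apply: cmeas_nc; apply: pcont_cmeas => t; exact: pcont_1Ba.
have H := @fatou _ _ R mu `[0, 2 * pi]%classic (measurable_itv _)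
  (fun n t => psi K (nc (1 - (s n)%:C * a * unit_pt t))).
have cs : s n @[n --> \oo] --> (1 : R).
  rewrite -[X in _ --> X]subr0; apply: cvgB; first exact: cvg_cst.
  exact: cvg_harmonic.
have E t : psi K (nc (1 - a * unit_pt t)) =
    limn_einf (fun n => psi K (nc (1 - (s n)%:C * a * unit_pt t))).
  have nz n : nc (1 - (s n)%:C * a * unit_pt t) != 0.
    by apply: lt0r_neq0; rewrite nc_gt0; apply: oneBunit_neq0; rewrite ns lt_eqF//; have /andP[] := s01 n.
  suff C : psi K (nc (1 - (s n)%:C * a * unit_pt t)) @[n --> \oo] --> psi K (nc (1 - a * unit_pt t)).
    by rewrite is_cvg_limn_einfE; [symmetry; exact/cvg_lim|apply/cvg_ex; eexists; exact: C].
  rewrite [X in X @ _ --> _](_ : _ = fun n => (K - ln (nc (1 - (s n)%:C * a * unit_pt t)))%:E); last first.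
    by apply/funext => n; rewrite /psi (negbTE (nz n)).
  rewrite /psi; case: eqP => [/Normc.eq0_normc/eqP|/eqP b0].
    rewrite subr_eq0 => /eqP au.
    (* Here [a e^(it) = 1] and the kernel at [s n] is [K + ln (n + 1)]; the value [+oo] of [psi] at
       [0] is its limit. *)
    apply/cvgeryP/cvgryPge => A; near=> n.
    rewrite -mulrA -au mulr1 -[1 in X in ln (nc X)]/(1%:C) -raddfB nc_real /s subKr.
    rewrite gtr0_norm ?invr_gt0// lnV ?posrE// opprK -lerBlDl.
    rewrite -[X in X <= _]expRK ler_ln ?posrE ?expR_gt0//.
    apply: (@le_trans _ _ n%:R); last by rewrite ler_nat.
    by near: n; exact: nbhs_infty_ger.
  apply: cvg_EFin; first by near=> n.
  rewrite /comp /=; apply: cvgB; first exact: cvg_cst.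
  have cl : {for nc (1 - a * unit_pt t), continuous (@ln R)}.
    by apply: continuous_ln; rewrite lt_neqAle eq_sym b0 nc_ge0.
  suff H' : nc (1 - (s n)%:C * a * unit_pt t) @[n --> \oo] --> nc (1 - a * unit_pt t).
    exact: (continuous_cvg _ cl H').
  apply/cvgrPdist_le => e e0; move/cvgrPdist_le : cs => /(_ e e0) cs.
  near=> n; have : `|1 - s n| <= e by near: n.
  apply: le_trans; rewrite ler_norml.
  set A := 1 - a * unit_pt t; set B := 1 - (s n)%:C * a * unit_pt t.
  have AB : nc (A - B) = `|1 - s n|.
    have sB : (1 - s n)%:C = 1 - (s n)%:C :> R[i] by exact: (raddfB (real_complex R)).
    have -> : A - B = - ((1 - s n)%:C * (a * unit_pt t)) by rewrite /A /B sB; move: (s n)%:C (unit_pt t) => u v; ring.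
    by rewrite ncN !Normc.normcM nc_unit_pt a1 !mulr1 nc_real.
  clearbody A B; have := ncBD A (B - A); have := ncBD B (A - B).
  have -> : B + (A - B) = A by ring.
    have -> : A + (B - A) = B by ring.
    rewrite (ncB B) AB; move: (nc A) (nc B) `|_| => u v x h1 h2; clear -h1 h2; lra.
under eq_integral do rewrite E.
apply: le_trans (H _ _) _.
- by move=> n; apply: measurable_funTS; exact: mp.
- move=> n t _; apply: psi_ge0; first exact: nc_ge0.
  apply: le_trans aK; apply: (le_trans (ncD _ _)); rewrite Normc.normc1 ncN lerD2l.
  rewrite Normc.normcM nc_unit_pt mulr1 ns a1; have /andP[_ /ltW//] := s01 n.
rewrite (_ : (fun n => _) = fun n => (2 * pi * K)%:E).
  have cc : (2 * pi * K)%:E @[_ --> \oo] --> (2 * pi * K)%:E by exact: cvg_cst.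
  by rewrite is_cvg_limn_einfE; [rewrite (cvg_lim _ cc)|apply/cvg_ex; eexists; exact: cc].
apply/funext => n; have /andP[h0 h1] := s01 n; rewrite psi_int_neq1; last by rewrite ns lt_eqF.
rewrite ns /lnp max_l ?subr0//; exact/ln_le0/ltW.
Unshelve. all: by end_near.
Qed.

End log_kernel.

(** * Logarithmic tails of univalent functions *)

Section univalent_tail.
Context {R : realType}.
Local Open Scope complex_scope.
Implicit Types (z w h a : R[i]) (f G F : R[i] -> R[i]) (r t : R).
Local Notation mu := (@lebesgue_measure R).

Let tpi0 : 0 <= 2 * pi :> R. Proof. by rewrite mulr_ge0// pi_ge0. Qed.
Let tpi1 : 0 < 2 * pi :> R. Proof. by rewrite mulr_gt0// pi_gt0. Qed.

Lemma tonelli_itv (A B : set R) (F : R * R -> \bar R) : measurable A -> measurable B ->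
  measurable_fun setT F -> (forall p, 0 <= F p)%E ->
  (\int[mu]_(x in A) \int[mu]_(y in B) F (x, y) = \int[mu]_(y in B) \int[mu]_(x in A) F (x, y))%E.
Proof.
move=> mA mB mF F0.
pose F' := F \_ (A `*` B).
have mF' : measurable_fun setT F'.
  apply/(measurable_restrictT _ (measurableX mA mB)).
  exact: measurable_funTS.
have F'0 p : (0 <= F' p)%E by rewrite /F' /patch; case: ifP.
have := fubini_tonelli (m1 := mu) (m2 := mu) F' mF' F'0.
have E1 : (\int[mu]_x \int[mu]_y F' (x, y) = \int[mu]_(x in A) \int[mu]_(y in B) F (x, y))%E.
  rewrite [RHS]integral_mkcond; apply: eq_integral => x _; rewrite [RHS]/patch; case: ifPn => xA.
    rewrite [RHS]integral_mkcond; apply: eq_integral => y _.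
    by rewrite /F' /patch in_setX /= xA.
  rewrite (eq_integral (fun=> 0%E)) ?integral0// => y _.
  by rewrite /F' /patch in_setX /= (negbTE xA).
have E2 : (\int[mu]_y \int[mu]_x F' (x, y) = \int[mu]_(y in B) \int[mu]_(x in A) F (x, y))%E.
  rewrite [RHS]integral_mkcond; apply: eq_integral => x _; rewrite [RHS]/patch; case: ifPn => xA.
    rewrite [RHS]integral_mkcond; apply: eq_integral => y _.
    by rewrite /F' /patch in_setX /= xA andbT.
  rewrite (eq_integral (fun=> 0%E)) ?integral0// => y _.
  by rewrite /F' /patch in_setX /= (negbTE xA) andbF.
by rewrite E1 E2.
Qed.

Lemma measurable_itv_l (B : set R) (F : R * R -> \bar R) : measurable B ->
  measurable_fun setT F -> (forall p, 0 <= F p)%E ->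
  measurable_fun setT (fun x => \int[mu]_(y in B) F (x, y))%E.
Proof.
move=> mB mF F0.
pose F' := F \_ (setT `*` B).
have mF' : measurable_fun setT F'.
  apply/(measurable_restrictT _ (measurableX measurableT mB)).
  exact: measurable_funTS.
have F'0 p : (0 <= F' p)%E by rewrite /F' /patch; case: ifP.
have -> : (fun x => \int[mu]_(y in B) F (x, y))%E = fubini_F mu F'.
  apply/funext => x; rewrite /fubini_F [LHS]integral_mkcond; apply: eq_integral => y _.
  by rewrite /F' /patch in_setX /= in_setT.
exact: (measurable_fun_fubini_tonelli_F (m2 := mu)).
Qed.

Lemma measurable_itv_r (A : set R) (F : R * R -> \bar R) : measurable A ->
  measurable_fun setT F -> (forall p, 0 <= F p)%E ->
  measurable_fun setT (fun y => \int[mu]_(x in A) F (x, y))%E.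
Proof.
move=> mA mF F0; apply: (@measurable_itv_l A (F \o (fun p : R * R => (p.2, p.1)))) => //.
  apply: measurableT_comp => //; apply/measurable_fun_pairP; split=> //=; [exact: measurable_snd|exact: measurable_fst].
by move=> p; exact: F0.
Qed.

Lemma bounded_integrable (g : R -> R) (B : R) : measurable_fun setT g ->
  (forall t, `|g t| <= B) -> mu.-integrable `[0, 2 * pi] (EFin \o g).
Proof.
move=> mg gB; apply: (@le_integrable _ _ _ mu _ _ _ (EFin \o cst B)) => //.
- by apply: measurable_funTS; exact/measurable_EFinP.
- by move=> t _ /=; rewrite lee_fin (le_trans (gB t))// ler_norm.
- by apply: cont_integrable => t _; exact: cvg_cst.
Qed.

(** Where [x] vanishes the kernel is [+oo], so a continuous majorant [V] of [ln x] off the zeros of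
    [x] already bounds the integral from below. *)
Lemma psi_int_ge (K B : R) (x V : R -> R) : (forall t, {for t, continuous V}) ->
  (forall t, x t != 0 -> ln (x t) <= V t) ->
  \int[mu]_(t in `[0, 2 * pi]) V t <= 2 * pi * B ->
  (forall t, 0 <= x t) -> (forall t, x t <= expR K) -> measurable_fun setT x ->
  ((2 * pi * (K - B))%:E <= \int[mu]_(t in `[0%R, (2 * pi)%R]) psi K (x t))%E.
Proof.
move=> cV xV iV x0 xK mx.
have cKV t : {for t, continuous (fun t => K - V t)} by apply: cvgB; [exact: cvg_cst|exact: cV].
have iKV : 2 * pi * (K - B) <= \int[mu]_(t in `[0, 2 * pi]) (K - V t).
  rewrite RintegralB//; last 2 first.
  - by apply: cont_integrable => t _; exact: cvg_cst.
  - by apply: cont_integrable => t _; exact: cV.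
  by rewrite Rint_cst mulrBr lerB.
have mKV : measurable_fun setT (fun t => K - V t) by exact: continuous_measurable_fun.
apply: (@le_trans _ _ (\int[mu]_(t in `[0, 2 * pi]) (K - V t))%:E); first by rewrite lee_fin.
rewrite -Rint_EFin; last by move=> t _; exact: cKV.
(* [K - V] may be negative; its positive part still lies below the nonnegative kernel and permits
   the monotonicity of nonnegative integrals. *)
apply: (@le_trans _ _ (\int[mu]_(t in `[0%R, (2 * pi)%R]) (Num.max 0 (K - V t))%:E)%E).
  have cm t : {for t, continuous (fun t => Num.max 0 (K - V t))}.
    by apply: continuous_max; [exact: cvg_cst|exact: cKV].
  rewrite !Rint_EFin ?lee_fin//; apply: le_Rintegral => //.
  - exact: cont_integrable.
  - exact: cont_integrable.
  - by move=> t _; rewrite le_max lexx orbT.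
apply: ge0_le_integral => //.
- by move=> t _; rewrite lee_fin le_max lexx.
- apply: measurable_funTS; apply/measurable_EFinP.
  by apply: measurable_maxr => //; exact: measurable_cst.
- by apply: measurable_funTS; exact: measurable_psi.
- move=> t _; have := @psi_ge0 _ K _ (x0 t) (xK t); rewrite /psi; case: eqP => [_ _|/eqP xt].
    exact: leey.
  by rewrite !lee_fin ge_max => ->; rewrite lerB// xV.
Qed.

Section jensen.
Variables (f : R[i] -> R[i]) (r rho : R).
Hypotheses (hf : holoD f) (fi : injD f) (f0 : f 0 = 0).
Hypotheses (r0 : 0 < r) (r1 : r < 1) (rho0 : 0 < rho) (rho1 : rho < 1).

Let n1 t : nc (r%:C * unit_pt t) < 1.
Proof. by rewrite nc_circ// ltW. Qed.

Let pf t : pcont (fun s => f (r%:C * unit_pt s)) t.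
Proof. by apply: pcont_circ; apply: cholo_ccont; exact: hf. Qed.

(** If [w] is not a value, [1 - f / w] is zero-free with value [1] at [0]. If [w = f z0], dividing
    by [1 - z / z0] leaves a zero-free [G], and the factor itself is handled by [log_majorant] since
    [|r / z0| <= 1 / rho]. *)
Lemma jensen_univalent w K : w != 0 -> (forall z, nc z < 1 -> f z = w -> rho <= nc z) ->
  (forall t, nc (1 - f (r%:C * unit_pt t) / w) <= expR K) ->
  ((2 * pi * (K - ln rho^-1))%:E <=
   \int[mu]_(t in `[0%R, (2 * pi)%R]) psi K (nc (1 - f (r%:C * unit_pt t) / w)%R))%E.
Proof.
move=> w0 wrho bK.
have z01 : nc (0 : R[i]) < 1 by rewrite Normc.normc0.
have lr0 : 0 < ln rho^-1 by rewrite ln_gt0// invf_gt1.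
have mx : measurable_fun setT (fun t => nc (1 - f (r%:C * unit_pt t) / w)).
  apply: cmeas_nc; apply: cmeasB; first exact: cmeas_cst.
  by apply: cmeasM; [exact: pcont_cmeas|exact: cmeas_cst].
have r01 : 0 < r < 1 by rewrite r0.
have [[z0 [z01' fz0]]|nw] := pselect (exists z, nc z < 1 /\ f z = w); last first.
  pose G z := 1 - f z / w.
  have hG : holoD G.
    move=> z z1; have [d Hd] := hf z1; eexists; apply: cdiffB; first exact: cdiff_cst.
    by apply: cdiffM; [exact: Hd|exact: cdiff_cst].
  have G0 z : nc z < 1 -> G z != 0.
    move=> z1; apply/eqP => /eqP; rewrite subr_eq0 => /eqP E; apply: nw; exists z; split=> //.
    by rewrite -[RHS]mul1r E divfK.
  have [iG eG] := jensen_zero_free hG G0 r01.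
  apply: (@psi_int_ge _ _ _ (fun t => ln (nc (G (r%:C * unit_pt t))))) => //.
  - move=> t; apply: ln_nc_continuous; last exact: G0.
    by apply: pcontB; [exact: pcont_cst|apply: pcontM; [exact: pf|exact: pcont_cst]].
  - by rewrite eG /G f0 mul0r subr0 Normc.normc1 ln1 mulr0 mulr_ge0// ltW.
  - by move=> t; exact: nc_ge0.
have nz0 : z0 != 0 by apply: contraNneq w0 => z00; rewrite -fz0 z00 f0.
have [d Hd] := hf z01'.
have hH := dquot_holo hf z01' Hd; have H0 := dquot_zero_free hf fi z01' Hd.
(* By injectivity [z0] is the only zero, so the difference quotient at [z0] has none; the constant
   [z0 / w] normalises [G 0] to [1]. *)
pose G z := z0 / w * dquot f z0 d z.
have hG : holoD G by move=> z z1; have [e He] := hH z z1; eexists; exact: cdiffZ He.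
have G0 z : nc z < 1 -> G z != 0.
  by move=> z1; rewrite mulf_neq0 ?mulf_neq0 ?invr_eq0// H0.
have Gz0 : G 0 = 1.
  rewrite /G /dquot eq_sym (negbTE nz0) f0 fz0 !sub0r; field.
  by rewrite nz0 w0.
have fE z : 1 - f z / w = (1 - z / z0) * G z.
  rewrite /G /dquot; case: eqP => [->|/eqP zz0]; first by rewrite fz0 !divff// subrr mul0r.
  by rewrite fz0; field; rewrite subr_eq0 zz0 nz0 w0.
have [iG eG] := jensen_zero_free hG G0 r01.
have ra : nc (r%:C / z0) <= rho^-1.
  rewrite Normc.normcM Normc.normcV nc_real gtr0_norm// mulrC ler_pdivrMl ?nc_gt0//.
  apply: (le_trans (ltW r1)); rewrite ler_pdivlMr// mul1r; exact: wrho.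
have [|U [cU bU iU]] := log_majorant ra; first by rewrite invf_gt1.
have cG t : {for t, continuous (fun t => ln (nc (G (r%:C * unit_pt t))))}.
  apply: ln_nc_continuous; last exact: G0.
  by apply: pcont_circ; apply: cholo_ccont; exact: hG.
apply: (@psi_int_ge _ _ _ (fun t => U t + ln (nc (G (r%:C * unit_pt t))))) => //.
- by move=> t; apply: cvgD; [exact: cU|exact: cG].
- move=> t; rewrite fE Normc.normcM mulf_eq0 negb_or => /andP[h1 h2].
  have E : r%:C * unit_pt t / z0 = r%:C / z0 * unit_pt t by rewrite mulrAC.
  have {}h1 : 0 < nc (1 - r%:C * unit_pt t / z0) by rewrite lt0r h1 nc_ge0.
  rewrite lnM ?posrE ?nc_gt0 ?G0//; last by rewrite -nc_gt0.
  by rewrite lerD2r E bU// -E -nc_gt0.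
- rewrite RintegralD//; last by apply: cont_integrable => t _; exact: cU.
  by rewrite eG Gz0 Normc.normc1 ln1 mulr0 addr0.
- by move=> t; exact: nc_ge0.
Qed.

(* Jensen's inequality for [1 - f / w] averaged over [|w| = tau]: by Tonelli, the
   mean of [ln |1 - X e^(-is)|] over [s] is [ln+ |X|]. *)
Lemma log_tail tau : 0 < tau -> (forall z, nc z < 1 -> tau <= nc (f z) -> rho <= nc z) ->
  mu.-integrable `[0, 2 * pi] (EFin \o (fun t => lnp (nc (f (r%:C * unit_pt t)) / tau))) /\
  \int[mu]_(t in `[0, 2 * pi]) lnp (nc (f (r%:C * unit_pt t)) / tau) <= 2 * pi * ln rho^-1.
Proof.
move=> tau0 H.
have lr0 : 0 < ln rho^-1 by rewrite ln_gt0// invf_gt1.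
have r01 : 0 < r < 1 by rewrite r0.
have [|M HM] := @circle_bound _ f _ r r01; first by move=> z /andP[_]; exact: hf.
pose X t := f (r%:C * unit_pt t) / tau%:C.
have tC : tau%:C != 0 by rewrite -nc_gt0 nc_real gtr0_norm.
have nX t : nc (X t) = nc (f (r%:C * unit_pt t)) / tau.
  by rewrite Normc.normcM Normc.normcV nc_real gtr0_norm.
have M0 : 0 <= M by apply: le_trans (HM (r%:C * unit_pt 0) _); rewrite ?nc_ge0// nc_circ// ltW.
have XM t : nc (X t) <= M / tau.
  by rewrite nX ler_wpM2r ?invr_ge0 ?(ltW tau0)// HM// nc_circ// ltW.
(* The first term makes the kernel nonnegative for all pairs of angles; the second makes the lower
   bound [K - ln rho^-1] nonnegative. *)
pose K := Num.max (ln (1 + M / tau)) (ln rho^-1).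
have MT0 : 0 <= M / tau by rewrite divr_ge0// ltW.
have XK t : 1 + nc (X t) <= expR K.
  rewrite (@le_trans _ _ (1 + M / tau)) ?lerD2l//.
  rewrite -[X in X <= _]lnK ?posrE ?ltr_wpDr// ler_expR /K le_max lexx//.
have K0 : 0 <= K by rewrite le_max (ltW lr0) orbT.
have Kr : ln rho^-1 <= K by rewrite le_max lexx orbT.
clearbody K.
have pX t : pcont X t by apply: pcontM; [exact: pf|exact: pcont_cst].
have mX : cmeas X by exact: pcont_cmeas.
have ml : measurable_fun setT (fun t => lnp (nc (X t))).
  apply: measurable_maxr; first exact: measurable_cst.
  by apply: (measurableT_comp (@measurable_ln R)); exact: cmeas_nc.
have l0 t : 0 <= lnp (nc (X t)) by rewrite /lnp le_max lexx.
have lK t : lnp (nc (X t)) <= K.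
  rewrite /lnp ge_max K0 /=; have [->|x0] := eqVneq (nc (X t)) 0; first by rewrite ln0.
  have xp : 0 < nc (X t) by rewrite lt0r x0 nc_ge0.
  rewrite -[X in _ <= X]expRK ler_ln ?posrE ?expR_gt0//.
  by apply: le_trans (XK t); rewrite lerDr.
have il : mu.-integrable `[0, 2 * pi] (EFin \o (fun t => lnp (nc (X t)))).
  by apply: (bounded_integrable (B := K)) => // t; rewrite ger0_norm.
have -> : (fun t => lnp (nc (f (r%:C * unit_pt t)) / tau)) = fun t => lnp (nc (X t)).
  by apply/funext => t; rewrite nX.
split=> //.
pose Phi (p : R * R) := psi K (nc (1 - X p.1 * unit_pt (- p.2))).
have bP t s : nc (1 - X t * unit_pt (- s)) <= expR K.
  apply: le_trans (XK t); apply: (le_trans (ncD _ _)).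
  by rewrite Normc.normc1 ncN Normc.normcM nc_unit_pt mulr1.
have mun : cmeas (fun s : R => unit_pt (- s)).
  apply: pcont_cmeas => s; apply: pcont_pair => /=; apply: continuous_comp.
  - exact: opp_continuous.
  - exact: continuous_cos.
  - exact: opp_continuous.
  - exact: continuous_sin.
have mPhi : measurable_fun setT Phi.
  apply: measurable_psi; apply: cmeas_nc; apply: cmeasB; first exact: cmeas_cst.
  apply: cmeasM; first exact: (@cmeas_comp _ _ _ _ _ X fst measurable_fst mX).
  split; first exact: (measurableT_comp mun.1 measurable_snd).
  exact: (measurableT_comp mun.2 measurable_snd).
have Phi0 p : (0 <= Phi p)%E by apply: psi_ge0; [exact: nc_ge0|exact: bP].
have PhiE t s : Phi (t, s) = psi K (nc (1 - X t * unit_pt (- s))) by [].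
clearbody Phi.
have T := tonelli_itv (measurable_itv `[0, 2 * pi]) (measurable_itv `[0, 2 * pi]) mPhi Phi0.
have lower : ((2 * pi * (2 * pi * (K - ln rho^-1)))%:E <=
    \int[mu]_(s in `[0%R, (2 * pi)%R]) \int[mu]_(t in `[0%R, (2 * pi)%R]) Phi (t, s))%E.
  rewrite -Rint_cst -Rint_EFin; last by move=> t _; exact: cvg_cst.
  apply: ge0_le_integral => //.
  - by move=> t _; rewrite lee_fin mulr_ge0// subr_ge0.
  - by apply: measurable_funTS; exact: (measurable_itv_r _ mPhi Phi0).
  - move=> s _.
    have ws : (tau%:C * unit_pt s) != 0 by rewrite mulf_neq0// unit_pt_neq0.
    have E t : 1 - X t * unit_pt (- s) = 1 - f (r%:C * unit_pt t) / (tau%:C * unit_pt s).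
      by rewrite /X unit_ptN invfM mulrA.
    under eq_integral do rewrite PhiE E.
    apply: jensen_univalent => //; last by move=> t; rewrite -E.
    move=> z z1 fz; apply: H => //; rewrite fz Normc.normcM nc_unit_pt mulr1 nc_real.
    by rewrite gtr0_norm.
have upper : (\int[mu]_(t in `[0%R, (2 * pi)%R]) \int[mu]_(s in `[0%R, (2 * pi)%R]) Phi (t, s) <=
    (2 * pi * (2 * pi * K - \int[mu]_(t in `[0, 2 * pi]) lnp (nc (X t))))%:E)%E.
  have iK : mu.-integrable `[0, 2 * pi] (EFin \o (fun t : R => K)).
    by apply: cont_integrable => t _; exact: cvg_cst.
  have iB : mu.-integrable `[0, 2 * pi] (EFin \o (fun t => K - lnp (nc (X t)))).
    apply: (bounded_integrable (B := K)).
      by apply: measurable_funB => //; exact: measurable_cst.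
    by move=> t; rewrite ger0_norm ?subr_ge0// gerBl.
  have -> : (2 * pi * (2 * pi * K - \int[mu]_(t in `[0, 2 * pi]) lnp (nc (X t))))%:E =
    (\int[mu]_(t in `[0%R, (2 * pi)%R]) (2 * pi * (K - lnp (nc (X t))))%:E)%E.
    rewrite -(Rint_cst K) -RintegralB// -RintegralZl// /Rintegral fineK//.
    apply: integrable_fin_num => //.
    have -> : (fun t => (2 * pi * (K - lnp (nc (X t))))%:E) =
      (fun t => ((2 * pi)%:E * (K - lnp (nc (X t)))%R%:E)%E).
      by apply/funext => t /=; rewrite EFinM.
    exact: integrableZl.
  apply: ge0_le_integral => //.
  - by move=> t _; apply: integral_ge0 => s _; exact: Phi0.
  - by apply: measurable_funTS; exact: (measurable_itv_l _ mPhi Phi0).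
  - apply: measurable_funTS; apply/measurable_EFinP.
    by apply: measurable_funM; [exact: measurable_cst|apply: measurable_funB => //; exact: measurable_cst].
  - move=> t _; have E s : nc (1 - X t * unit_pt (- s)) = nc (1 - conj (X t) * unit_pt s).
      by rewrite -nc_conj conjB conj1 conjM conj_unit_pt.
    under eq_integral do rewrite PhiE E.
    by rewrite -(nc_conj (X t)); apply: psi_int_le; rewrite nc_conj.
have := le_trans lower; rewrite -T => /(_ _ upper); rewrite lee_fin ler_pM2l//.
rewrite mulrBr; lra.
Qed.

End jensen.

End univalent_tail.

(** * Growth and Hardy spaces *)

Section hardy_growth.
Context {R : realType}.
Local Open Scope complex_scope.
Implicit Types (z w h a : R[i]) (f G F : R[i] -> R[i]) (r t : R).
Local Notation mu := (@lebesgue_measure R).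

Let tpi0 : 0 <= 2 * pi :> R. Proof. by rewrite mulr_ge0// pi_ge0. Qed.

Lemma powR_le (x y q : R) : 0 <= q -> 0 <= x -> x <= y -> x `^ q <= y `^ q.
Proof.
by move=> q0 x0 xy; apply: ge0_ler_powR; rewrite ?nnegrE// (le_trans x0).
Qed.

Lemma powR_addr_le (x y p : R) : 0 < p -> 0 <= x -> 0 <= y ->
  (x + y) `^ p <= 2 `^ p * (x `^ p + y `^ p).
Proof.
move=> p0 x0 y0; apply: (@le_trans _ _ ((2 * Num.max x y) `^ p)).
  apply: powR_le; rewrite ?addr_ge0 ?(ltW p0)//.
  by rewrite mulr_natl mulr2n lerD// le_max lexx ?orbT.
rewrite powRM// ?le_max ?x0// ler_wpM2l ?powR_ge0//.
by case: (leP x y) => _; rewrite ?lerDl ?lerDr powR_ge0.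
Qed.

Lemma powR_exprn (x y : R) n : 0 <= x -> (x ^+ n) `^ y = (x `^ y) ^+ n.
Proof.
move=> x0; rewrite -(powR_mulrn n x0) -powRrM mulrC powRrM powR_mulrn//; exact: powR_ge0.
Qed.

Lemma ln_inv1B_le (e : R) : 0 <= e <= 2^-1 -> ln (1 - e)^-1 <= 2 * e.
Proof.
move=> /andP[e0 e1]; have d0 : 0 < 1 - e by lra.
have := expR_ge1Dx (ln (1 - e)^-1); rewrite lnK ?posrE ?invr_gt0// => h.
have : (1 - e)^-1 <= 1 + 2 * e by rewrite -[X in X <= _]mul1r ler_pdivrMr//; nra.
lra.
Qed.

Lemma lnp_ge0 (x : R) : 0 <= lnp x. Proof. by rewrite /lnp le_max lexx. Qed.

(** If [x] lies between [T 2^(N+1)] and [T 2^(N+2)], the term of index [N] alone is large enough: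
    its logarithm is at least [ln 2], and [T^q (2^q)^(N+2)] dominates [x^q]. This accounts for the
    factor [(2^q)^2 / ln 2]. *)
Lemma dyadic_bound (T q x : R) N : 0 < T -> 0 < q -> 0 <= x -> x <= T * 2 ^+ N.+1 ->
  x `^ q <= (2 * T) `^ q + \sum_(0 <= k < N)
    T `^ q * (2 `^ q) ^+ 2 / ln 2 * (2 `^ q) ^+ k * lnp (x / (T * 2 ^+ k)).
Proof.
move=> T0 q0 x0; have l2 : 0 < ln 2 :> R by rewrite ln_gt0// ltr1n.
have w0 : 0 < 2 `^ q :> R by exact: powR_gt0.
have Tq0 : 0 < T `^ q by exact: powR_gt0.
have c0 k : 0 <= T `^ q * (2 `^ q) ^+ 2 / ln 2 * (2 `^ q) ^+ k.
  apply: mulr_ge0; last by apply: exprn_ge0; exact: ltW.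
  apply: divr_ge0; last exact: ltW.
  by apply: mulr_ge0; [exact: ltW|apply: exprn_ge0; exact: ltW].
have pk k : (T * 2 ^+ k) `^ q = T `^ q * (2 `^ q) ^+ k.
  rewrite powRM ?(ltW T0) ?exprn_ge0//; congr (_ * _).
  exact: powR_exprn.
elim: N => [|N IH] xN.
  rewrite big_geq// addr0; apply: powR_le => //; [exact: ltW|by rewrite mulrC -[2]expr1].
rewrite big_nat_recr//= addrA; have [xl|xg] := leP x (T * 2 ^+ N.+1).
  by apply: (le_trans (IH xl)); rewrite lerDl mulr_ge0// lnp_ge0.
rewrite (@le_trans _ _ (T `^ q * (2 `^ q) ^+ N.+2))//.
  by rewrite -pk; apply: powR_le => //; exact: ltW.
rewrite (@le_trans _ _ (T `^ q * (2 `^ q) ^+ 2 / ln 2 * (2 `^ q) ^+ N * lnp (x / (T * 2 ^+ N))))//; last first.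
  by rewrite lerDr addr_ge0 ?powR_ge0// sumr_ge0// => k _; rewrite mulr_ge0// lnp_ge0.
have -> : T `^ q * (2 `^ q) ^+ N.+2 = T `^ q * (2 `^ q) ^+ 2 / ln 2 * (2 `^ q) ^+ N * ln 2.
  move: (ln 2) (T `^ q) (2 `^ q) l2 => l u w l2; rewrite !exprS expr0; field; by rewrite gt_eqF.
rewrite ler_wpM2l// /lnp le_max; apply/orP; right.
have P0 : 0 < T * 2 ^+ N by rewrite mulr_gt0// exprn_gt0.
have x2 : 2 <= x / (T * 2 ^+ N).
  by rewrite ler_pdivlMr// (le_trans _ (ltW xg))// exprS mulrCA.
have x2' := lt_le_trans (ltr0n R 2) x2.
by rewrite ler_ln// posrE.
Qed.

Lemma integral_sum_le (g : nat -> R -> R) (c B : nat -> R) (A : R) N :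
  (forall k, 0 <= c k) ->
  (forall k, mu.-integrable `[0, 2 * pi] (EFin \o g k) /\ \int[mu]_(t in `[0, 2 * pi]) g k t <= B k) ->
  mu.-integrable `[0, 2 * pi] (EFin \o (fun t => A + \sum_(0 <= k < N) c k * g k t)) /\
  \int[mu]_(t in `[0, 2 * pi]) (A + \sum_(0 <= k < N) c k * g k t) <=
    2 * pi * A + \sum_(0 <= k < N) c k * B k.
Proof.
move=> c0 H; elim: N => [|N [iN bN]].
  rewrite big_geq// addr0.
  have -> : (fun t : R => A + \sum_(0 <= k < 0) c k * g k t) = fun=> A.
    by apply/funext => t; rewrite big_geq// addr0.
  by split; [apply: cont_integrable => t _; exact: cvg_cst|rewrite Rint_cst].
have [ig bg] := H N.
have -> : (fun t : R => A + \sum_(0 <= k < N.+1) c k * g k t) =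
    fun t => (A + \sum_(0 <= k < N) c k * g k t) + c N * g N t.
  by apply/funext => t; rewrite big_nat_recr//= addrA.
have icg : mu.-integrable `[0, 2 * pi] (EFin \o (fun t => c N * g N t)).
  have -> : EFin \o (fun t => c N * g N t) = (fun t => (c N)%:E * (EFin \o g N) t)%E.
    by apply/funext => t /=; rewrite EFinM.
  exact: integrableZl.
split.
  have -> : EFin \o (fun t => A + \sum_(0 <= k < N) c k * g k t + c N * g N t) =
     ((EFin \o (fun t => (A + \sum_(0 <= k < N) c k * g k t)%R)) \+ (EFin \o (fun t => (c N * g N t)%R)))%E.
    by apply/funext => t /=; rewrite EFinD.
  exact: integrableD.
rewrite RintegralD// big_nat_recr//= addrA lerD// RintegralZl//.
by rewrite ler_wpM2l.
Qed.

Section growth.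
Variables (f : R[i] -> R[i]) (C b q : R).
Hypotheses (hf : holoD f) (fi : injD f) (f0 : f 0 = 0).
Hypotheses (C0 : 0 < C) (b0 : 0 < b) (q0 : 0 < q) (qb : q * b < 1).
Hypothesis gr : forall z, 2^-1 <= nc z -> nc z < 1 -> nc (f z) <= C * (1 - nc z) `^ (- b).

Lemma hardy_of_growth0 : exists M : R, forall r, 0 < r < 1 ->
  (\int[mu]_(t in `[0%R, (2 * pi)%R]) (nc (f (r%:C * unit_pt t)) `^ q)%R%:E <= M%:E)%E.
Proof.
have [|B HB] := @polar_bounded _ f 0 2^-1 (ltac:(by rewrite invr_ge0)).
  move=> r t /andP[r0 r1]; apply: cholo_ccont; apply: hf; rewrite nc_circ//; lra.
have fB z : nc z <= 2^-1 -> nc (f z) <= B.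
  by have [t ht {2}->] := polar_form z => z1; apply: HB; rewrite ?nc_ge0.
(* Exceeding [B] confines [|f| >= T] to [|z| > 1/2], where the growth bound holds; the second term
   keeps every [e k] at most [1/2]. *)
pose T := Num.max (B + 1) (C * 2 `^ b).
have TB : B < T by rewrite lt_max ltrDl ltr01.
have TC : C * 2 `^ b <= T by rewrite le_max lexx orbT.
have T0 : 0 < T by apply: lt_le_trans TC; rewrite mulr_gt0// powR_gt0.
clearbody T.
pose tau k : R := T * 2 ^+ k.
have tauT k : T <= tau k by rewrite /tau ler_peMr ?(ltW T0)// exprn_ege1// ler1n.
have tau0 k : 0 < tau k by apply: lt_le_trans (tauT k).
(* Solving [tau k <= C (1 - |z|)^(-b)]: a value of modulus [tau k] is taken only where
   [1 - |z| <= e k]. *)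
pose e k := (C / tau k) `^ b^-1.
have e0 k : 0 < e k by rewrite powR_gt0// divr_gt0.
have e1 k : e k <= 2^-1.
  have -> : 2^-1 = (2 `^ (- b)) `^ b^-1 :> R.
    by rewrite -powRrM mulNr divff ?gt_eqF// powR_inv1.
  apply: powR_le; rewrite ?invr_ge0 ?(ltW b0)//; first by rewrite divr_ge0// ltW.
  rewrite powRN ler_pdivrMr// mulrC ler_pdivlMr ?powR_gt0//.
  exact: le_trans (tauT k).
have L r k : 0 < r < 1 ->
    mu.-integrable `[0, 2 * pi] (EFin \o (fun t => lnp (nc (f (r%:C * unit_pt t)) / tau k))) /\
    \int[mu]_(t in `[0, 2 * pi]) lnp (nc (f (r%:C * unit_pt t)) / tau k) <= 2 * pi * (2 * e k).
  move=> /andP[r0 r1].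
  have E1 := e1 k; have E0 := e0 k.
  have [|i1 i2] := @log_tail _ f r (1 - e k) hf fi f0 r0 r1 (ltac:(lra)) (ltac:(lra)) _ (tau0 k).
    move=> z z1 tz.
    have zh : 2^-1 <= nc z.
      by rewrite leNgt; apply/negP => /ltW/fB; apply/negP; rewrite -ltNge (lt_le_trans TB)// (le_trans (tauT k)).
    have z1' : 0 < 1 - nc z by rewrite subr_gt0.
    have := le_trans tz (gr zh z1); rewrite powRN ler_pdivlMr ?powR_gt0// mulrC -ler_pdivlMr// => h.
    have : ((1 - nc z) `^ b) `^ b^-1 <= e k.
      by apply: powR_le; rewrite ?invr_ge0 ?powR_ge0 ?(ltW b0).
    rewrite -powRrM divff ?gt_eqF// powRr1; lra.
  split=> //; apply: (le_trans i2); rewrite ler_wpM2l// ln_inv1B_le// e1 andbT; exact: ltW.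
pose w : R := 2 `^ q; pose v : R := 2 `^ (- b^-1).
pose cc := T `^ q * w ^+ 2 / ln 2.
have w0 : 0 < w by exact: powR_gt0.
have l2 : 0 < ln 2 :> R by rewrite ln_gt0// ltr1n.
have cc0 : 0 <= cc by rewrite /cc !mulr_ge0 ?invr_ge0 ?exprn_ge0 ?powR_ge0 ?(ltW l2) ?(ltW w0).
(* The ratio is [2^(q - 1/b)]; this is where [q * b < 1] enters. *)
have wv : 0 <= w * v < 1.
  rewrite mulr_ge0 ?powR_ge0//= /w /v -powRD; last by rewrite pnatr_eq0 implybT.
  rewrite /powR pnatr_eq0 /= expR_lt1 pmulr_llt0//.
  by rewrite subr_lt0 -[b^-1]mul1r ltr_pdivlMr.
have ek k : e k = (C / T) `^ b^-1 * v ^+ k.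
  rewrite /e /tau invfM mulrA powRM ?divr_ge0 ?invr_ge0 ?exprn_ge0 ?(ltW C0) ?(ltW T0)//.
  congr (_ * _); rewrite -exprVn powR_exprn ?invr_ge0//; congr (_ ^+ _).
  by rewrite /v -(@powR_inv1 _ 2)// -powRrM mulN1r.
exists (2 * pi * (2 * T) `^ q + cc * (2 * pi) * 2 * (C / T) `^ b^-1 * (1 - w * v)^-1) => r r01.
have /andP[r0 r1] := r01.
have [|M HM] := @circle_bound _ f _ r r01; first by move=> z /andP[_]; exact: hf.
(* [N] depends on [r] through the maximum [M] on the circle; the geometric series makes the final
   bound independent of it. *)
have [N HN] : exists N, M <= T * 2 ^+ N.+1.
  have [||N HN] := @geo_small R 2^-1 (T / (`|M| + 1)).
  - by rewrite invr_ge0 ler0n invf_lt1 ?ltr1n.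
  - by rewrite divr_gt0// ltr_wpDl.
  exists N; have := HN N.+1 (leqnSn _); have P0 : (0 : R) < 2 ^+ N.+1 by exact: exprn_gt0.
  rewrite exprVn -[X in X <= _]mul1r ler_pdivrMr// mulrAC ler_pdivlMr ?ltr_wpDl// mul1r => h.
  by apply: le_trans h; rewrite (le_trans (ler_norm _))// lerDl.
have c0 k : 0 <= cc * w ^+ k by rewrite mulr_ge0// exprn_ge0// ltW.
have [iS bS] := @integral_sum_le (fun k t => lnp (nc (f (r%:C * unit_pt t)) / tau k))
  (fun k => cc * w ^+ k) (fun k => 2 * pi * (2 * e k)) ((2 * T) `^ q) N c0 (fun k => L r k r01).
have S0 t : 0 <= (2 * T) `^ q + \sum_(0 <= k < N) cc * w ^+ k * lnp (nc (f (r%:C * unit_pt t)) / tau k).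
  by rewrite addr_ge0 ?powR_ge0// sumr_ge0// => k _; rewrite mulr_ge0// lnp_ge0.
have mf : measurable_fun setT (fun t => nc (f (r%:C * unit_pt t))).
  apply: cmeas_nc; apply: pcont_cmeas => t; apply: pcont_circ; apply: cholo_ccont; apply: hf.
  by rewrite nc_circ// ltW.
apply: (@le_trans _ _ (\int[mu]_(t in `[0%R, (2 * pi)%R])
    ((2 * T) `^ q + \sum_(0 <= k < N) cc * w ^+ k * lnp (nc (f (r%:C * unit_pt t)) / tau k))%:E)%E).
  apply: ge0_le_integral => //.
  - by move=> t _; rewrite lee_fin powR_ge0.
  - apply: measurable_funTS; apply/measurable_EFinP; exact: (measurableT_comp (measurable_powR _) mf).
  - by move/integrableP : iS => [].
  - move=> t _; rewrite lee_fin; apply: dyadic_bound => //; first exact: nc_ge0.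
    by apply: le_trans HN; apply: HM; rewrite nc_circ// ltW.
have -> : (\int[mu]_(t in `[0%R, (2 * pi)%R])
    ((2 * T) `^ q + \sum_(0 <= k < N) cc * w ^+ k * lnp (nc (f (r%:C * unit_pt t)) / tau k))%:E)%E =
  (\int[mu]_(t in `[0, 2 * pi])
    ((2 * T) `^ q + \sum_(0 <= k < N) cc * w ^+ k * lnp (nc (f (r%:C * unit_pt t)) / tau k)))%:E.
  by rewrite /Rintegral fineK//; exact: integrable_fin_num.
rewrite lee_fin; apply: (le_trans bS); rewrite lerD2l.
have -> : \sum_(0 <= k < N) cc * w ^+ k * (2 * pi * (2 * e k)) =
    cc * (2 * pi) * 2 * (C / T) `^ b^-1 * \sum_(0 <= k < N) (w * v) ^+ k.
  rewrite mulr_sumr; apply: eq_bigr => k _; rewrite ek exprMn; ring.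
apply: ler_wpM2l; last exact: geo_sum_le.
apply: mulr_ge0; last exact: powR_ge0.
by apply: mulr_ge0 => //; apply: mulr_ge0.
Qed.

End growth.

(** Reduction to [f 0 = 0]: the constant [|f 0|] is absorbed in the growth bound because
    [(1 - |z|)^(-b) >= 1], and in the [q]-means up to the factor [2^q]. *)
Theorem hardy_of_growth f (C b q : R) : holoD f -> injD f -> 0 < C -> 0 < b -> 0 < q -> q * b < 1 ->
  (forall z, 2^-1 <= nc z -> nc z < 1 -> nc (f z) <= C * (1 - nc z) `^ (- b)) ->
  exists M : R, forall r, 0 < r < 1 ->
  (\int[mu]_(t in `[0%R, (2 * pi)%R]) (nc (f (r%:C * unit_pt t)) `^ q)%R%:E <= M%:E)%E.
Proof.
move=> hf fi C0 b0 q0 qb gr.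
pose a := nc (f 0); have a0 : 0 <= a by exact: nc_ge0.
pose g z := f z - f 0.
have hg : holoD g.
  by move=> z z1; have [d Hd] := hf z z1; eexists; apply: cdiffB; [exact: Hd|exact: cdiff_cst].
have gi : injD g by move=> z w z1 w1 /addIr; exact: fi.
have g0 : g 0 = 0 by rewrite /g subrr.
have fg z : nc (f z) <= nc (g z) + a by rewrite -[f z](subrK (f 0)); exact: ncD.
have gf z : nc (g z) <= nc (f z) + a by rewrite /g (le_trans (ncD _ _))// ncN.
have gg z : 2^-1 <= nc z -> nc z < 1 -> nc (g z) <= (C + a) * (1 - nc z) `^ (- b).
  move=> z1 z2; apply: (le_trans (gf z)); rewrite mulrDl lerD ?gr//.
  rewrite ler_peMr// powRN invf_ge1 ?powR_gt0 ?subr_gt0//.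
  rewrite -[X in _ <= X]((congr1 (fun g => g b) (@powR1 R)) : 1 `^ b = 1); apply: powR_le; [exact: ltW|by rewrite subr_ge0 ltW|].
  by rewrite gerBl nc_ge0.
have [//|M HM] := @hardy_of_growth0 g (C + a) b q hg gi g0 _ b0 q0 qb gg; first by rewrite ltr_wpDr.
exists (2 `^ q * (M + 2 * pi * a `^ q)) => r r01; have /andP[r0 r1] := r01.
have mf G : holoD G -> measurable_fun setT (fun t => nc (G (r%:C * unit_pt t)) `^ q).
  move=> hG; apply: (measurableT_comp (measurable_powR _)).
  apply: cmeas_nc; apply: pcont_cmeas => t; apply: pcont_circ; apply: cholo_ccont; apply: hG.
  by rewrite nc_circ// ltW.
have q2 : 0 <= 2 `^ q :> R by exact: powR_ge0.
apply: (@le_trans _ _ (\int[mu]_(t in `[0%R, (2 * pi)%R])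
   ((2 `^ q)%:E * ((nc (g (r%:C * unit_pt t)) `^ q)%:E + (a `^ q)%:E)))%E).
  apply: ge0_le_integral => //.
  - by move=> t _; rewrite lee_fin powR_ge0.
  - by apply: measurable_funTS; apply/measurable_EFinP; exact: mf.
  - apply: measurable_funTS; apply/measurable_EFinP => /=.
    apply: measurable_funM; first exact: measurable_cst.
    by apply: measurable_funD; [exact: mf|exact: measurable_cst].
  - move=> t _; rewrite -EFinD -EFinM lee_fin.
    apply: le_trans (powR_addr_le q0 (nc_ge0 _) a0).
    by apply: powR_le; [exact: ltW|exact: nc_ge0|exact: fg].
rewrite ge0_integralZl//; last 2 first.
- apply: measurable_funTS; apply/measurable_EFinP => /=.
  by apply: measurable_funD; [exact: mf|exact: measurable_cst].
- by move=> t _; rewrite -EFinD lee_fin addr_ge0// powR_ge0.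
rewrite EFinM lee_wpmul2l ?lee_fin// ge0_integralD//; last 3 first.
- by move=> t _; rewrite lee_fin powR_ge0.
- by apply: measurable_funTS; apply/measurable_EFinP; exact: mf.
- by move=> t _; rewrite lee_fin powR_ge0.
rewrite EFinD leeD ?HM//.
by rewrite Rint_EFin ?Rint_cst// => t _; exact: cvg_cst.
Qed.

End hardy_growth.

(** * Polar coordinates *)

Section affine.
Context {R : realType}.
Local Notation mu := (@lebesgue_measure R).
Local Open Scope ereal_scope.

Lemma lebesgue_affine_itv (c d a b : R) : c != 0%R ->
  mu `]a, b] = `|c|%:E * mu ((fun x : R => (c * x + d)%R) @^-1` `]a, b]).
Proof.
rewrite neq_lt => /orP[c0|c0].
  have -> : (fun x : R => (c * x + d)%R) @^-1` `]a, b] = `[((b - d) / c)%R, ((a - d) / c)%R[%classic.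
    apply/seteqP; split=> x /=; rewrite !in_itv /= ler_ndivrMr// ltr_ndivlMr//;
    by rewrite lerBrDr ltrBlDr andbC (mulrC x).
  rewrite !lebesgue_measure_itv /= !lte_fin ltr_nM2r ?invr_lt0// ltrD2r.
  case: ifP => _; last by rewrite mule0.
  by rewrite -!EFinB -EFinM ltr0_norm//; congr EFin; field; rewrite lt_eqF.
have -> : (fun x : R => (c * x + d)%R) @^-1` `]a, b] = `]((a - d) / c)%R, ((b - d) / c)%R]%classic.
  apply/seteqP; split=> x /=; rewrite !in_itv /= ler_pdivlMr// ltr_pdivrMr//;
  by rewrite lerBrDr ltrBlDr (mulrC x).
rewrite !lebesgue_measure_itv /= !lte_fin ltr_pM2r ?invr_gt0// ltrD2r.
case: ifP => _; last by rewrite mule0.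
by rewrite -!EFinB -EFinM gtr0_norm//; congr EFin; field; rewrite gt_eqF.
Qed.

Lemma measurable_affine (c d : R) : measurable_fun setT (fun x : R => (c * x + d)%R).
Proof.
apply: measurable_funD; last exact: measurable_cst.
by apply: measurable_funM; [exact: measurable_cst|exact: measurable_id].
Qed.

(** The image of Lebesgue measure under the affine map, scaled by [|c|], agrees with Lebesgue
    measure on half-open intervals, hence everywhere. *)
Lemma integral_affine (c d : R) (F : R -> \bar R) : c != 0%R -> measurable_fun setT F ->
  (forall x, 0 <= F x) -> \int[mu]_x F x = `|c|%:E * \int[mu]_x F (c * x + d)%R.
Proof.
move=> c0 mF F0.
have mphi : @measurable_fun _ _ (measurableTypeR R) (measurableTypeR R) setT
  (fun x : R => (c * x + d)%R) by exact: measurable_affine.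
pose phi : measurableTypeR R -> measurableTypeR R := (fun x : R => (c * x + d)%R).
pose k : {nonneg R} := NngNum (normr_ge0 c).
pose m0 := mscale k (pushforward mu phi); pose m := m0 mphi.
transitivity (\int[m]_x F x).
  apply: eq_measure_integral => A mA _.
  apply: lebesgue_measure_unique => // X [[a b] _ <-] /=.
  by rewrite /m /mscale /pushforward /=; exact: lebesgue_affine_itv.
rewrite ge0_integral_mscale//; congr (_ * _).
by rewrite ge0_integral_pushforward.
Qed.

Lemma integral_oppr (F : R -> \bar R) : measurable_fun setT F ->
  (forall x, 0 <= F x) -> \int[mu]_x F (- x)%R = \int[mu]_x F x.
Proof.
move=> mF F0; rewrite [RHS](@integral_affine (-1) 0)// ?oppr_eq0 ?oner_eq0//.
by rewrite normrN1 mul1e; apply: eq_integral => x _; rewrite mulN1r addr0.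
Qed.

Lemma integral_quarter_turn (F : R * R -> \bar R) : measurable_fun setT F ->
  (forall p, 0 <= F p) -> \int[mu \x mu]_w F ((- w.2)%R, w.1) = \int[mu \x mu]_w F w.
Proof.
move=> mF F0.
have mF' : measurable_fun setT (fun w : R * R => F ((- w.2)%R, w.1)).
  apply: (measurableT_comp mF); apply/measurable_fun_pairP; split=> //=.
    by exact: (measurableT_comp (@oppr_measurable R setT) measurable_snd).
  exact: measurable_fst.
rewrite (fubini_tonelli1 (m1 := mu) (m2 := mu) _ mF' (fun w => F0 _)).
rewrite (fubini_tonelli2 (m1 := mu) (m2 := mu) _ mF F0).
apply: eq_integral => x _; apply: (@integral_oppr (fun y => F (y, x))) => //.
exact: measurableT_comp.
Qed.

End affine.

(** * Polar integration over a quarter of the plane *)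

Section polar.
Context {R : realType}.
Local Notation mu := (@lebesgue_measure R).
Local Open Scope ereal_scope.

(** On this quarter of the plane, away from the origin, the slope [y / x] runs over [[-1, 1]] and
    the angle is its [atan]. *)
Definition sector : set (R * R) := [set w | (`|w.2| <= w.1)%R].

Lemma mem_sector w : (w \in sector) = (`|w.2| <= w.1)%R.
Proof. by apply/idP/idP; rewrite inE. Qed.

Lemma measurable_sector : measurable sector.
Proof.
have -> : sector = (fun w : R * R => (`|w.2| <= w.1)%R) @^-1` [set true].
  by apply/seteqP; split=> w /=.
rewrite -[X in measurable X]setTI; apply: measurable_fun_ler => //.
by apply: measurableT_comp => //; exact: measurable_snd.
Qed.

Lemma cos_atan_gt0 (s : R) : (0 < cos (atan s))%R.
Proof. by rewrite cos_gt0_pihalf// atan_gtNpi2 atan_ltpi2. Qed.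

Lemma sin_atan (s : R) : sin (atan s) = (cos (atan s) * s)%R.
Proof.
by rewrite -[X in (_ * X)%R]atanK /tan mulrCA mulfV ?mulr1// gt_eqF// cos_atan_gt0.
Qed.

Lemma measurable_cos_atan : measurable_fun setT (fun s : R => cos (atan s)).
Proof.
apply: continuous_measurable_fun => s; apply: continuous_comp; first exact: continuous_atan.
exact: continuous_cos.
Qed.

Lemma measurable_sin_atan : measurable_fun setT (fun s : R => sin (atan s)).
Proof.
apply: continuous_measurable_fun => s; apply: continuous_comp; first exact: continuous_atan.
exact: continuous_sin.
Qed.

(* Only linear substitutions occur: first [y = x s], then [x = rho cos (atan s)]. *)
Lemma polar_sector (F : R * R -> \bar R) : measurable_fun setT F -> (forall w, 0 <= F w) ->
  \int[mu \x mu]_(w in sector) F w =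
  \int[mu]_(r in `[0%R, +oo[) \int[mu]_(s in `[(-1)%R, 1%R])
    (F (r * cos (atan s), r * sin (atan s))%R * (`|r| * cos (atan s) ^+ 2)%:E).
Proof.
move=> mF F0.
pose A (p : R * R) := F (p.1, p.1 * p.2)%R * `|p.1|%:E.
pose B (p : R * R) := F (p.1 * cos (atan p.2), p.1 * sin (atan p.2))%R *
  (`|p.1| * cos (atan p.2) ^+ 2)%:E.
have A0 p : 0 <= A p by rewrite mule_ge0// lee_fin.
have B0 p : 0 <= B p by rewrite mule_ge0// lee_fin mulr_ge0// sqr_ge0.
have mabs : measurable_fun setT (fun p : R * R => `|p.1|%R).
  by apply: measurableT_comp => //; exact: measurable_fst.
have mca : measurable_fun setT (fun p : R * R => cos (atan p.2)).
  exact: (measurableT_comp measurable_cos_atan measurable_snd).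
have msa : measurable_fun setT (fun p : R * R => sin (atan p.2)).
  exact: (measurableT_comp measurable_sin_atan measurable_snd).
have mA : measurable_fun setT A.
  apply: emeasurable_funM; last exact/measurable_EFinP.
  apply: (measurableT_comp mF); apply/measurable_fun_pairP; split; first exact: measurable_fst.
  by apply: measurable_funM; [exact: measurable_fst|exact: measurable_snd].
have mB : measurable_fun setT B.
  apply: emeasurable_funM; last first.
    by apply/measurable_EFinP; apply: measurable_funM => //; apply: measurable_funX.
  apply: (measurableT_comp mF); apply/measurable_fun_pairP; split;
  by apply: measurable_funM => //; exact: measurable_fst.
have mFS : measurable_fun setT (F \_ sector).
  by apply/(measurable_restrictT _ measurable_sector); exact: measurable_funTS.
have FS0 w : 0 <= (F \_ sector) w by rewrite /patch; case: ifP.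
rewrite integral_mkcond (fubini_tonelli1 (m1 := mu) (m2 := mu) _ mFS FS0) /fubini_F.
transitivity (\int[mu]_(x in `[0%R, +oo[) \int[mu]_(s in `[(-1)%R, 1%R]) A (x, s)).
  rewrite [RHS]integral_mkcond; apply: eq_integral => x _; rewrite [RHS]/patch.
  rewrite mem_setE in_itv /= andbT.
  have mFx : measurable_fun setT (fun y => (F \_ sector) (x, y)).
    exact: measurableT_comp.
  have [x0|x0|x0] := ltgtP 0%R x.
  - rewrite (@integral_affine _ x 0)// ?gt_eqF// -ge0_integralZl//; last first.
      exact: (measurableT_comp mFx (measurable_affine _ _)).
    rewrite [RHS]integral_mkcond; apply: eq_integral => s _.
    rewrite /patch mem_sector mem_setE /= addr0 in_itv /= normrM (gtr0_norm x0).
    rewrite -[X in (_ <= X)%R]mulr1 ler_pM2l// ler_norml.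
    by case: ifP => _; rewrite ?mule0// /A /= muleC (gtr0_norm x0).
  - rewrite (eq_integral (fun=> 0)) ?integral0// => y _.
    rewrite /patch mem_sector /=; case: ifP => // h.
    by have := le_lt_trans (le_trans (normr_ge0 y) h) x0; rewrite ltxx.
  (* The slice of the sector over [x = 0] is a single point, hence null; on the other side the
     Jacobian [|x|] vanishes. *)
  - rewrite -x0 [RHS](eq_integral (fun=> 0)); last by move=> s _; rewrite /A /= normr0 mule0.
    rewrite integral0 -[RHS](integral_set1 (fun y => F (0%R, y)) 0%R) [RHS]integral_mkcond.
    apply: eq_integral => y _; rewrite /patch mem_sector /= normr_le0.
    rewrite (_ : (y \in [set 0%R]) = (y == 0%R))//.
    by apply/idP/eqP => [|->]; rewrite inE.
have BE r s : F (r * cos (atan s), r * sin (atan s))%R * (`|r| * cos (atan s) ^+ 2)%:E = B (r, s) by [].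
under [RHS]eq_integral => r _ do (under eq_integral => s _ do rewrite BE).
have AE x s : A (x, s) = F (x, x * s)%R * `|x|%:E by [].
clearbody A B.
rewrite (tonelli_itv (measurable_itv _) (measurable_itv _) mA A0).
rewrite (tonelli_itv (measurable_itv _) (measurable_itv _) mB B0).
apply: eq_integral => s _; have c0 := cos_atan_gt0 s.
rewrite [LHS]integral_mkcond (@integral_affine _ (cos (atan s)) 0) ?gt_eqF//; last 2 first.
- apply/(measurable_restrictT _ (measurable_itv _)); apply: measurable_funTS.
  exact: (measurableT_comp mA (measurable_pair2 _)).
- by move=> x; rewrite /patch; case: ifP.
rewrite -ge0_integralZl//; last 2 first.
- apply: (measurableT_comp _ (measurable_affine _ _)).
  apply/(measurable_restrictT _ (measurable_itv _)); apply: measurable_funTS.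
  exact: (measurableT_comp mA (measurable_pair2 _)).
- by move=> x _; rewrite /patch; case: ifP.
rewrite [RHS]integral_mkcond; apply: eq_integral => r _.
rewrite /patch !mem_setE /= !in_itv /= !andbT addr0 pmulr_rge0//.
case: ifP => _; last by rewrite mule0.
rewrite -BE AE (gtr0_norm c0) muleCA -EFinM (mulrC _ r) sin_atan mulrA.
by congr (_ * _%:E); rewrite normrM (gtr0_norm c0); ring.
Qed.

End polar.

(** * From the sector to the disk by quarter turns *)

Section polar_disk.
Context {R : realType}.
Local Notation mu := (@lebesgue_measure R).
Local Open Scope complex_scope.
Implicit Types (r s t : R).

Let tpi0 : 0 <= 2 * pi :> R. Proof. by rewrite mulr_ge0// pi_ge0. Qed.
Let pi0 : 0 < pi :> R. Proof. exact: pi_gt0. Qed.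

Lemma continuous_shift (g : R -> R) (c t : R) : {for t + c, continuous g} ->
  {for t, continuous (fun t => g (t + c))}.
Proof.
move=> cg; apply: (@continuous_comp _ _ _ (fun t => t + c) g) => //.
by apply: cvgD; [exact: cvg_id|exact: cvg_cst].
Qed.

Lemma Rint_shift (g : R -> R) (a b c : R) : (forall t, {for t, continuous g}) ->
  (forall t, 0 <= g t) ->
  \int[mu]_(t in `[a, b]) g (t + c) = \int[mu]_(t in `[(a + c), (b + c)]) g t.
Proof.
move=> cg g0; have mg : measurable_fun setT (EFin \o g).
  by apply/measurable_EFinP; exact: continuous_measurable_fun.
apply/EFin_inj; rewrite -!Rint_EFin//; last by move=> t _; exact: continuous_shift.
rewrite [RHS]integral_mkcond (@integral_affine _ 1 c) ?oner_eq0//; last 2 first.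
- by apply/(measurable_restrictT _ (measurable_itv _)); exact: measurable_funTS.
- by move=> t; rewrite /patch; case: ifP => //= _; rewrite lee_fin.
rewrite normr1 mul1e integral_mkcond; apply: eq_integral => t _.
by rewrite /patch !mem_setE /= !in_itv /= mul1r !lerD2r.
Qed.

(** The shifted arcs tile the interval from [- pi / 4] to [7 pi / 4]; periodicity moves the part
    left of [0] to the end of [[0, 2 pi]]. *)
Lemma Rint_four_arcs (g : R -> R) : (forall t, {for t, continuous g}) ->
  (forall t, 0 <= g t) -> (forall t, g (t + 2 * pi) = g t) ->
  \int[mu]_(t in `[- (pi / 4), pi / 4]) (\sum_(k < 4) g (t + k%:R * (pi / 2))) =
  \int[mu]_(t in `[0, 2 * pi]) g t.
Proof.
move=> cg g0 gp.
have cgk k t : {for t, continuous (fun t => g (t + k * (pi / 2)))} by exact: continuous_shift.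
have ig a b k : mu.-integrable `[a, b] (EFin \o (fun t => g (t + k * (pi / 2)))).
  by apply: cont_integrable.
have ia a b : mu.-integrable `[a, b] (EFin \o g) by apply: cont_integrable.
rewrite (_ : (fun t => \sum_(k < 4) g (t + k%:R * (pi / 2))) =
   fun t => g (t + 0 * (pi / 2)) + (g (t + 1 * (pi / 2)) + (g (t + 2 * (pi / 2)) + g (t + 3 * (pi / 2)))));
  last first.
  by apply/funext => t; rewrite 4!big_ord_recl big_ord0 /= addr0.
have cgk2 t : {for t, continuous (fun t => g (t + 2 * (pi / 2)) + g (t + 3 * (pi / 2)))}.
  by apply: cvgD; exact: cgk.
have cgk3 t : {for t, continuous (fun t => g (t + 1 * (pi / 2)) + (g (t + 2 * (pi / 2)) + g (t + 3 * (pi / 2))))}.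
  by apply: cvgD; [exact: cgk|exact: cgk2].
rewrite RintegralD//; last by apply: cont_integrable.
rewrite RintegralD//; last by apply: cont_integrable.
rewrite RintegralD// !Rint_shift//.
rewrite (@Rint_split _ (- (pi / 4) + 0 * (pi / 2)) 0)//; last 2 first.
- by rewrite mul0r addr0 oppr_le0 divr_ge0// ltW.
- by rewrite mul0r addr0 divr_ge0// ltW.
have -> : \int[mu]_(t in `[(- (pi / 4) + 0 * (pi / 2)), 0]) g t =
    \int[mu]_(t in `[(pi * 7 / 4), 2 * pi]) g t.
  under eq_Rintegral do rewrite -gp.
  have E : - (pi / 4) + 0 * (pi / 2) + 2 * pi = pi * 7 / 4 :> R by field.
  by rewrite Rint_shift// E add0r.
have split5 (p : R) : 0 < p -> [/\ p / 4 <= 2 * p, p / 4 <= p * 3 / 4, p * 3 / 4 <= 2 * p,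
    p * 3 / 4 <= p * 5 / 4 & p * 5 / 4 <= 2 * p].
  by move=> p0; split; lra.
have split6 (p : R) : 0 < p -> p * 5 / 4 <= p * 7 / 4 /\ p * 7 / 4 <= 2 * p.
  by move=> p0; split; lra.
have [le1 le2 le3 le4 le5] := split5 _ pi0; have [le6 le7] := split6 _ pi0.
rewrite [RHS](@Rint_split _ 0 (pi / 4))//; last by rewrite divr_ge0// ltW.
rewrite (@Rint_split _ (pi / 4) (pi * 3 / 4))//.
rewrite (@Rint_split _ (pi * 3 / 4) (pi * 5 / 4))//.
rewrite (@Rint_split _ (pi * 5 / 4) (pi * 7 / 4))//.
have -> : pi / 4 + 0 * (pi / 2) = pi / 4 :> R by field.
have -> : pi / 4 + 1 * (pi / 2) = pi * 3 / 4 :> R by field.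
have -> : pi / 4 + 2 * (pi / 2) = pi * 5 / 4 :> R by field.
have -> : pi / 4 + 3 * (pi / 2) = pi * 7 / 4 :> R by field.
have -> : - (pi / 4) + 1 * (pi / 2) = pi / 4 :> R by field.
have -> : - (pi / 4) + 2 * (pi / 2) = pi * 3 / 4 :> R by field.
have -> : - (pi / 4) + 3 * (pi / 2) = pi * 5 / 4 :> R by field.
by rewrite -!addrA addrC !addrA.
Qed.

(** The factor [cos (atan s) ^+ 2 = 1 / (1 + s ^+ 2)] is the derivative of [atan], which maps
    [[-1, 1]] onto [[- pi / 4, pi / 4]]. *)
Lemma Rint_atan (g : R -> R) : (forall t, {for t, continuous g}) ->
  (\int[mu]_(s in `[(-1)%R, 1%R]) (g (atan s) * cos (atan s) ^+ 2)%R%:E)%E =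
  (\int[mu]_(t in `[- (pi / 4), pi / 4]) g t)%:E.
Proof.
move=> cg.
have dE : derive1 (@atan R) = fun x => (1 + x ^+ 2)^-1 by apply/funext => x; rewrite derive1_atan.
have cd x : {for x, continuous (fun x : R => (1 + x ^+ 2)^-1)}.
  apply: cvgV; first by rewrite gt_eqF// ltr_wpDr// sqr_ge0.
  by apply: cvgD; [exact: cvg_cst|exact: exprn_continuous].
rewrite -Rint_EFin// -atan1 -atanN.
rewrite (@integration_by_substitution_increasing _ (@atan R))//.
- apply: eq_integral => s _; congr EFin => /=; congr (_ * _).
  by rewrite derive1_atan cos_atan exprVn sqr_sqrtr// addr_ge0// sqr_ge0.
- by move=> x y _ _; exact: lt_atan.
- by rewrite dE => x _; exact: cd.
- by rewrite dE; apply/cvg_ex; eexists; apply: cvg_at_right_filter; exact: cd.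
- by rewrite dE; apply/cvg_ex; eexists; apply: cvg_at_left_filter; exact: cd.
- split.
  + by move=> x _; exact: derivable_atan.
  + by apply: cvg_at_right_filter; exact: continuous_atan.
  + by apply: cvg_at_left_filter; exact: continuous_atan.
- by apply: continuous_subspaceT => t; exact: cg.
Qed.

Definition disk2 : set (R * R) := [set w | nc (w.1 +i* w.2) < 1].

Definition qturn (w : R * R) : R * R := (- w.2, w.1).

Lemma qturn4 w : iter 4 qturn w = w.
Proof. by case: w => x y; rewrite /= /qturn /= !opprK. Qed.

Lemma measurable_qturn n : measurable_fun setT (iter n qturn).
Proof.
elim: n => [|n IH]; first exact: measurable_id.
have -> : iter n.+1 qturn = qturn \o iter n qturn by [].
apply: measurableT_comp => //; apply/measurable_fun_pairP; split=> /=.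
  exact: (measurableT_comp (@oppr_measurable R setT) measurable_snd).
exact: measurable_fst.
Qed.

Lemma integral_qturn (F : R * R -> \bar R) n : measurable_fun setT F ->
  (forall p, 0 <= F p)%E ->
  (\int[mu \x mu]_w F (iter n qturn w) = \int[mu \x mu]_w F w)%E.
Proof.
move=> mF F0; elim: n => [//|n <-].
transitivity (\int[mu \x mu]_w (F \o iter n qturn) (qturn w))%E.
  by apply: eq_integral => w _; rewrite /= -iterSr.
apply: (@integral_quarter_turn _ (F \o iter n qturn)) => [|w]; last exact: F0.
by apply: (measurableT_comp mF); exact: measurable_qturn.
Qed.

Lemma qturn_polar n r t : iter n qturn (r * cos t, r * sin t) =
  (r * cos (t + n%:R * (pi / 2)), r * sin (t + n%:R * (pi / 2))).
Proof.
elim: n => [|n /= ->]; first by rewrite /= mul0r addr0.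
have -> : t + n.+1%:R * (pi / 2) = t + n%:R * (pi / 2) + pi / 2.
  by rewrite -natr1 mulrDl mul1r addrA.
by rewrite cosDpihalf sinDpihalf mulrN.
Qed.

Lemma polarE r t : (r * cos t) +i* (r * sin t) = r%:C * unit_pt t.
Proof. by apply: complex_eq => /=; ring. Qed.

Lemma sector_cover w : exists k : 'I_4, iter k qturn w \in sector.
Proof.
case: w => x y; have [yx|xy] := leP `|y| `|x|.
  have [x0|x0] := leP 0 x.
    by exists ord0; rewrite mem_sector /= (le_trans yx)// ger0_norm.
  exists (inord 2); rewrite inordK// mem_sector /= normrN.
  by rewrite (le_trans yx)// ltr0_norm.
have [y0|y0] := leP 0 y.
  exists (inord 3); rewrite inordK// mem_sector /= normrN opprK.
  by rewrite (le_trans (ltW xy))// ger0_norm.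
exists (inord 1); rewrite inordK// mem_sector /=.
by rewrite (le_trans (ltW xy))// ltr0_norm.
Qed.

Section polar_estimates.
Variable (Phi : R[i] -> R).
Hypotheses (mPhi : measurable_fun disk2 (fun w : R * R => Phi (w.1 +i* w.2))).
Hypotheses (mD : measurable disk2) (Phi0 : forall z, 0 <= Phi z).
Hypotheses (cPhi : forall r t, 0 <= r < 1 ->
  {for t, continuous (fun t => Phi (r%:C * unit_pt t))}).

Let F : R * R -> \bar R := (fun w : R * R => (Phi (w.1 +i* w.2))%:E) \_ disk2.

Let mF : measurable_fun setT F.
Proof. by apply/(measurable_restrictT _ mD); exact/measurable_EFinP. Qed.

Let F0 w : (0 <= F w)%E.
Proof. by rewrite /F /patch; case: ifP => // _; rewrite lee_fin. Qed.

Let Fk (k : 'I_4) w := F (iter k qturn w).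

Let mFk k : measurable_fun setT (Fk k).
Proof. by apply: (measurableT_comp mF); exact: measurable_qturn. Qed.

Let mSk k : measurable_fun setT (Fk k \_ sector).
Proof. by apply/(measurable_restrictT _ measurable_sector); exact: measurable_funTS. Qed.

Let Sk0 k w : (0 <= (Fk k \_ sector) w)%E.
Proof. by rewrite /patch; case: ifP => // _; exact: F0. Qed.

Let FP r t : 0 <= r -> F (r * cos t, r * sin t) =
  if r < 1 then (Phi (r%:C * unit_pt t))%:E else 0%E.
Proof.
move=> r0; rewrite /F /patch /= polarE.
have -> : ((r * cos t, r * sin t) \in disk2) = (r < 1); last by [].
by apply/idP/idP; rewrite inE /disk2 /= polarE nc_circ.
Qed.

Lemma polar_sum :
  (\int[mu \x mu]_(w in sector) (\sum_(k < 4) Fk k w) =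
   \int[mu]_(r in `[0%R, 1%R[) (r%:E * \int[mu]_(t in `[0%R, (2 * pi)%R]) (Phi (r%:C * unit_pt t))%:E))%E.
Proof.
have mG : measurable_fun setT (fun w => \sum_(k < 4) Fk k w)%E.
  by apply: emeasurable_sum => k; exact: mFk.
rewrite polar_sector//; last by move=> w; apply: sume_ge0 => k _; exact: F0.
rewrite integral_mkcond [RHS]integral_mkcond; apply: eq_integral => r _.
rewrite /patch !mem_setE !in_itv /= andbT; case: ifPn => //= r0.
have [r1|r1] := ltP r 1; last first.
  rewrite (eq_integral (fun=> 0%E)) ?integral0// => s _.
  by rewrite big1 ?mul0e// => k _; rewrite /Fk qturn_polar FP// ltNge r1.
pose g t := r * Phi (r%:C * unit_pt t).
have r01 : 0 <= r < 1 by rewrite r0.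
have cg t : {for t, continuous g} by apply: cvgM; [exact: cvg_cst|exact: cPhi].
have g0 t : 0 <= g t by rewrite mulr_ge0.
transitivity (\int[mu]_(s in `[(-1)%R, 1%R])
    ((\sum_(k < 4) g (atan s + k%:R * (pi / 2))) * cos (atan s) ^+ 2)%:E)%E.
  apply: eq_integral => s _.
  rewrite (eq_bigr (fun k : 'I_4 => (Phi (r%:C * unit_pt (atan s + k%:R * (pi / 2))))%:E)); last first.
    by move=> k _; rewrite /Fk qturn_polar FP// r1.
  rewrite sumEFin -EFinM ger0_norm//; congr EFin; rewrite mulrA; congr (_ * _).
  by rewrite mulr_suml; apply: eq_bigr => k _; rewrite mulrC.
rewrite (@Rint_atan (fun t => \sum_(k < 4) g (t + k%:R * (pi / 2)))); last first.
  by move=> t; apply: cvg_big => [|k _]; [exact: add_continuous|exact: continuous_shift].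
rewrite Rint_four_arcs//; last by move=> t; rewrite /g unit_ptD unit_pt2pi mulr1.
rewrite Rint_EFin; last by move=> t _; exact: cPhi.
rewrite RintegralZl ?EFinM//; apply: cont_integrable => t _; exact: cPhi.
Qed.

(** The four turned sectors cover the plane and overlap on the diagonals, so each point is counted
    at least once. An inequality is enough here, and no null set has to be discussed. *)
Lemma polar_upper : (\int[mu \x mu]_(w in disk2) (Phi (w.1 +i* w.2))%:E <=
   \int[mu]_(r in `[0%R, 1%R[) (r%:E * \int[mu]_(t in `[0%R, (2 * pi)%R]) (Phi (r%:C * unit_pt t))%:E))%E.
Proof.
rewrite -polar_sum integral_mkcond ge0_integral_sum//; [|exact: measurable_sector| |]; last 2 first.
- by move=> k; apply: measurable_funTS; exact: mFk.
- by move=> k w _; exact: F0.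
have -> : (\sum_(k < 4) \int[mu \x mu]_(w in sector) Fk k w =
    \int[mu \x mu]_w \sum_(k < 4) (Fk k \_ sector) (iter (4 - k) qturn w))%E.
  rewrite ge0_integral_sum//; last first.
    by move=> k; apply: measurableT_comp => //; exact: measurable_qturn.
  apply: eq_bigr => k _; rewrite (@integral_qturn (Fk k \_ sector))//.
  by rewrite [LHS]integral_mkcond.
apply: ge0_le_integral => //.
apply: emeasurable_sum => k; apply: measurableT_comp => //; exact: measurable_qturn.
move=> w _; have [k Hk] := sector_cover w.
(* If [k] quarter turns bring [w] into the sector, the summand with [4 - j = k] modulo [4] applies
   these turns and its [Fk j] undoes them; that summand alone is the integrand at [w]. *)
pose j : 'I_4 := inord ((4 - k) %% 4).
rewrite (bigD1 j)//= -[X in (X <= _)%E]adde0 leeD//; last by apply: sume_ge0 => i _.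
have jE v : iter (4 - j) qturn v = iter k qturn v.
  rewrite /j inordK ?ltn_pmod//; case: (k) => -[|[|[|[|//]]]] i //=.
  by rewrite -[LHS]/(iter 4 qturn v) qturn4.
rewrite /patch jE Hk /Fk -jE -iterD subnKC ?qturn4//; exact: ltnW (ltn_ord j).
Qed.

(** The integral over each sector is at most the full one; the crude factor [4] only affects
    constants. *)
Lemma polar_lower : (\int[mu]_(r in `[0%R, 1%R[)
     (r%:E * \int[mu]_(t in `[0%R, (2 * pi)%R]) (Phi (r%:C * unit_pt t))%:E) <=
   4%:E * \int[mu \x mu]_(w in disk2) (Phi (w.1 +i* w.2))%:E)%E.
Proof.
rewrite -polar_sum ge0_integral_sum//; [|exact: measurable_sector| |]; last 2 first.
- by move=> k; apply: measurable_funTS; exact: mFk.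
- by move=> k w _; exact: F0.
apply: (@le_trans _ _ (\sum_(k < 4) \int[mu \x mu]_w F w)%E).
  apply: lee_sum => k _; rewrite -(@integral_qturn F k)//.
  rewrite integral_mkcond; apply: ge0_le_integral => //; first exact: mSk.
    exact: mFk.
  by move=> w _; rewrite /patch; case: ifP => // _; exact: F0.
have I0 : (0 <= \int[mu \x mu]_w F w)%E by apply: integral_ge0 => w _; exact: F0.
rewrite [X in (_ <= _ * X)%E]integral_mkcond -/F 4!big_ord_recl big_ord0.
have -> : 4%:E = (1%:E + (1%:E + (1%:E + 1%:E)))%E :> \bar R.
  by rewrite -!EFinD; congr EFin; ring.
by rewrite !ge0_muleDl ?adde_ge0// !mul1e adde0.
Qed.

Lemma measurable_circle_mean : measurable_fun (`[0%R, 1%R[%classic : set R)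
  (fun r : R => (r%:E * \int[mu]_(t in `[0%R, (2 * pi)%R]) (Phi (r%:C * unit_pt t))%:E)%E).
Proof.
apply: emeasurable_funM.
  by apply: measurable_funTS; apply/measurable_EFinP; exact: measurable_id.
apply: (@eq_measurable_fun _ _ _ _ _ (fun r => \int[mu]_(t in `[0%R, (2 * pi)%R]) F (r * cos t, r * sin t)%R)%E).
  move=> r; rewrite inE /= in_itv /= => /andP[r0 r1]; apply: eq_integral => t _.
  by rewrite FP// r1.
apply: measurable_funTS.
apply: (@measurable_itv_l _ `[0, 2 * pi]%classic (fun p => F (p.1 * cos p.2, p.1 * sin p.2))) => //.
apply: (measurableT_comp mF); apply/measurable_fun_pairP; split.
  apply: measurable_funM; first exact: measurable_fst.
  exact: (measurableT_comp (continuous_measurable_fun (@continuous_cos R)) measurable_snd).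
apply: measurable_funM; first exact: measurable_fst.
exact: (measurableT_comp (continuous_measurable_fun (@continuous_sin R)) measurable_snd).
Qed.

End polar_estimates.

End polar_disk.

Section disk_measurability.
Context {R : realType}.
Local Open Scope complex_scope.
Local Notation mu := (@lebesgue_measure R).

Lemma cmeas_point : cmeas (fun w : R * R => w.1 +i* w.2).
Proof. by split; [exact: measurable_fst|exact: measurable_snd]. Qed.

Lemma measurable_disk2 : measurable (@disk2 R).
Proof.
have -> : @disk2 R = (fun w : R * R => nc (w.1 +i* w.2) < 1) @^-1` [set true].
  by apply/seteqP; split=> w /=.
rewrite -[X in measurable X]setTI; apply: measurable_fun_ltr => //.
exact: (cmeas_nc cmeas_point).
Qed.

Lemma cmeas_exprn d (T : measurableType d) (F : T -> R[i]) n : cmeas F -> cmeas (fun x => F x ^+ n).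
Proof.
move=> mF; elim: n => [|n IH]; first exact: cmeas_cst.
by under eq_fun do rewrite exprS; exact: cmeasM.
Qed.

Lemma cmeas_sum d (T : measurableType d) (F : nat -> T -> R[i]) n : (forall k, cmeas (F k)) ->
  cmeas (fun x => \sum_(0 <= k < n) F k x).
Proof.
move=> mF; elim: n => [|n IH].
  by under eq_fun do rewrite big_geq//; exact: cmeas_cst.
by under eq_fun do rewrite big_nat_recr//=; exact: cmeasD.
Qed.

Lemma csums_cvg (u : nat -> R[i]) l : csums u l ->
  complex.Re (\sum_(0 <= k < n) u k) @[n --> \oo] --> complex.Re l /\
  complex.Im (\sum_(0 <= k < n) u k) @[n --> \oo] --> complex.Im l.
Proof.
move=> H; split; apply/cvgrPdist_le => e e0; have [N HN] := H _ e0;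
  exists N => // n /= Nn; rewrite -raddfB; have := HN n Nn; rewrite ncB; apply: le_trans.
- exact: Re_le_nc.
- exact: Im_le_nc.
Qed.

(** The values of [f] off the disk are arbitrary, so [f] is replaced by its extension by zero; on
    the disk its components are limits of Taylor polynomials. *)
Lemma holo_cmeas (f : R[i] -> R[i]) : holoD f ->
  exists G : R * R -> R[i], cmeas G /\ forall w, disk2 w -> G w = f (w.1 +i* w.2).
Proof.
move=> hf; have [hp cf] := holoD_punct hf.
pose S n (w : R * R) := \sum_(0 <= k < n) tcoef f k * (w.1 +i* w.2) ^+ k.
have mS n : cmeas (S n).
  by apply: cmeas_sum => k; apply: cmeasM; [exact: cmeas_cst|apply: cmeas_exprn; exact: cmeas_point].
have cS w : disk2 w -> _ := fun w1 => csums_cvg (taylor hp cf w1).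
pose g (w : R * R) := f (w.1 +i* w.2).
exists (fun w => ((fun w => complex.Re (g w)) \_ (@disk2 R)) w +i* ((fun w => complex.Im (g w)) \_ (@disk2 R)) w).
split; last first.
  by move=> w w1; rewrite /patch mem_set// /g; case: (f _).
split; apply/(measurable_restrictT _ measurable_disk2).
- apply: (@measurable_fun_cvg _ _ _ _ (fun n w => complex.Re (S n w))).
    by move=> n; apply: measurable_funTS; exact: (mS n).1.
  by move=> w w1; exact: (cS w w1).1.
- apply: (@measurable_fun_cvg _ _ _ _ (fun n w => complex.Im (S n w))).
    by move=> n; apply: measurable_funTS; exact: (mS n).2.
  by move=> w w1; exact: (cS w w1).2.
Qed.

(** Where [g] vanishes the power may fail to be differentiable; there [g <= e^(1/p)] gives
    [g^p <= e] directly. *)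
Lemma continuous_powR_comp (g : R -> R) (p t : R) : 0 < p -> (forall s, 0 <= g s) ->
  {for t, continuous g} -> {for t, continuous (fun s => g s `^ p)}.
Proof.
move=> p0 g0 cg; have [gt0|gt0] := ltP 0 (g t).
  apply: (@continuous_comp _ _ _ g (fun x => x `^ p)) => //.
  apply: differentiable_continuous; apply/derivable1_diffP.
  by apply: derivable_powR; rewrite in_itv /= gt0.
have gt : g t = 0 by apply/eqP; rewrite eq_le gt0 g0.
apply/cvg_eps => e e0.
have e1 : 0 < e `^ p^-1 by rewrite powR_gt0.
move/cvg_eps : cg => /(_ _ e1)[r r0 Hr]; exists r => // h /Hr.
rewrite gt powR0 ?gt_eqF// !subr0 !ger0_norm ?powR_ge0// => H.
rewrite -[X in _ <= X]powRr1 ?(ltW e0)// -(@mulVf _ p) ?gt_eqF// powRrM.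
by apply: powR_le => //; exact: ltW.
Qed.

End disk_measurability.

(** * Growth of univalent functions in Bergman spaces *)

Section bergman_growth.
Context {R : realType}.
Local Open Scope complex_scope.
Implicit Types (z w h a : R[i]) (f G F k : R[i] -> R[i]) (r t : R).
Local Notation mu := (@lebesgue_measure R).

Let tpi0 : 0 <= 2 * pi :> R. Proof. by rewrite mulr_ge0// pi_ge0. Qed.

(* [k] is a multiple of a branch of [((f - f 0) / z) ^ p]. *)
Lemma power_branch f p : holoD f -> injD f ->
  exists k, exists2 c : R, 0 < c & holoD k /\
  forall z, nc z < 1 -> z != 0 -> nc (k z) = c * (nc (f z - f 0) / nc z) `^ p.
Proof.
move=> hf fi; have z01 : nc (0 : R[i]) < 1 by rewrite Normc.normc0.
have [d Hd] := hf _ z01.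
have hg := dquot_holo hf z01 Hd; have g0 := dquot_zero_free hf fi z01 Hd.
have [L [hL _ EL]] := log_branch hg g0.
have c0 : 0 < nc (dquot f 0 d 0) by rewrite nc_gt0 g0.
exists (fun z => cexp (p%:C * L z)), (nc (dquot f 0 d 0) `^ (- p)); first exact: powR_gt0.
split=> [z z1|z z1 z0].
  apply: cholo_comp; last by eexists; exact: cdiff_cexp.
  by have [e He] := hL z z1; eexists; exact: cdiffZ He.
have -> : nc (f z - f 0) / nc z = nc (dquot f 0 d z).
  by rewrite /dquot (negbTE z0) subr0 Normc.normcM Normc.normcV.
rewrite (EL z z1) nc_cexp Normc.normcM nc_cexp powRM ?nc_ge0 ?expR_ge0// mulrA -powRD; last first.
  by apply/implyP => _; rewrite gt_eqF.
rewrite addNr powRr0 mul1r -expRM; congr expR.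
by rewrite cReM /= mul0r subr0 mulrC.
Qed.

(** Cauchy's formula with [|w / (w - z)| <= rho / (rho - |z|)] on the circle. *)
Lemma circle_mean_bound k z rho : holoD k -> 0 < nc z -> nc z < rho -> rho < 1 ->
  2 * pi * nc (k z) <= rho / (rho - nc z) * \int[mu]_(t in `[0, 2 * pi]) nc (k (rho%:C * unit_pt t)).
Proof.
move=> hk z0 zr r1; have [hp ck] := holoD_punct hk.
have r0 : 0 < rho by exact: lt_trans zr.
have d0 : 0 < rho - nc z by rewrite subr_gt0.
have E := cauchy_formula hp ck z0 zr r1.
have -> : 2 * pi * nc (k z) = nc (circ (fun w => k w * (w / (w - z))) rho).
  by rewrite E Normc.normcM nc_real ger0_norm.
have wz w : nc w = rho -> w - z != 0.
  by move=> wr; rewrite subr_eq0; apply: contraTneq zr => <-; rewrite wr ltxx.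
have cK t : pcont (fun t => k (rho%:C * unit_pt t)) t.
  by apply: pcont_circ; apply: cholo_ccont; apply: hk; rewrite nc_circ// ltW.
have cF t : pcont (fun t => k (rho%:C * unit_pt t) * (rho%:C * unit_pt t / (rho%:C * unit_pt t - z))) t.
  apply: (@pcont_circ _ (fun w => k w * (w / (w - z)))); apply: cholo_ccont; apply: cholo_M.
    by apply: hk; rewrite nc_circ// ltW.
  apply: cholo_M; first by eexists; exact: cdiff_id.
  eexists; apply: cdiffV; last by apply: cdiffB; [exact: cdiff_id|exact: cdiff_cst].
  by apply: wz; rewrite nc_circ// ltW.
apply: (le_trans (cint_nc _)) => [t _|]; first exact: cF.
rewrite -RintegralZl//; last by apply: cont_integrable => t _; exact: pcont_nc.
apply: le_Rintegral => //.
- by apply: cont_integrable => t _; exact: pcont_nc.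
- by apply: cont_integrable => t _; apply: cvgM; [exact: cvg_cst|exact: pcont_nc].
move=> t _; rewrite !Normc.normcM Normc.normcV (mulrC (nc (k _))) ler_wpM2r ?nc_ge0//.
rewrite -[X in X / _]Normc.normcM nc_circ ?(ltW r0)// ler_wpM2l ?(ltW r0)//.
rewrite lef_pV2 ?posrE ?nc_gt0 ?wz ?nc_circ ?(ltW r0)//.
by have := ncBD (rho%:C * unit_pt t) (- z); rewrite ncN nc_circ// ltW.
Qed.

(** The two signs of [alpha] use opposite ends of the range of [m]. *)
Lemma powR_weight (alpha d m : R) : 0 < d -> d / 4 <= m -> m <= d ->
  m `^ (- alpha) <= 4 `^ `|alpha| * d `^ (- alpha).
Proof.
move=> d0 dm md; have m0 : 0 < m by apply: lt_le_trans dm; rewrite divr_gt0.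
have [a0|a0] := leP 0 alpha.
  rewrite (ger0_norm a0) !powRN -[4 `^ alpha]invrK -invfM lef_pV2 ?posrE; last 2 first.
  - by rewrite powR_gt0.
  - by rewrite mulr_gt0 ?invr_gt0 ?powR_gt0.
  rewrite -powRN.
  have -> : 4 `^ (- alpha) = 4^-1 `^ alpha :> R.
    by rewrite -(@powR_inv1 _ 4)// -powRrM mulN1r.
  rewrite -powRM ?invr_ge0 ?(ltW d0)//; apply: powR_le => //; last by rewrite mulrC.
  by rewrite mulr_ge0 ?invr_ge0// ltW.
have na : 0 <= - alpha by rewrite oppr_ge0 ltW.
apply: (@le_trans _ _ (d `^ (- alpha))); first by apply: powR_le => //; exact: ltW.
rewrite ler_peMl ?powR_ge0// -[X in X <= _](powRr0 4).
by apply: ler_powR => //; rewrite ler1n.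
Qed.

Section growth.
Variables (f : R[i] -> R[i]) (p alpha : R).
Hypotheses (hf : holoD f) (fi : injD f) (p0 : 0 < p) (al : -1 < alpha).

Let Phi z : R := nc (f z) `^ p * (1 - nc z ^+ 2) `^ alpha.

Hypothesis fin : (\int[mu \x mu]_(w in @disk2 R) (Phi (w.1 +i* w.2))%:E < +oo)%E.

Let Phi0 z : 0 <= Phi z. Proof. by rewrite mulr_ge0// powR_ge0. Qed.

Let cPhi r t : 0 <= r < 1 -> {for t, continuous (fun t => Phi (r%:C * unit_pt t))}.
Proof.
move=> /andP[r0 r1]; apply: cvgM.
  apply: continuous_powR_comp => //; first by move=> s; exact: nc_ge0.
  apply: pcont_nc; apply: pcont_circ; apply: cholo_ccont; apply: hf.
  by rewrite nc_circ.
have -> : (fun s => (1 - nc (r%:C * unit_pt s) ^+ 2) `^ alpha) = fun=> (1 - r ^+ 2) `^ alpha.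
  by apply/funext => s; rewrite nc_circ.
rewrite nc_circ//; exact: cvg_cst.
Qed.

Let mPhi : measurable_fun (@disk2 R) (fun w : R * R => Phi (w.1 +i* w.2)).
Proof.
have [G [mG GE]] := holo_cmeas hf.
apply: (@eq_measurable_fun _ _ _ _ _ (fun w : R * R => nc (G w) `^ p * (1 - nc (w.1 +i* w.2) ^+ 2) `^ alpha)).
  by move=> w; rewrite inE => w1; rewrite /Phi GE.
apply: measurable_funTS; apply: measurable_funM.
  exact: (measurableT_comp (measurable_powR _) (cmeas_nc mG)).
apply: (measurableT_comp (measurable_powR _)); apply: measurable_funB; first exact: measurable_cst.
by apply: measurable_funX; exact: (cmeas_nc cmeas_point).
Qed.

Let I := fine (\int[mu \x mu]_(w in @disk2 R) (Phi (w.1 +i* w.2))%:E)%E.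

Let I0 : 0 <= I.
Proof. by apply: fine_ge0; apply: integral_ge0 => w _; rewrite lee_fin. Qed.

Let IE : (\int[mu \x mu]_(w in @disk2 R) (Phi (w.1 +i* w.2))%:E = I%:E)%E.
Proof.
rewrite /I fineK// ge0_fin_numE//; apply: integral_ge0 => w _; by rewrite lee_fin.
Qed.

Let Q rho := (rho%:E * \int[mu]_(t in `[0%R, (2 * pi)%R]) (Phi (rho%:C * unit_pt t))%:E)%E.

(** Finiteness of the area integral controls the circle integrals only on average, so the inequality
    is integrated over radii in [[a, b]]. The [4] is that of [polar_lower]. *)
Lemma average_bound (a b Y c : R) : 0 <= a -> a < b -> b < 1 -> 0 <= c ->
  (forall rho, a <= rho <= b ->
     Y <= c * (rho * \int[mu]_(t in `[0, 2 * pi]) Phi (rho%:C * unit_pt t))) ->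
  Y * (b - a) <= c * (4 * I).
Proof.
move=> a0 ab b1 c0 H.
have [Y0|Y0] := leP Y 0.
  apply: (@le_trans _ _ 0); last by rewrite !mulr_ge0.
  by rewrite mulr_le0_ge0// subr_ge0 ltW.
rewrite -lee_fin.
have sJ : `[a, b]%classic `<=` (`[0, 1[%classic : set R).
  move=> x /=; rewrite !in_itv /= => /andP[h1 h2].
  by rewrite (le_trans a0)// (le_lt_trans h2).
have mQ := measurable_circle_mean mPhi measurable_disk2 Phi0.
have Q0 rho : 0 <= rho -> (0 <= Q rho)%E.
  move=> r0; rewrite mule_ge0 ?lee_fin//; apply: integral_ge0 => t _; by rewrite lee_fin.
have mQJ : measurable_fun `[a, b] Q by exact: measurable_funS mQ.
apply: (@le_trans _ _ (\int[mu]_(rho in `[a, b]) (c%:E * Q rho))%E).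
  have -> : (Y * (b - a))%:E = (\int[mu]_(rho in `[a, b]) Y%:E)%E.
    by rewrite integral_cst//= lebesgue_measure_itv /= lte_fin ab EFinM EFinB.
  apply: ge0_le_integral => //.
  - by move=> x _; rewrite lee_fin ltW.
  - by apply: emeasurable_funM => //; exact: measurable_cst.
  move=> x /=; rewrite in_itv /= => xJ; have /andP[x1 x2] := xJ.
  rewrite /Q Rint_EFin; last first.
    by move=> t _; apply: cPhi; rewrite (le_trans a0 x1) (le_lt_trans x2 b1).
  by rewrite -!EFinM lee_fin H.
rewrite ge0_integralZl//; last first.
  by move=> x /sJ /=; rewrite in_itv /= => /andP[x0 _]; exact: Q0.
rewrite EFinM lee_wpmul2l ?lee_fin// EFinM -IE.
apply: le_trans (polar_lower mPhi measurable_disk2 Phi0 cPhi).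
apply: ge0_subset_integral => //.
by move=> x /=; rewrite in_itv /= => /andP[x0 _]; exact: Q0.
Qed.

(** With [d = 1 - |z|], the Cauchy kernel costs [1 / d], averaging over radii another [1 / d], and
    removing the weight [d^(- alpha)]. This bounds the branch of [((f - f 0) / z)^p] by a multiple
    of [d^(- (alpha + 2))], and a [p]-th root follows. *)
Lemma bergman_growth : exists2 C : R, 0 < C &
  forall z, 2^-1 <= nc z -> nc z < 1 -> nc (f z) <= C * (1 - nc z) `^ (- ((alpha + 2) / p)).
Proof.
have al1 : 1 <= alpha + 2 by rewrite -lerBlDr (le_trans _ (ltW al))// lerBlDr; lra.
have al0 : 0 < alpha + 2 by exact: lt_le_trans al1.
have [k [c c0 [hk kE]]] := power_branch p hf fi.
pose a := nc (f 0); have a0 : 0 <= a by exact: nc_ge0.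
pose A := c * 4 `^ p; pose B : R := 4 `^ `|alpha|.
have A0 : 0 < A by rewrite mulr_gt0// powR_gt0.
have B0 : 0 < B by rewrite powR_gt0.
have nE z : nc z = 0 -> nc z < 2^-1 by move=> ->; rewrite invr_gt0.
have kA z : 2^-1 <= nc z -> nc z < 1 -> nc (k z) <= A * (nc (f z) `^ p + a `^ p).
  move=> z1 z2; have z0 : 0 < nc z by apply: lt_le_trans z1; rewrite invr_gt0.
  rewrite kE// -?nc_gt0// /A -mulrA ler_wpM2l ?(ltW c0)//.
  apply: (@le_trans _ _ ((2 * (nc (f z) + a)) `^ p)).
    apply: powR_le; rewrite ?(ltW p0) ?divr_ge0 ?nc_ge0//.
    rewrite ler_pdivrMr//; apply: (@le_trans _ _ (nc (f z) + a)).
      by apply: (le_trans (ncD _ _)); rewrite ncN.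
    by have fa : 0 <= nc (f z) + a; [rewrite addr_ge0 ?nc_ge0|nra].
  rewrite powRM ?addr_ge0 ?nc_ge0//.
  have -> : 4 `^ p = 2 `^ p * 2 `^ p :> R by rewrite -powRM//; congr (_ `^ _); ring.
  by rewrite -mulrA ler_wpM2l ?powR_ge0// powR_addr_le// nc_ge0.
pose C1 := 2 * (2 * pi * A * a `^ p); pose C2 := 4 * (4 * A * B) * (4 * I).
have C10 : 0 <= C1.
  by apply: mulr_ge0 => //; apply: mulr_ge0; [apply: mulr_ge0 => //; exact: ltW|exact: powR_ge0].
have C20 : 0 <= C2.
  apply: mulr_ge0; last exact: mulr_ge0.
  by apply: mulr_ge0 => //; apply: mulr_ge0; [apply: mulr_ge0 => //; exact: ltW|exact: ltW].
have kb z : 2^-1 <= nc z -> nc z < 1 ->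
    nc (k z) <= (C1 + C2 + 1) * (1 - nc z) `^ (- (alpha + 2)).
  move=> z1 z2; have z0 : 0 < nc z by apply: lt_le_trans z1; rewrite invr_gt0.
  pose d := 1 - nc z; have d0 : 0 < d by rewrite subr_gt0.
  have d1 : d <= 1 by rewrite gerBl ltW.
  have da : 0 < d `^ (- alpha) by exact: powR_gt0.
  (* For [rho] in [[r1, r2]], [1 - rho] lies between [d / 4] and [d / 2], [rho - |z|] is at least
     [d / 2], and the interval has length [d / 4]. *)
  pose r1 := (1 + nc z) / 2; pose r2 := (3 + nc z) / 4.
  (* The contribution of [f 0] is subtracted so that what remains is bounded by the weighted circle
     integral alone, as [average_bound] requires. *)
  pose Y := 2 * pi * nc (k z) - 2 / d * (2 * pi * A * a `^ p).
  have YQ : Y * (r2 - r1) <= 4 / d * (A * B * d `^ (- alpha)) * (4 * I).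
    apply: average_bound; rewrite /r1 /r2.
    - lra.
    - lra.
    - lra.
    - by apply: mulr_ge0; [exact: divr_ge0 (ltW d0)|apply: mulr_ge0; [apply: mulr_ge0; exact: ltW|exact: ltW]].
    move=> rho /andP[h1 h2].
    have rz : nc z < rho by lra.
    have rho1 : rho < 1 by lra.
    have rho0 : 0 < rho by lra.
    have rhoh : 2^-1 <= rho by lra.
    have rhod : d / 2 <= rho - nc z by rewrite /d; lra.
    have m1 : d / 4 <= 1 - rho ^+ 2 by rewrite /d expr2; nra.
    have m2 : 1 - rho ^+ 2 <= d by rewrite /d expr2; nra.
    have := circle_mean_bound hk z0 rz rho1.
    set J := \int[mu]_(t in _) _ => XJ.
    set K := \int[mu]_(t in _) _.
    have cP t : {for t, continuous (fun t => Phi (rho%:C * unit_pt t))}.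
      by apply: cPhi; rewrite (ltW rho0) rho1.
    have JK : J <= A * (B * d `^ (- alpha) * K + 2 * pi * a `^ p).
      have -> : A * (B * d `^ (- alpha) * K + 2 * pi * a `^ p) =
          \int[mu]_(t in `[0, 2 * pi]) (A * (B * d `^ (- alpha) * Phi (rho%:C * unit_pt t) + a `^ p)).
        rewrite RintegralZl//; last first.
          apply: cont_integrable => t _; apply: cvgD; last exact: cvg_cst.
          by apply: cvgM; [exact: cvg_cst|exact: cP].
        rewrite RintegralD//; last 2 first.
        - by apply: cont_integrable => t _; apply: cvgM; [exact: cvg_cst|exact: cP].
        - by apply: cont_integrable => t _; exact: cvg_cst.
        by rewrite RintegralZl// ?Rint_cst//; apply: cont_integrable => t _; exact: cP.
      apply: le_Rintegral => //.
      - apply: cont_integrable => t _; apply: pcont_nc; apply: pcont_circ; apply: cholo_ccont.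
        by apply: hk; rewrite nc_circ// ltW.
      - apply: cont_integrable => t _; apply: cvgM; first exact: cvg_cst.
        by apply: cvgD; [apply: cvgM; [exact: cvg_cst|exact: cP]|exact: cvg_cst].
      move=> t _; have nr : nc (rho%:C * unit_pt t) = rho by rewrite nc_circ// ltW.
      apply: (le_trans (kA _ _ _)); rewrite ?nr// ler_wpM2l ?(ltW A0)// lerD2r.
      have m0 : 0 < 1 - rho ^+ 2 by apply: lt_le_trans m1; rewrite divr_gt0.
      have -> : nc (f (rho%:C * unit_pt t)) `^ p = Phi (rho%:C * unit_pt t) * (1 - rho ^+ 2) `^ (- alpha).
        by rewrite /Phi nr -mulrA powRN mulfV ?mulr1// gt_eqF// powR_gt0.
      by rewrite mulrC ler_wpM2r// powR_weight.
    have K0 : 0 <= K by apply: Rintegral_ge0 => t _.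
    have J0 : 0 <= J by apply: Rintegral_ge0 => t _; exact: nc_ge0.
    have XJ' : 2 * pi * nc (k z) <= 2 / d * J.
      apply: (le_trans XJ); rewrite ler_wpM2r//.
      rewrite ler_pdivrMr ?subr_gt0// mulrAC ler_pdivlMr//; nra.
    rewrite /Y lerBlDr; apply: (le_trans XJ').
    have E : 4 / d * (A * B * d `^ (- alpha)) * (rho * K) + 2 / d * (2 * pi * A * a `^ p) =
      2 / d * (A * (B * d `^ (- alpha) * (2 * rho * K) + 2 * pi * a `^ p)).
      by field; rewrite gt_eqF.
    rewrite E ler_wpM2l ?divr_ge0 ?(ltW d0)//; apply: (le_trans JK).
    rewrite ler_wpM2l ?(ltW A0)// lerD2r ler_wpM2l ?mulr_ge0 ?(ltW B0) ?(ltW da)//.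
    by rewrite ler_peMl//; lra.
  have r12 : r2 - r1 = d / 4 by rewrite /r1 /r2 /d; field.
  have d2 : d `^ (- (alpha + 2)) = d `^ (- alpha) / d ^+ 2.
    rewrite opprD powRD; last by apply/implyP => _; rewrite gt_eqF.
    by rewrite (powRN d 2) powR_mulrn// ltW.
  (* Since [alpha + 2 >= 1] and [d <= 1], the term coming from [f 0] is of lower order. *)
  have dd : d^-1 <= d `^ (- (alpha + 2)).
    rewrite -powR_inv1 ?(ltW d0)//.
    rewrite !powRN lef_pV2 ?posrE ?powR_gt0//.
    by apply: ger_powR; [rewrite d0 d1|exact: al1].
  have Yle : Y <= C2 * d `^ (- (alpha + 2)).
    move: YQ; rewrite r12 mulrA ler_pdivrMr// -ler_pdivlMr// => /le_trans; apply.
    rewrite d2 le_eqVlt; apply/orP; left; apply/eqP; rewrite /C2; field.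
    by rewrite gt_eqF.
  have pi1 : 1 <= 2 * pi :> R by have := pi_ge2 R; lra.
  have n0 := nc_ge0 (k z).
  have step : nc (k z) <= 2 * pi * nc (k z) by rewrite ler_peMl.
  apply: (le_trans step).
  have -> : 2 * pi * nc (k z) = Y + C1 * d^-1.
    by rewrite /Y /C1; field; rewrite gt_eqF.
  rewrite -/d; have D0 : 0 < d `^ (- (alpha + 2)) by exact: powR_gt0.
  have := ler_wpM2l C10 dd; move: Yle; move: (d `^ (- (alpha + 2))) D0 => D D0; move: (d^-1) => e.
  by move=> h1 h2; rewrite !mulrDl mul1r; lra.
pose C3 := C1 + C2 + 1; have C30 : 0 < C3 by rewrite ltr_wpDl// addr_ge0.
pose b := (alpha + 2) / p; have b0 : 0 < b by rewrite divr_gt0.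
exists ((C3 / c) `^ p^-1 + a); first by rewrite ltr_wpDr// powR_gt0// divr_gt0.
move=> z z1 z2; have z0 : 0 < nc z by apply: lt_le_trans z1; rewrite invr_gt0.
have d0 : 0 < 1 - nc z by rewrite subr_gt0.
rewrite -/b mulrDl.
have fa : nc (f z) <= nc (f z - f 0) + a.
  by rewrite -[in X in X <= _](subrK (f 0) (f z)); exact: ncD.
apply: (le_trans fa); apply: lerD; last first.
  rewrite ler_peMr// powRN invf_ge1 ?powR_gt0//.
  rewrite -[X in _ <= X](powRr0 (1 - nc z)).
  by apply: ger_powR; [rewrite d0 gerBl ltW|exact: ltW].
have := kb z z1 z2; rewrite kE// -?nc_gt0// mulrC -ler_pdivlMr// => H.
have := @powR_le _ _ _ p^-1 _ (powR_ge0 _ _) H; rewrite invr_ge0 => /(_ (ltW p0)).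
rewrite -powRrM mulfV ?gt_eqF// powRr1 ?divr_ge0 ?nc_ge0// mulrAC -/C3.
have -> : (C3 / c * (1 - nc z) `^ (- (alpha + 2))) `^ p^-1 = (C3 / c) `^ p^-1 * (1 - nc z) `^ (- b).
  rewrite powRM ?powR_ge0//; last by rewrite divr_ge0// ltW.
  by rewrite -powRrM mulNr.
move=> /(le_trans _); apply.
by rewrite ler_pdivlMr// ler_piMr ?nc_ge0// ltW.
Qed.

End growth.

End bergman_growth.

(** * From Hardy to Bergman spaces *)

Section parseval.
Context {R : realType}.
Local Open Scope complex_scope.
Implicit Types (z w h a c : R[i]) (f G F : R[i] -> R[i]) (r t : R) (b : nat -> R[i]).
Local Notation mu := (@lebesgue_measure R).

Let tpi0 : 0 <= 2 * pi :> R. Proof. by rewrite mulr_ge0// pi_ge0. Qed.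

Definition ptrunc b N z : R[i] := \sum_(0 <= k < N) b k * z ^+ k.

Lemma ptruncS b N z : ptrunc b N.+1 z = ptrunc b N z + b N * z ^+ N.
Proof. by rewrite /ptrunc big_nat_recr. Qed.

Lemma ptrunc_cdiff b N z : cdiff (ptrunc b N.+1) z (ptrunc (dcoef b) N z).
Proof.
elim: N => [|N IH].
  have -> : ptrunc b 1 = fun=> b 0%N.
    by apply/funext => x; rewrite /ptrunc big_nat1 expr0 mulr1.
  rewrite {1}/ptrunc big_geq//; exact: cdiff_cst.
have -> : ptrunc b N.+2 = fun x => ptrunc b N.+1 x + b N.+1 * x ^+ N.+1.
  by apply/funext => x; exact: ptruncS.
rewrite (ptruncS (dcoef b)); apply: cdiffD => //.
have := cdiffZ (b N.+1) (cdiff_exprn z N.+1).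
by rewrite /dcoef mulrA (mulrC (b _)).
Qed.

Lemma ptrunc_holo b N : holoD (ptrunc b N).
Proof.
move=> z _; case: N => [|N]; last by eexists; exact: ptrunc_cdiff.
exists 0; have -> : ptrunc b 0 = fun=> 0 by apply/funext => x; rewrite /ptrunc big_geq.
exact: cdiff_cst.
Qed.

Lemma ptrunc_ccont b N z : ccont (ptrunc b N) z.
Proof.
apply: cholo_ccont; case: N => [|N]; last by eexists; exact: ptrunc_cdiff.
exists 0; have -> : ptrunc b 0 = fun=> 0 by apply/funext => x; rewrite /ptrunc big_geq.
exact: cdiff_cst.
Qed.

Lemma nc_sqrD z w : nc (z + w) ^+ 2 = nc z ^+ 2 + nc w ^+ 2 + 2 * complex.Re (z * conj w).
Proof. by rewrite !nc_sqr cReM /conj !raddfD /=; ring. Qed.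

Lemma conjD z w : conj (z + w) = conj z + conj w.
Proof. by apply: complex_eq; rewrite /conj /= !raddfD /= ?opprD. Qed.

Lemma conj_mul z : conj z * z = (nc z ^+ 2)%:C.
Proof.
apply: complex_eq; rewrite ?cReM ?cImM /conj /=; last by ring.
by rewrite nc_sqr; ring.
Qed.

Lemma conjX z n : conj (z ^+ n) = conj z ^+ n.
Proof. by elim: n => [|n IH]; rewrite ?expr0 ?conj1// !exprS conjM IH. Qed.

Lemma conj_monomial r t k : r != 0 -> conj ((r%:C * unit_pt t) ^+ k) =
  ((r ^+ 2) ^+ k)%:C * (r%:C * unit_pt t) ^- k.
Proof.
move=> r0; set w := r%:C * unit_pt t.
have w0 : w != 0 by rewrite mulf_neq0 ?unit_pt_neq0// -nc_gt0 nc_real normr_gt0.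
have nw : nc w ^+ 2 = r ^+ 2 by rewrite Normc.normcM nc_unit_pt mulr1 nc_real real_normK ?num_real.
have cw : conj w = (r ^+ 2)%:C / w by rewrite -nw -conj_mul mulfK.
by rewrite conjX cw expr_div_n (rmorphXn (real_complex R) k (r ^+ 2)).
Qed.

Lemma Rint_Re_circ F r : \int[mu]_(t in `[0, 2 * pi]) complex.Re (F (r%:C * unit_pt t)) =
  complex.Re (circ F r).
Proof. by []. Qed.

Lemma Re_conj z : complex.Re (conj z) = complex.Re z. Proof. by []. Qed.

Let pP b N r t : pcont (fun s => ptrunc b N (r%:C * unit_pt s)) t.
Proof. by apply: pcont_circ; exact: ptrunc_ccont. Qed.

(** On the circle [conj z^k = r^(2k) z^(-k)], so the conjugate of the product is a polynomial with
    no constant term, whose mean is its value [0] at the origin. *)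
Lemma monomial_orthogonal b c N r : 0 < r < 1 ->
  \int[mu]_(t in `[0, 2 * pi]) complex.Re (ptrunc b N (r%:C * unit_pt t) *
    conj (c * (r%:C * unit_pt t) ^+ N)) = 0.
Proof.
move=> /[dup] r01 /andP[r0 r1].
(* The coefficients of [c z^N conj (ptrunc b N z)] on the circle: degree [k] comes from the index
   [N - k], and only [1 <= k <= N] occur. *)
pose b' k := if k is k'.+1 then
  if (k' < N)%N then c * conj (b (N - k)%N) * ((r ^+ 2) ^+ (N - k)%N)%:C else 0 else 0.
rewrite (@eq_Rintegral _ _ _ mu _ (fun t => complex.Re (ptrunc b' N.+1 (r%:C * unit_pt t)))); last first.
  move=> t _; rewrite -[LHS]Re_conj conjM conjK; congr complex.Re.
  set w := r%:C * unit_pt t.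
  have w0 : w != 0 by rewrite mulf_neq0 ?unit_pt_neq0// -nc_gt0 nc_real normr_gt0 gt_eqF.
  have -> : conj (ptrunc b N w) = \sum_(0 <= k < N) conj (b k) * conj (w ^+ k).
    rewrite /ptrunc; elim: (N) => [|n IH]; last by rewrite !big_nat_recr//= -IH -conjM conjD.
    by rewrite !big_geq//; apply: complex_eq; rewrite /conj //= oppr0.
  rewrite /ptrunc big_nat_recl// mul0r add0r mulr_suml (big_nat_rev) /=.
  apply: eq_big_nat => k /andP[_ kN]; rewrite kN add0n.
  rewrite conj_monomial ?gt_eqF// -/w.
  have E : w ^+ N = w ^+ (N - k.+1) * w ^+ k.+1 by rewrite -exprD subnK.
  rewrite E; set u := w ^+ (N - k.+1); have u0 : u != 0 by rewrite expf_neq0.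
  move: (conj _) (_%:C) (w ^+ k.+1) => x y v; field.
  by [].
rewrite (Rint_Re_circ (ptrunc b' N.+1)) circ_mean//; last exact: ptrunc_holo.
suff -> : ptrunc b' N.+1 0 = 0 by rewrite mulr0.
rewrite /ptrunc big_nat_recl// mul0r add0r big1// => k _.
by rewrite exprS mul0r mulr0.
Qed.

Let iP b N r : mu.-integrable `[0, 2 * pi] (EFin \o (fun t => nc (ptrunc b N (r%:C * unit_pt t)) ^+ 2)).
Proof.
apply: cont_integrable => t _; apply: cvgM; apply: pcont_nc; exact: pP.
Qed.

Let cRe F G r t : pcont (fun s => F (r%:C * unit_pt s)) t -> pcont (fun s => G (r%:C * unit_pt s)) t ->
  {for t, continuous (fun s => complex.Re (F (r%:C * unit_pt s) * conj (G (r%:C * unit_pt s))))}.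
Proof.
move=> cF cG.
have -> : (fun s => complex.Re (F (r%:C * unit_pt s) * conj (G (r%:C * unit_pt s)))) =
  fun s => complex.Re (F (r%:C * unit_pt s)) * complex.Re (G (r%:C * unit_pt s)) +
           complex.Im (F (r%:C * unit_pt s)) * complex.Im (G (r%:C * unit_pt s)).
  by apply/funext => s; rewrite cReM /conj /= mulrN opprK.
by apply: cvgD; apply: cvgM; [exact: pcont_Re|exact: pcont_Re|exact: pcont_Im|exact: pcont_Im].
Qed.

(** Each new monomial is orthogonal to the preceding ones. The radius [0] is treated apart since the
    reflection formula divides by [z]. *)
Lemma parseval b N r : 0 <= r < 1 ->
  \int[mu]_(t in `[0, 2 * pi]) nc (ptrunc b N (r%:C * unit_pt t)) ^+ 2 =
  2 * pi * \sum_(0 <= k < N) nc (b k) ^+ 2 * (r ^+ 2) ^+ k.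
Proof.
move=> /andP[r0 r1]; move: r0; rewrite le_eqVlt => /predU1P[<-|r0].
  rewrite (@eq_Rintegral _ _ _ mu _ (fun=> \sum_(0 <= k < N) nc (b k) ^+ 2 * ((0 : R) ^+ 2) ^+ k)) ?Rint_cst//.
  move=> t _; rewrite mul0r expr0n /=; case: N => [|N].
    by rewrite /ptrunc !big_geq// Normc.normc0 expr0n.
  rewrite /ptrunc !big_nat_recl// !expr0 !mulr1.
  by rewrite !big1 ?addr0// => k _; rewrite expr0n mulr0.
have r01 : 0 < r < 1 by rewrite r0.
elim: N => [|N IH].
  rewrite big_geq// mulr0 (@eq_Rintegral _ _ _ mu _ (fun=> 0)) ?Rint_cst ?mulr0//.
  by move=> t _; rewrite /ptrunc big_geq// Normc.normc0 expr0n.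
have nN t : nc (b N * (r%:C * unit_pt t) ^+ N) ^+ 2 = nc (b N) ^+ 2 * (r ^+ 2) ^+ N.
  by rewrite Normc.normcM ncX nc_circ ?(ltW r0)// exprMn exprAC.
have pm t : pcont (fun s => b N * (r%:C * unit_pt s) ^+ N) t.
  apply: (@pcont_circ _ (fun z => b N * z ^+ N)); apply: cholo_ccont.
  by eexists; apply: cdiffZ; exact: cdiff_exprn.
rewrite (@eq_Rintegral _ _ _ mu _ (fun t => nc (ptrunc b N (r%:C * unit_pt t)) ^+ 2 +
    nc (b N) ^+ 2 * (r ^+ 2) ^+ N +
    2 * complex.Re (ptrunc b N (r%:C * unit_pt t) * conj (b N * (r%:C * unit_pt t) ^+ N)))); last first.
  by move=> t _; rewrite ptruncS nc_sqrD nN.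
have ic : mu.-integrable `[0, 2 * pi] (EFin \o (fun t : R => nc (b N) ^+ 2 * (r ^+ 2) ^+ N)).
  by apply: cont_integrable => t _; exact: cvg_cst.
have cRe' t := @cRe (ptrunc b N) (fun z => b N * z ^+ N) r t (pP _ _ _ _) (pm t).
have iR : mu.-integrable `[0, 2 * pi] (EFin \o (fun t : R => complex.Re (ptrunc b N (r%:C * unit_pt t) *
    conj (b N * (r%:C * unit_pt t) ^+ N)))).
  by apply: cont_integrable => t _; exact: cRe'.
rewrite RintegralD//; last 2 first.
- apply: cont_integrable => t _; apply: cvgD; last exact: cvg_cst.
  by apply: cvgM; apply: pcont_nc; exact: pP.
- by apply: cont_integrable => t _; apply: cvgM; [exact: cvg_cst|exact: cRe'].
rewrite RintegralZl// monomial_orthogonal// mulr0 addr0 RintegralD// Rint_cst IH.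
rewrite -mulrDr; congr (_ * _); symmetry; exact: big_nat_recr.
Qed.

Lemma nc_sqrB z w : nc (z - w) ^+ 2 = nc z ^+ 2 + nc w ^+ 2 - 2 * complex.Re (z * conj w).
Proof. by rewrite !nc_sqr cReM /conj !raddfB /=; ring. Qed.

(** After reflecting [conj z^N] on the circle, each term is the Cauchy integral that defines
    [tcoef h N]. *)
Lemma taylor_cross (h : R[i] -> R[i]) N r : holoD h -> 0 < r < 1 ->
  \int[mu]_(t in `[0, 2 * pi]) complex.Re (h (r%:C * unit_pt t) * conj (ptrunc (tcoef h) N (r%:C * unit_pt t))) =
  2 * pi * \sum_(0 <= k < N) nc (tcoef h k) ^+ 2 * (r ^+ 2) ^+ k.
Proof.
move=> hh /[dup] r01 /andP[r0 r1]; have [dh ch] := holoD_punct hh.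
have ph t : pcont (fun s => h (r%:C * unit_pt s)) t.
  by apply: pcont_circ; apply: cholo_ccont; apply: hh; rewrite nc_circ// ltW.
elim: N => [|N IH].
  rewrite big_geq// mulr0 (@eq_Rintegral _ _ _ mu _ (fun=> 0)) ?Rint_cst ?mulr0//.
  by move=> t _; rewrite /ptrunc big_geq// cReM /conj /= oppr0 !mulr0 subr0.
set b := tcoef h in IH *.
have pm t : pcont (fun s => b N * (r%:C * unit_pt s) ^+ N) t.
  apply: (@pcont_circ _ (fun z => b N * z ^+ N)); apply: cholo_ccont.
  by eexists; apply: cdiffZ; exact: cdiff_exprn.
have cR1 t := @cRe h (ptrunc b N) r t (ph t) (pP _ _ _ _).
have cR2 t := @cRe h (fun z => b N * z ^+ N) r t (ph t) (pm t).
rewrite (@eq_Rintegral _ _ _ mu _ (fun t => complex.Re (h (r%:C * unit_pt t) * conj (ptrunc b N (r%:C * unit_pt t))) +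
    complex.Re (h (r%:C * unit_pt t) * conj (b N * (r%:C * unit_pt t) ^+ N)))); last first.
  by move=> t _; rewrite ptruncS conjD mulrDr raddfD.
rewrite RintegralD//; [|by apply: cont_integrable|by apply: cont_integrable].
rewrite IH.
have -> : \sum_(0 <= k < N.+1) nc (b k) ^+ 2 * (r ^+ 2) ^+ k =
    \sum_(0 <= k < N) nc (b k) ^+ 2 * (r ^+ 2) ^+ k + nc (b N) ^+ 2 * (r ^+ 2) ^+ N by exact: big_nat_recr.
rewrite [RHS]mulrDr; congr (_ + _).
rewrite (@eq_Rintegral _ _ _ mu _ (fun t => complex.Re (conj (b N) * ((r ^+ 2) ^+ N)%:C *
    (h (r%:C * unit_pt t) * (r%:C * unit_pt t) ^- N)))); last first.
  move=> t _; rewrite conjM conj_monomial ?gt_eqF//; congr complex.Re.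
  by move: (conj _) (_%:C) (h _) (_ ^- N) => x y u v; ring.
rewrite (Rint_Re_circ (fun z => conj (b N) * ((r ^+ 2) ^+ N)%:C * (h z * z ^- N))).
rewrite circZ; last first.
  - move=> z zr; have z0 : z != 0 by rewrite -nc_gt0 zr.
    apply: cholo_ccont; apply: cholo_M; first by apply: hh; rewrite zr.
    eexists; apply: cdiffV; last exact: cdiff_exprn.
    by rewrite expf_neq0.
  - exact: ltW.
have tE : circ (fun z => h z * z ^- N) r = (2 * pi)%:C * b N.
  rewrite /b (tcoefE dh _ r01) mulVKf// -nc_gt0 nc_real normr_gt0 gt_eqF//.
  by rewrite mulr_gt0// pi_gt0.
rewrite tE; have -> : conj (b N) * ((r ^+ 2) ^+ N)%:C * ((2 * pi)%:C * b N) =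
  ((nc (b N) ^+ 2) * ((r ^+ 2) ^+ N * (2 * pi)))%:C.
  have rM (x y : R) : (x * y)%:C = x%:C * y%:C :> R[i] by exact: (rmorphM (real_complex R)).
  rewrite (rM (nc (b N) ^+ 2)) (rM ((r ^+ 2) ^+ N)) -conj_mul.
  by rewrite [(2 * pi)%:C * b N]mulrC mulrACA.
move: (nc (b N) ^+ 2) ((r ^+ 2) ^+ N) (2 * pi) => x y u.
by rewrite -[LHS]/(x * (y * u)); ring.
Qed.

(** The square mean of [h] minus its Taylor polynomial is nonnegative; expanding it uses
    [taylor_cross] and [parseval]. *)
Lemma bessel (h : R[i] -> R[i]) N r (M : R) : holoD h -> 0 < r < 1 ->
  \int[mu]_(t in `[0, 2 * pi]) nc (h (r%:C * unit_pt t)) ^+ 2 <= M ->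
  2 * pi * \sum_(0 <= k < N) nc (tcoef h k) ^+ 2 * (r ^+ 2) ^+ k <= M.
Proof.
move=> hh /[dup] r01 /andP[r0 r1]; apply: le_trans.
have r01' : 0 <= r < 1 by rewrite ltW.
have ph t : pcont (fun s => h (r%:C * unit_pt s)) t.
  by apply: pcont_circ; apply: cholo_ccont; apply: hh; rewrite nc_circ// ltW.
have cR1 t := @cRe h (ptrunc (tcoef h) N) r t (ph t) (pP _ _ _ _).
have ih : mu.-integrable `[0, 2 * pi] (EFin \o (fun t => nc (h (r%:C * unit_pt t)) ^+ 2)).
  by apply: cont_integrable => t _; apply: cvgM; exact: pcont_nc.
have iR : mu.-integrable `[0, 2 * pi] (EFin \o (fun t => 2 * complex.Re (h (r%:C * unit_pt t) *
    conj (ptrunc (tcoef h) N (r%:C * unit_pt t))))).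
  by apply: cont_integrable => t _; apply: cvgM; [exact: cvg_cst|exact: cR1].
have : 0 <= \int[mu]_(t in `[0, 2 * pi]) nc (h (r%:C * unit_pt t) - ptrunc (tcoef h) N (r%:C * unit_pt t)) ^+ 2.
  by apply: Rintegral_ge0 => t _; exact: sqr_ge0.
rewrite (@eq_Rintegral _ _ _ mu _ (fun t => nc (h (r%:C * unit_pt t)) ^+ 2 +
   nc (ptrunc (tcoef h) N (r%:C * unit_pt t)) ^+ 2 -
   2 * complex.Re (h (r%:C * unit_pt t) * conj (ptrunc (tcoef h) N (r%:C * unit_pt t))))); last first.
  by move=> t _; rewrite nc_sqrB.
rewrite RintegralB//; last first.
  apply: cont_integrable => t _; apply: cvgD; first by apply: cvgM; exact: pcont_nc.
  by apply: cvgM; apply: pcont_nc; exact: pP.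
rewrite RintegralD// RintegralZl//; last by apply: cont_integrable.
rewrite taylor_cross// parseval//; set X := 2 * pi * _; set Y := \int[mu]_(t in _) _.
clearbody X Y; lra.
Qed.

(** All weights [r^(2k)] with [k < N] are at least [r^(2N)], so letting [r] tend to [1] needs the
    continuity of a single function. *)
Lemma bessel_limit (h : R[i] -> R[i]) N (M : R) : holoD h ->
  (forall r, 2^-1 <= r -> r < 1 -> \int[mu]_(t in `[0, 2 * pi]) nc (h (r%:C * unit_pt t)) ^+ 2 <= M) ->
  2 * pi * \sum_(0 <= k < N) nc (tcoef h k) ^+ 2 <= M.
Proof.
move=> hh H; apply/ler_addgt0Pl => e e0.
set S := \sum_(0 <= k < N) _.
have S0 : 0 <= S by apply: sumr_ge0 => k _; exact: sqr_ge0.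
have cS : {for 1, continuous (fun r : R => 2 * pi * S * (r ^+ 2) ^+ N)}.
  apply: cvgM; first exact: cvg_cst.
  apply: (@continuous_comp _ _ _ (fun r => r ^+ 2) (fun x => x ^+ N)); exact: exprn_continuous.
move/cvg_eps : cS => /(_ _ e0)[d d0 Hd].
pose x := Num.min (d / 2) 2^-1.
have x0 : 0 < x by rewrite lt_min divr_gt0//= invr_gt0 ltr0n.
have xd : x < d by rewrite (@le_lt_trans _ _ (d / 2)) ?ge_min ?lexx//; lra.
have x2 : x <= 2^-1 by rewrite ge_min lexx orbT.
clearbody x; have := Hd (- x); rewrite normrN gtr0_norm// => /(_ xd).
rewrite !expr1n mulr1 ler_distl => /andP[h1 _].
have r1 : 2^-1 <= 1 - x by lra.
have r2 : 1 - x < 1 by lra.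
have r01 : 0 < 1 - x < 1 by rewrite r2 andbT; lra.
have := bessel N hh r01 (H _ r1 r2).
have : S * ((1 - x) ^+ 2) ^+ N <= \sum_(0 <= k < N) nc (tcoef h k) ^+ 2 * ((1 - x) ^+ 2) ^+ k.
  rewrite /S mulr_suml; apply: ler_sum_nat => k /andP[_ kN].
  rewrite ler_wpM2l ?sqr_ge0//; apply: ler_wiXn2l; [exact: sqr_ge0| |exact: ltnW].
  by rewrite expr_le1//; lra.
move=> /(ler_wpM2l tpi0) h2 h3; have := le_trans h2 h3; rewrite mulrA => h4.
move: h1 h4; rewrite -lerBlDr => h1 h4; have := le_trans h1 h4; lra.
Qed.

Lemma sum_sqr_geo_le (x : R) N : 0 <= x -> x < 1 ->
  \sum_(0 <= k < N) (k.+1%:R) ^+ 2 * x ^+ k <= 2 / (1 - x) ^+ 3.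
Proof.
move=> x0 x1; have y0 : 0 < 1 - x by rewrite subr_gt0.
(* [x ^+ n * E n] is the tail of the series from index [n] on. *)
pose E n : R := n.+1%:R ^+ 2 / (1 - x) + (2 * n.+1%:R + 1) * x / (1 - x) ^+ 2 + 2 * x ^+ 2 / (1 - x) ^+ 3.
have E0 n : 0 <= E n.
  by rewrite /E !addr_ge0// divr_ge0 ?exprn_ge0 ?(ltW y0)// mulr_ge0// ?addr_ge0 ?exprn_ge0.
suff H : \sum_(0 <= k < N) (k.+1%:R) ^+ 2 * x ^+ k <= 2 / (1 - x) ^+ 3 - x ^+ N * E N.
  by apply: (le_trans H); rewrite gerBl mulr_ge0// exprn_ge0.
elim: N => [|N IH].
  rewrite big_geq// expr0 mul1r /E.
  have -> : 2 / (1 - x) ^+ 3 - (1 ^+ 2 / (1 - x) + (2 * 1 + 1) * x / (1 - x) ^+ 2 + 2 * x ^+ 2 / (1 - x) ^+ 3) =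
     (1 - x) / (1 - x) ^+ 3 by field; rewrite gt_eqF.
  by rewrite divr_ge0 ?exprn_ge0 ?(ltW y0).
rewrite big_nat_recr//=; apply: (@le_trans _ _ (2 / (1 - x) ^+ 3 - x ^+ N * E N + N.+1%:R ^+ 2 * x ^+ N)).
  by rewrite lerD2r.
rewrite le_eqVlt; apply/orP; left; apply/eqP; rewrite (exprS x N) /E -(natr1 N.+1).
by move: (N.+1%:R) (x ^+ N) => n u; field; rewrite gt_eqF.
Qed.

(** Termwise [2 x y <= x^2 / D + y^2 D] with [D = (1 - |z|)^(3/2)], written [d ^+ 3] for
    [d = sqrt (1 - |z|)]. This choice balances [A / D] against [sum_sqr_geo_le], which contributes
    [2 D / d^6]. *)
Lemma ptrunc_deriv_growth b N (A : R) z : (forall n, \sum_(0 <= k < n) nc (b k) ^+ 2 <= A) ->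
  nc z < 1 -> nc (ptrunc (dcoef b) N z) ^+ 2 * (1 - nc z) ^+ 3 <= ((A + 2) / 2) ^+ 2.
Proof.
move=> HA z1; have y0 : 0 < 1 - nc z by rewrite subr_gt0.
have A0 : 0 <= A by have := HA 0%N; rewrite big_geq.
pose d := Num.sqrt (1 - nc z); have d0 : 0 < d by rewrite sqrtr_gt0.
have dd : d ^+ 2 = 1 - nc z by rewrite sqr_sqrtr// ltW.
rewrite -dd -exprM mulnC exprM -exprMn.
rewrite ler_pXn2r ?nnegrE//; last 2 first.
- by rewrite mulr_ge0 ?nc_ge0// exprn_ge0// ltW.
- by rewrite divr_ge0// addr_ge0.
have D0 : 0 < d ^+ 3 by exact: exprn_gt0.
rewrite -ler_pdivlMr//; apply: (le_trans (nc_sum _ _)).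
apply: (@le_trans _ _ (\sum_(0 <= k < N)
   (nc (b k.+1) ^+ 2 / d ^+ 3 + (k.+1%:R ^+ 2 * (nc z ^+ 2) ^+ k) * d ^+ 3) / 2)).
  apply: ler_sum_nat => k _; rewrite /dcoef Normc.normcM Normc.normcM nc_nat ncX.
  have -> : (nc z ^+ 2) ^+ k = (nc z ^+ k) ^+ 2 by rewrite -!exprM mulnC.
  move: (nc (b _)) (k.+1%:R) (nc z ^+ k) (d ^+ 3) D0 => u n v D D0.
  rewrite ler_pdivlMr// -subr_ge0.
  have -> : u ^+ 2 / D + n ^+ 2 * v ^+ 2 * D - n * u * v * 2 = (u - n * v * D) ^+ 2 / D.
    by field; rewrite gt_eqF.
  by rewrite divr_ge0 ?sqr_ge0// ltW.
rewrite -mulr_suml big_split/= -!mulr_suml.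
have s1 : \sum_(0 <= k < N) nc (b k.+1) ^+ 2 <= A.
  by apply: le_trans (HA N.+1); rewrite [leRHS]big_nat_recl// lerDr sqr_ge0.
have s2 : \sum_(0 <= k < N) k.+1%:R ^+ 2 * (nc z ^+ 2) ^+ k <= 2 / d ^+ 6.
  apply: (le_trans (sum_sqr_geo_le _ _ _)); rewrite ?sqr_ge0//.
    by rewrite expr_lt1 ?nc_ge0.
  have -> : d ^+ 6 = (1 - nc z) ^+ 3 by rewrite -dd -exprM.
  rewrite ler_wpM2l// lef_pV2 ?posrE ?exprn_gt0//; last by rewrite subr_gt0 expr_lt1 ?nc_ge0.
  rewrite lerXn2r ?nnegrE ?(ltW y0)//; last by rewrite lerD2l lerN2 expr2 ler_piMl ?nc_ge0// ltW.
  by rewrite subr_ge0 ltW// expr_lt1 ?nc_ge0.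
have -> : (A + 2) / 2 / d ^+ 3 = (A / d ^+ 3 + 2 / d ^+ 6 * d ^+ 3) / 2 by field; rewrite gt_eqF.
rewrite ler_wpM2r//; apply: lerD; first by rewrite ler_wpM2r// invr_ge0 ltW.
by rewrite ler_wpM2r// ltW.
Qed.

End parseval.

(** [kappa] is the threshold of the case distinction in the pointwise estimate along a ray, and
    [kappa ^+ 2 * K] the resulting bound on [phi x * (1 - x)]. *)
Definition hardy_cst {R : realType} (s K : R) : R :=
  let kappa := 4 * s / (s - 1) in 2 * s * kappa * (kappa ^+ 2 * K) `^ (s - 1).

Lemma radial_weight_continuous {R : realType} (phi : R -> R) (s x : R) : 0 < phi x ->
  {for x, continuous phi} -> x < 1 -> {for x, continuous (fun x => phi x `^ s * (1 - x) `^ (s - 2))}.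
Proof.
move=> p0 cphi x1; have y0 : 0 < 1 - x by rewrite subr_gt0.
have cp (g : R -> R) p : 0 < g x -> {for x, continuous g} -> {for x, continuous (fun x => g x `^ p)}.
  move=> g0 cg; apply: (@continuous_comp _ _ _ g (fun x => x `^ p)) => //.
  apply: differentiable_continuous; apply/derivable1_diffP.
  by apply: derivable_powR; rewrite in_itv /= g0.
apply: cvgM; first exact: cp.
by apply: (cp (fun x => 1 - x)) => //; apply: cvgB; [exact: cvg_cst|exact: cvg_id].
Qed.

(** * A Hardy-type inequality along a ray *)

Section radial_hardy.
Context {R : realType}.
Local Notation mu := (@lebesgue_measure R).
Variables (phi dphi D : R -> R) (s K rho : R).
Hypotheses (s1 : 1 < s) (rho0 : 0 < rho) (rho1 : rho < 1).
Hypotheses (phi1 : forall x, 1 <= phi x) (D0 : forall x, 0 <= D x).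
Hypotheses (dphiP : forall x : R, is_derive x 1 phi (dphi x)).
Hypotheses (cdphi : forall x, {for x, continuous dphi}) (cD : forall x, {for x, continuous D}).
Hypotheses (dphiD : forall x, dphi x <= 2 * Num.sqrt (phi x) * D x).
Hypotheses (DK : forall x, 0 <= x < 1 -> D x ^+ 2 * (1 - x) ^+ 3 <= K).

(** The logarithm of [phi^s (1 - x)^(s - 1)]. In the application [phi = 1 + |h|^2] and [D = |h'|]
    along a radius. *)
Let E x := s * ln (phi x) + (s - 1) * ln (1 - x).
Let dE x := s * (dphi x / phi x) - (s - 1) / (1 - x).
Let kappa := 4 * s / (s - 1).
Let C := 2 * s * kappa * (kappa ^+ 2 * K) `^ (s - 1).

Let phi0 x : 0 < phi x. Proof. exact: lt_le_trans (phi1 x). Qed.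
Let s0 : 0 < s. Proof. by apply: lt_trans s1. Qed.
Let sm : 0 < s - 1. Proof. by rewrite subr_gt0. Qed.
Let kappa0 : 0 < kappa. Proof. by rewrite divr_gt0// mulr_gt0. Qed.

Let cphi x : {for x, continuous phi}.
Proof. by apply: differentiable_continuous; apply/derivable1_diffP; have [] := dphiP x. Qed.

Let dE_E (x : R) : x < 1 -> is_derive x 1 E (dE x).
Proof.
move=> x1; have y0 : 0 < 1 - x by rewrite subr_gt0.
have d1 : is_derive x 1 (@ln R \o phi) ((phi x)^-1 * dphi x).
  by apply: is_derive1_comp; exact: is_derive1_ln.
have d2 : is_derive x 1 (@ln R \o (fun x : R => 1 - x)) ((1 - x)^-1 * (0 - 1)).
  by apply: is_derive1_comp; exact: is_derive1_ln.
apply: is_derive_eq (is_deriveD (is_deriveZ s d1) (is_deriveZ (s - 1) d2)) _.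
rewrite /dE /GRing.scale /=.
by field; rewrite !gt_eqF.
Qed.

Let Ppow x : x < 1 -> expR (E x) = phi x `^ s * (1 - x) `^ (s - 1).
Proof.
move=> x1; have y0 : 0 < 1 - x by rewrite subr_gt0.
by rewrite /E expRD /powR !gt_eqF.
Qed.

Let Wpow x : x < 1 -> phi x `^ s * (1 - x) `^ (s - 2) = expR (E x) / (1 - x).
Proof.
move=> x1; have y0 : 0 < 1 - x by rewrite subr_gt0.
rewrite Ppow// -mulrA; congr (_ * _).
have -> : s - 2 = s - 1 + - 1 by ring.
by rewrite powRD ?powR_inv1 ?(ltW y0)//; apply/implyP => _; rewrite gt_eqF.
Qed.

Lemma hardy_cst_ge0 : 0 <= hardy_cst s K.
Proof. by apply: mulr_ge0; [apply: mulr_ge0; [exact: mulr_ge0 (ltW s0)|exact: ltW]|exact: powR_ge0]. Qed.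

Let C0 : 0 <= C. Proof. exact: hardy_cst_ge0. Qed.

(* If [4 s D (1 - x) <= (s - 1) sqrt phi], the first term of [dE] is at most half
   of the second; otherwise [sqrt phi <= kappa D (1 - x)] and [DK] bounds
   [phi (1 - x)]. *)
Let pointwise x : 0 <= x < 1 ->
  expR (E x) * dE x <= - ((s - 1) / 2) * (phi x `^ s * (1 - x) `^ (s - 2)) + C * (D x ^+ 2 * (1 - x)).
Proof.
move=> /[dup] x01 /andP[x0 x1]; rewrite Wpow//; have y0 : 0 < 1 - x by rewrite subr_gt0.
have P0 : 0 < expR (E x) by exact: expR_gt0.
pose a := Num.sqrt (phi x); have a0 : 0 < a by rewrite sqrtr_gt0.
have aE : a ^+ 2 = phi x by rewrite sqr_sqrtr// ltW.
have h1 : expR (E x) * (s * (dphi x / phi x)) <= 2 * s * D x * expR (E x) / a.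
  rewrite -aE; have := dphiD x; rewrite -/a; move: (dphi x) (D x) (expR (E x)) P0 => u v P P0 uv.
  rewrite ler_pdivlMr//.
  have -> : P * (s * (u / a ^+ 2)) * a = P * s / a * u by field; rewrite gt_eqF.
  have -> : 2 * s * v * P = P * s / a * (2 * a * v) by field; rewrite gt_eqF.
  by rewrite ler_wpM2l// divr_ge0 ?(ltW a0)// mulr_ge0// ltW.
have h2 : 2 * s * D x * expR (E x) / a <= (s - 1) / 2 * (expR (E x) / (1 - x)) + C * (D x ^+ 2 * (1 - x)).
  have [c1|c2] := leP (4 * s * (D x * (1 - x))) ((s - 1) * a).
    rewrite -[X in X <= _]addr0 lerD//; last by rewrite mulr_ge0// mulr_ge0 ?sqr_ge0// ltW.
    rewrite ler_pdivrMr//.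
    have -> : (s - 1) / 2 * (expR (E x) / (1 - x)) * a = expR (E x) / (2 * (1 - x)) * ((s - 1) * a).
      by move: (expR _) => P; field; rewrite gt_eqF.
    have -> : 2 * s * D x * expR (E x) = expR (E x) / (2 * (1 - x)) * (4 * s * (D x * (1 - x))).
      by move: (expR _) => P; field; rewrite gt_eqF.
    by rewrite ler_wpM2l// divr_ge0 ?(ltW P0)// mulr_ge0// ltW.
  have ak : a <= kappa * (D x * (1 - x)).
    rewrite /kappa mulrAC ler_pdivlMr// mulrC; exact: ltW.
  have pk : phi x * (1 - x) <= kappa ^+ 2 * K.
    apply: (@le_trans _ _ (kappa ^+ 2 * (D x ^+ 2 * (1 - x) ^+ 3))); last first.
      by rewrite ler_wpM2l ?sqr_ge0// DK.
    have -> : kappa ^+ 2 * (D x ^+ 2 * (1 - x) ^+ 3) = (kappa * (D x * (1 - x))) ^+ 2 * (1 - x) by ring.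
    rewrite ler_wpM2r ?(ltW y0)// -aE ler_pXn2r ?nnegrE ?(ltW a0)//.
    by rewrite mulr_ge0 ?(ltW kappa0)// mulr_ge0// ltW.
  have PE : expR (E x) <= a ^+ 2 * (kappa ^+ 2 * K) `^ (s - 1).
    rewrite Ppow// aE.
    have -> : phi x `^ s = phi x * phi x `^ (s - 1).
      rewrite -[X in X * _]powRr1 ?(ltW (phi0 x))// -powRD; last by apply/implyP => _; rewrite gt_eqF.
      by congr (_ `^ _); ring.
    rewrite -mulrA ler_wpM2l ?(ltW (phi0 x))// -powRM ?(ltW y0) ?(ltW (phi0 x))//.
    by apply: powR_le => //; [exact: ltW|rewrite mulr_ge0// ltW].
  rewrite ler_wpDl//; first by rewrite mulr_ge0 ?divr_ge0 ?(ltW sm) ?(ltW P0) ?(ltW y0).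
  have sD : 0 <= 2 * s * D x by rewrite mulr_ge0// mulr_ge0// ltW.
  apply: (@le_trans _ _ (2 * s * D x * (a * (kappa ^+ 2 * K) `^ (s - 1)))).
    rewrite -mulrA ler_wpM2l// ler_pdivrMr//; apply: (le_trans PE).
    by rewrite le_eqVlt; apply/orP; left; apply/eqP; move: (_ `^ _) => u; ring.
  have -> : C * (D x ^+ 2 * (1 - x)) = 2 * s * D x * (kappa * (D x * (1 - x)) * (kappa ^+ 2 * K) `^ (s - 1)).
    by rewrite /C; move: (_ `^ _) => u; ring.
  by rewrite ler_wpM2l// ler_wpM2r// powR_ge0.
have -> : expR (E x) * dE x = expR (E x) * (s * (dphi x / phi x)) - (s - 1) * (expR (E x) / (1 - x)).
  by rewrite /dE; move: (expR _) => P; field; rewrite !gt_eqF.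
move: (le_trans h1 h2); move: (expR (E x) / (1 - x)) (expR _ * _) (C * _) => u v w h.
lra.
Qed.

Let cE x : x < 1 -> {for x, continuous E}.
Proof.
by move=> x1; apply: differentiable_continuous; apply/derivable1_diffP; have [] := dE_E x1.
Qed.

Let cdP x : x < 1 -> {for x, continuous (fun x => expR (E x) * dE x)}.
Proof.
move=> x1; have y0 : 1 - x != 0 by rewrite gt_eqF// subr_gt0.
apply: cvgM.
  by apply: (@continuous_comp _ _ _ E expR); [exact: cE|exact: continuous_expR].
apply: cvgB.
  apply: cvgM; first exact: cvg_cst.
  apply: cvgM; first exact: cdphi.
  by apply: cvgV; [rewrite gt_eqF|exact: cphi].
apply: cvgM; first exact: cvg_cst.
by apply: cvgV => //; apply: cvgB; [exact: cvg_cst|exact: cvg_id].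
Qed.

(** The pointwise estimate is integrated over [[0, rho]]; the boundary value at [rho] is positive
    and is dropped, which leaves only [phi 0]. *)
Lemma radial_hardy :
  \int[mu]_(x in `[0, rho]) (phi x `^ s * (1 - x) `^ (s - 2)) <=
  2 / (s - 1) * (phi 0 `^ s + hardy_cst s K * \int[mu]_(x in `[0, rho]) (D x ^+ 2 * (1 - x))).
Proof.
rewrite -[hardy_cst s K]/C.
have lt1 x : 0 <= x <= rho -> x < 1 by move=> /andP[_ /le_lt_trans]; apply.
have FTC : \int[mu]_(x in `[0, rho]) (expR (E x) * dE x) = expR (E rho) - expR (E 0).
  rewrite /Rintegral (@continuous_FTC2 _ _ (fun x => expR (E x))) -?EFinB//.
  - apply: continuous_in_subspaceT => x; rewrite inE /= in_itv /= => /lt1; exact: cdP.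
  - split.
    + move=> x; rewrite in_itv /= => /andP[_ xr].
      have x1 : x < 1 by exact: lt_trans rho1.
      have [] // := @is_derive1_comp _ expR E x _ _ (is_derive_expR _) (dE_E x1).
    + apply: cvg_at_right_filter; apply: (@continuous_comp _ _ _ E expR); [exact: cE|exact: continuous_expR].
    + apply: cvg_at_left_filter; apply: (@continuous_comp _ _ _ E expR); [exact: cE|exact: continuous_expR].
  - move=> x; rewrite in_itv /= => /andP[_ xr].
    have x1 : x < 1 by exact: lt_trans rho1.
    have [_ H] := @is_derive1_comp _ expR E x _ _ (is_derive_expR _) (dE_E x1).
    by rewrite derive1E; exact: H.
have cW x : 0 <= x <= rho -> {for x, continuous (fun x => phi x `^ s * (1 - x) `^ (s - 2))}.
  by move=> /lt1; exact: radial_weight_continuous.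
have cDD x : {for x, continuous (fun x => D x ^+ 2 * (1 - x))}.
  apply: cvgM; first by apply: cvgM; exact: cD.
  by apply: cvgB; [exact: cvg_cst|exact: cvg_id].
have iW : mu.-integrable `[0, rho] (EFin \o (fun x => phi x `^ s * (1 - x) `^ (s - 2))).
  exact: cont_integrable.
have iD : mu.-integrable `[0, rho] (EFin \o (fun x => D x ^+ 2 * (1 - x))).
  by apply: cont_integrable => x _; exact: cDD.
have : expR (E rho) - expR (E 0) <= - ((s - 1) / 2) * \int[mu]_(x in `[0, rho]) (phi x `^ s * (1 - x) `^ (s - 2))
    + C * \int[mu]_(x in `[0, rho]) (D x ^+ 2 * (1 - x)).
  rewrite -FTC -!RintegralZl// -RintegralD//; last 2 first.
  - by apply: cont_integrable => x xr; apply: cvgM; [exact: cvg_cst|exact: cW].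
  - by apply: cont_integrable => x xr; apply: cvgM; [exact: cvg_cst|exact: cDD].
  apply: le_Rintegral => //.
  - by apply: cont_integrable => x /lt1; exact: cdP.
  - apply: cont_integrable => x xr; apply: cvgD.
      by apply: cvgM; [exact: cvg_cst|exact: cW].
    by apply: cvgM; [exact: cvg_cst|exact: cDD].
  move=> x /=; rewrite in_itv /= => /[dup] xr /andP[x0 _]; apply: pointwise.
  by rewrite x0 lt1.
have -> : expR (E 0) = phi 0 `^ s by rewrite Ppow// subr0 powR1 mulr1.
have := expR_gt0 (E rho).
move: (expR (E rho)) (\int[mu]_(x in _) _) (C * _) (phi 0 `^ s) => u W v w u0 H.
rewrite mulrAC ler_pdivlMr//.
have -> : 2 * (w + v) = 2 * w + 2 * v by ring.
lra.
Qed.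

End radial_hardy.

(** * Area estimates for Taylor polynomials *)

Section polynomial_area.
Context {R : realType}.
Local Open Scope complex_scope.
Local Notation mu := (@lebesgue_measure R).
Implicit Types (b : nat -> R[i]) (t x : R) (z : R[i]).

Let tpi0 : 0 <= 2 * pi :> R. Proof. by rewrite mulr_ge0// pi_ge0. Qed.

(** The value [1 / ((2k + 1) (2k + 2))] decays like [k^(-2)] and compensates the squared factor
    [k + 1] that differentiation brings in. *)
Lemma Rint_beta k : \int[mu]_(x in `[0, 1]) ((1 - x) * (x ^+ 2) ^+ k) =
  (k.*2.+1%:R)^-1 - (k.*2.+2%:R)^-1.
Proof.
pose H x : R := (k.*2.+1%:R)^-1 * x ^+ k.*2.+1 - (k.*2.+2%:R)^-1 * x ^+ k.*2.+2.
have dH x : is_derive x 1 H ((1 - x) * (x ^+ 2) ^+ k).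
  have d n : is_derive x 1 (fun x : R => x ^+ n.+1) (n.+1%:R * x ^+ n).
    have -> : (fun x : R => x ^+ n.+1) = id ^+ n.+1 by apply/funext => y; rewrite exprfctE.
    apply: is_derive_eq (is_deriveX n.+1 (is_derive_id x (1 : R))) _.
    by rewrite /GRing.scale /= mulr1.
  apply: is_derive_eq (is_deriveB (is_deriveZ _ (d k.*2)) (is_deriveZ _ (d k.*2.+1))) _.
  rewrite /GRing.scale /= !mulrA !mulVf ?pnatr_eq0// !mul1r exprS -exprM mul2n.
  by rewrite mulrBl mul1r.
have cf x : {for x, continuous (fun x : R => (1 - x) * (x ^+ 2) ^+ k)}.
  apply: cvgM; first by apply: cvgB; [exact: cvg_cst|exact: cvg_id].
  by apply: (@continuous_comp _ _ _ (fun r : R => r ^+ 2) (fun x => x ^+ k)); exact: exprn_continuous.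
have cH x : {for x, continuous H}.
  by apply: differentiable_continuous; apply/derivable1_diffP; have [] := dH x.
rewrite /Rintegral (@continuous_FTC2 _ _ H)//.
- by rewrite -EFinB /= /H !expr1n !expr0n /= !mulr0 !mulr1 subr0 subr0.
- by apply: continuous_subspaceT.
- split.
  + by move=> x _; have [] := dH x.
  + by apply: cvg_at_right_filter; exact: cH.
  + by apply: cvg_at_left_filter; exact: cH.
- by move=> x _; rewrite derive1E; have [] := dH x.
Qed.

Let pray b N t x : pcont (fun x : R => ptrunc b N (x%:C * unit_pt t)) x.
Proof.
apply: pcont_comp; first exact: ptrunc_ccont.
by apply: pcontM; [apply: pcont_real; exact: cvg_id|exact: pcont_cst].
Qed.

Lemma cmeas_ptrunc_polar b N : cmeas (fun p : R * R => ptrunc b N (p.1%:C * unit_pt p.2)).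
Proof.
apply: cmeas_sum => k; apply: cmeasM; first exact: cmeas_cst.
apply: cmeas_exprn; apply: cmeasM.
  by split; [exact: measurable_fst|exact: measurable_cst].
split.
  exact: (measurableT_comp (continuous_measurable_fun (@continuous_cos R)) measurable_snd).
exact: (measurableT_comp (continuous_measurable_fun (@continuous_sin R)) measurable_snd).
Qed.

Section estimate.
Variables (b : nat -> R[i]) (N : nat) (A s rho : R).
Hypotheses (HA : forall n, \sum_(0 <= k < n) nc (b k) ^+ 2 <= A).
Hypotheses (s1 : 1 < s) (rho0 : 0 < rho) (rho1 : rho < 1).

Let S := ptrunc b N.+1.
Let S' := ptrunc (dcoef b) N.
Let K := ((A + 2) / 2) ^+ 2.

Let sm : 0 < s - 1. Proof. by rewrite subr_gt0. Qed.

(** [radial_hardy] applied to [phi = 1 + |S|^2]: here [dphi = 2 Re (S conj (S' w))] is at most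
    [2 sqrt phi |S'|], and [ptrunc_deriv_growth] supplies [K]. *)
Lemma ray_estimate t :
  \int[mu]_(x in `[0, rho]) ((1 + nc (S (x%:C * unit_pt t)) ^+ 2) `^ s * (1 - x) `^ (s - 2)) <=
  2 / (s - 1) * ((1 + A) `^ s +
    hardy_cst s K * \int[mu]_(x in `[0, rho]) (nc (S' (x%:C * unit_pt t)) ^+ 2 * (1 - x))).
Proof.
pose phi x := 1 + nc (S (x%:C * unit_pt t)) ^+ 2.
pose w := unit_pt t : R[i].
pose dphi x := 2 * complex.Re (S (x%:C * w) * conj (S' (x%:C * w) * w)).
have dP x : is_derive x 1 phi (dphi x).
  have cS : cdiff S (x%:C * w) (S' (x%:C * w)) by exact: ptrunc_cdiff.
  have dR := ray_derive_Re cS; have dI := ray_derive_Im cS.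
  have -> : phi = (fun=> 1) + ((fun x => complex.Re (S (x%:C * w))) * (fun x => complex.Re (S (x%:C * w))) +
      (fun x => complex.Im (S (x%:C * w))) * (fun x => complex.Im (S (x%:C * w)))).
    by apply/funext => y; rewrite /phi nc_sqr.
  apply: is_derive_eq (is_deriveD (is_derive_cst _ _ _) (is_deriveD (is_deriveM dR dR) (is_deriveM dI dI))) _.
  rewrite /dphi [in RHS]cReM /conj /GRing.scale /=.
  by move: (complex.Re _) (complex.Im _) (complex.Re (S' _ * _)) (complex.Im (S' _ * _)) => u v u' v'; ring.
have pS x := @pray b N.+1 t x; have pS' x := @pray (dcoef b) N t x.
have ps2 x : pcont (fun x : R => S' (x%:C * w) * w) x by apply: pcontM; [exact: pS'|exact: pcont_cst].
have := @radial_hardy R phi dphi (fun x => nc (S' (x%:C * w))) s K rho s1 rho0 rho1.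
have h1 x : 1 <= phi x by rewrite /phi lerDl sqr_ge0.
have cdphi x : {for x, continuous dphi}.
  have c1 : {for x, continuous (fun x : R => complex.Re (S (x%:C * w) * conj (S' (x%:C * w) * w)))}.
    have -> : (fun x : R => complex.Re (S (x%:C * w) * conj (S' (x%:C * w) * w))) =
      fun x => complex.Re (S (x%:C * w)) * complex.Re (S' (x%:C * w) * w) +
               complex.Im (S (x%:C * w)) * complex.Im (S' (x%:C * w) * w).
      by apply/funext => y; rewrite cReM /conj /= mulrN opprK.
    by apply: cvgD; apply: cvgM; [apply: pcont_Re; exact: pS|apply: pcont_Re; exact: ps2|
    apply: pcont_Im; exact: pS|apply: pcont_Im; exact: ps2].
  by apply: cvgM; [exact: cvg_cst|exact: c1].
have dD x : dphi x <= 2 * Num.sqrt (phi x) * nc (S' (x%:C * w)).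
  rewrite /dphi -mulrA ler_pM2l//; apply: (le_trans (ler_norm _)); apply: (le_trans (Re_le_nc _)).
  rewrite Normc.normcM nc_conj Normc.normcM nc_unit_pt mulr1 ler_wpM2r ?nc_ge0//.
  by rewrite -[X in X <= _]ger0_norm ?nc_ge0// -sqrtr_sqr ler_wsqrtr// /phi lerDr.
have DK x : 0 <= x < 1 -> nc (S' (x%:C * w)) ^+ 2 * (1 - x) ^+ 3 <= K.
  move=> /andP[x0 x1]; have nx : nc (x%:C * w) = x by rewrite nc_circ.
  by rewrite -[in 1 - x]nx; apply: ptrunc_deriv_growth => //; rewrite nx.
move=> /(_ h1 (fun x => nc_ge0 _) dP cdphi (fun x => pcont_nc (pS' x)) dD DK) H.
apply: (le_trans H); rewrite ler_wpM2l ?divr_ge0 ?(ltW sm)// lerD2r.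
have b0 : nc (b 0%N) ^+ 2 <= A by have := HA 1; rewrite big_nat1.
apply: powR_le; [exact: (ltW (lt_trans ltr01 s1))|exact: le_trans (h1 0)|].
rewrite /phi mul0r lerD2l /S /ptrunc big_nat_recl// expr0 mulr1 big1 ?addr0// => k _.
by rewrite exprS mul0r mulr0.
Qed.

(** Parseval on each circle, followed by the radial integral of each coefficient over [[0, 1]]. *)
Lemma derivative_area :
  (\int[mu]_(t in `[0%R, (2 * pi)%R]) \int[mu]_(x in `[0%R, rho])
     (nc (S' (x%:C * unit_pt t)) ^+ 2 * (1 - x))%R%:E <= (2 * pi * A)%:E)%E.
Proof.
(* The absolute value, harmless for [p.1 <= rho], makes [F] nonnegative on the whole plane, as
   Tonelli requires. *)
pose F (p : R * R) := (nc (S' (p.1%:C * unit_pt p.2)) ^+ 2 * `|1 - p.1|)%:E.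
have F0 p : (0 <= F p)%E by rewrite lee_fin mulr_ge0// sqr_ge0.
have mF : measurable_fun setT F.
  apply/measurable_EFinP; apply: measurable_funM.
    by apply: measurable_funX; apply: cmeas_nc; exact: cmeas_ptrunc_polar.
  apply: measurableT_comp => //; apply: measurable_funB; first exact: measurable_cst.
  exact: measurable_fst.
have -> : (\int[mu]_(t in `[0%R, (2 * pi)%R]) \int[mu]_(x in `[0%R, rho])
     (nc (S' (x%:C * unit_pt t)) ^+ 2 * (1 - x))%R%:E =
   \int[mu]_(t in `[0%R, (2 * pi)%R]) \int[mu]_(x in `[0%R, rho]) F (x, t))%E.
  apply: eq_integral => t _; apply: eq_integral => x; rewrite inE /= in_itv /= => /andP[x0 x1].
  by rewrite /F /= ger0_norm// subr_ge0 (le_trans x1)// ltW.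
rewrite -(tonelli_itv (measurable_itv _) (measurable_itv _) mF F0).
have cS (x : R) t : {for t, continuous (fun t => nc (S' (x%:C * unit_pt t)) ^+ 2)}.
  by apply: cvgM; apply: pcont_nc; apply: pcont_circ; exact: ptrunc_ccont.
pose G x : R := 2 * pi * \sum_(0 <= k < N) nc (dcoef b k) ^+ 2 * ((1 - x) * (x ^+ 2) ^+ k).
have cG x : {for x, continuous G}.
  apply: cvgM; first exact: cvg_cst.
  apply: cvg_big => [|k _]; first exact: add_continuous.
  apply: cvgM; first exact: cvg_cst.
  apply: cvgM; first by apply: cvgB; [exact: cvg_cst|exact: cvg_id].
  by apply: (@continuous_comp _ _ _ (fun r : R => r ^+ 2) (fun x => x ^+ k)); exact: exprn_continuous.
have G0 x : 0 <= x <= 1 -> 0 <= G x.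
  move=> /andP[x0 x1]; rewrite mulr_ge0// sumr_ge0// => k _.
  by rewrite mulr_ge0 ?sqr_ge0// mulr_ge0 ?subr_ge0// exprn_ge0// sqr_ge0.
apply: (@le_trans _ _ (\int[mu]_(x in `[0%R, 1%R]) (G x)%:E)%E).
  have -> : (\int[mu]_(x in `[0%R, rho]) \int[mu]_(t in `[0%R, (2 * pi)%R]) F (x, t) =
     \int[mu]_(x in `[0%R, rho]) (G x)%:E)%E.
    apply: eq_integral => x; rewrite inE /= in_itv /= => /andP[x0 x1].
    have x1' : x < 1 by exact: le_lt_trans rho1.
    have y0 : 0 <= 1 - x by rewrite subr_ge0 ltW.
    rewrite /F /= Rint_EFin; last by move=> t _; apply: cvgM; [exact: cS|exact: cvg_cst].
    rewrite RintegralZr//; last by apply: cont_integrable => t _; exact: cS.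
    rewrite parseval ?x0// ger0_norm// /G; congr EFin; rewrite -(mulrA (2 * pi)); congr (_ * _); rewrite mulr_suml.
    by apply: eq_bigr => k _; rewrite -mulrA [_ * (1 - x)]mulrC.
  apply: ge0_subset_integral => //.
  - by apply/measurable_EFinP; apply: measurable_funTS; exact: continuous_measurable_fun.
  - by move=> x /=; rewrite !in_itv /= => /andP[-> /le_trans]; apply; exact: ltW.
rewrite Rint_EFin// lee_fin /G RintegralZl//; last first.
  apply: cont_integrable => x _; apply: cvg_big => [|k _]; first exact: add_continuous.
  apply: cvgM; first exact: cvg_cst.
  apply: cvgM; first by apply: cvgB; [exact: cvg_cst|exact: cvg_id].
  by apply: (@continuous_comp _ _ _ (fun r : R => r ^+ 2) (fun x => x ^+ k)); exact: exprn_continuous.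
rewrite ler_wpM2l//.
have cB k x : {for x, continuous (fun x : R => (1 - x) * (x ^+ 2) ^+ k)}.
  apply: cvgM; first by apply: cvgB; [exact: cvg_cst|exact: cvg_id].
  by apply: (@continuous_comp _ _ _ (fun r : R => r ^+ 2) (fun x => x ^+ k)); exact: exprn_continuous.
have -> : \int[mu]_(x in `[0, 1]) (\sum_(0 <= k < N) nc (dcoef b k) ^+ 2 * ((1 - x) * (x ^+ 2) ^+ k)) =
    \sum_(0 <= k < N) nc (dcoef b k) ^+ 2 * ((k.*2.+1%:R)^-1 - (k.*2.+2%:R)^-1).
  elim: (N) => [|n IH].
    rewrite big_geq// (@eq_Rintegral _ _ _ mu _ (fun=> 0)); last by move=> x _; rewrite big_geq.
    by rewrite Rintegral_cst// mul0r.
  rewrite big_nat_recr//= -IH -Rint_beta -RintegralZl//; last by apply: cont_integrable => x _; exact: cB.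
  rewrite -RintegralD//; last 2 first.
  - apply: cont_integrable => x _; apply: cvg_big => [|k _]; first exact: add_continuous.
    by apply: cvgM; [exact: cvg_cst|exact: cB].
  - by apply: cont_integrable => x _; apply: cvgM; [exact: cvg_cst|exact: cB].
  by apply: eq_Rintegral => x _; rewrite big_nat_recr.
apply: le_trans (HA N.+1); rewrite [leRHS]big_nat_recl//.
rewrite ler_wpDl ?sqr_ge0//; apply: ler_sum_nat => k _.
rewrite /dcoef Normc.normcM nc_nat exprMn mulrC mulrA.
rewrite -[X in _ <= X]mul1r ler_wpM2r ?sqr_ge0//.
have -> : k.*2.+1%:R = 2 * k.+1%:R - 1 :> R by rewrite -natr1 -[k.+1%:R]natr1 -mul2n natrM; ring.
have -> : k.*2.+2%:R = 2 * k.+1%:R :> R by rewrite -doubleS -mul2n natrM.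
have : 1 <= k.+1%:R :> R by rewrite ler1n.
move: (k.+1%:R) => n n1.
(* With [n = k + 1], each coefficient weight is [n / (2 (2n - 1))], at most [1] for [n >= 1]. *)
have -> : ((2 * n - 1)^-1 - (2 * n)^-1) * n ^+ 2 = n / (2 * (2 * n - 1)).
  by field; rewrite !gt_eqF//; lra.
by rewrite ler_pdivrMr; lra.
Qed.

(** The ray estimate is integrated over the angle after an exchange of integrals. The bound depends
    on neither [N] nor [rho], which permits the later passage to the limit. *)
Lemma polynomial_area :
  (\int[mu]_(x in `[0%R, rho]) \int[mu]_(t in `[0%R, (2 * pi)%R])
     ((1 + nc (S (x%:C * unit_pt t)) ^+ 2) `^ s * (1 - x) `^ (s - 2))%R%:E <=
   (2 / (s - 1) * (2 * pi * (1 + A) `^ s + hardy_cst s K * (2 * pi * A)))%:E)%E.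
Proof.
have K0 : 0 <= K by exact: sqr_ge0.
have C0 := hardy_cst_ge0 K s1.
have c0 : 0 <= 2 / (s - 1) by rewrite divr_ge0// ltW.
have cS t x : {for x, continuous (fun x : R => nc (S (x%:C * unit_pt t)) ^+ 2)}.
  by apply: cvgM; apply: pcont_nc; exact: pray.
have cS' t x : {for x, continuous (fun x : R => nc (S' (x%:C * unit_pt t)) ^+ 2 * (1 - x))}.
  apply: cvgM; first by apply: cvgM; apply: pcont_nc; exact: pray.
  by apply: cvgB; [exact: cvg_cst|exact: cvg_id].
pose F (p : R * R) := ((1 + nc (S (p.1%:C * unit_pt p.2)) ^+ 2) `^ s * (1 - p.1) `^ (s - 2))%:E.
have F0 p : (0 <= F p)%E by rewrite lee_fin mulr_ge0// powR_ge0.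
have mF : measurable_fun setT F.
  apply/measurable_EFinP; apply: measurable_funM.
    apply: (measurableT_comp (measurable_powR _)); apply: measurable_funD; first exact: measurable_cst.
    by apply: measurable_funX; apply: cmeas_nc; exact: cmeas_ptrunc_polar.
  apply: (measurableT_comp (measurable_powR _)); apply: measurable_funB; first exact: measurable_cst.
  exact: measurable_fst.
pose F' (p : R * R) := (nc (S' (p.1%:C * unit_pt p.2)) ^+ 2 * `|1 - p.1|)%:E.
have F'0 p : (0 <= F' p)%E by rewrite lee_fin mulr_ge0// sqr_ge0.
have mF' : measurable_fun setT F'.
  apply/measurable_EFinP; apply: measurable_funM.
    by apply: measurable_funX; apply: cmeas_nc; exact: cmeas_ptrunc_polar.
  apply: measurableT_comp => //; apply: measurable_funB; first exact: measurable_cst.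
  exact: measurable_fst.
have F'E t : (\int[mu]_(x in `[0%R, rho]) F' (x, t) = \int[mu]_(x in `[0%R, rho])
     (nc (S' (x%:C * unit_pt t)) ^+ 2 * (1 - x))%R%:E)%E.
  apply: eq_integral => x; rewrite inE /= in_itv /= => /andP[x0 x1].
  by rewrite /F' /= ger0_norm// subr_ge0 (le_trans x1)// ltW.
have FE x t : F (x, t) = ((1 + nc (S (x%:C * unit_pt t)) ^+ 2) `^ s * (1 - x) `^ (s - 2))%:E by [].
under eq_integral => x _ do (under eq_integral => t _ do rewrite -FE).
clearbody F F'.
rewrite (tonelli_itv (measurable_itv _) (measurable_itv _) mF F0).
have m1 := measurable_itv_r (measurable_itv `[0, rho]) mF F0.
have m2 := measurable_itv_r (measurable_itv `[0, rho]) mF' F'0.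
have g2 t : (0 <= \int[mu]_(x in `[0%R, rho]) F' (x, t))%E by apply: integral_ge0.
apply: (@le_trans _ _ (\int[mu]_(t in `[0%R, (2 * pi)%R])
   ((2 / (s - 1))%:E * (((1 + A) `^ s)%:E + (hardy_cst s K)%:E * \int[mu]_(x in `[0%R, rho]) F' (x, t))))%E).
  apply: ge0_le_integral => //.
  - by move=> t _; apply: integral_ge0.
  - exact: measurable_funTS.
  - apply: measurable_funTS; apply: emeasurable_funM; first exact: measurable_cst.
    apply: emeasurable_funD; first exact: measurable_cst.
    by apply: emeasurable_funM => //; exact: measurable_cst.
  move=> t _; rewrite F'E; under eq_integral do rewrite FE.
  rewrite !Rint_EFin//; last first.
    move=> x /andP[_ xr]; have x1 : x < 1 by exact: le_lt_trans rho1.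
    apply: (@radial_weight_continuous _ (fun x => 1 + nc (S (x%:C * unit_pt t)) ^+ 2)) => //.
      by rewrite ltr_wpDr// sqr_ge0.
    by apply: cvgD; [exact: cvg_cst|exact: cS].
  by rewrite -(EFinM (hardy_cst s K)) -EFinD -EFinM lee_fin ray_estimate.
rewrite ge0_integralZl//; last 2 first.
- apply: measurable_funTS; apply: emeasurable_funD; first exact: measurable_cst.
  by apply: emeasurable_funM => //; exact: measurable_cst.
- by move=> t _; rewrite adde_ge0 ?lee_fin ?powR_ge0// mule_ge0// lee_fin.
rewrite (EFinM (2 / (s - 1))) lee_wpmul2l ?lee_fin// ge0_integralD//; last 3 first.
- by move=> t _; rewrite lee_fin powR_ge0.
- by move=> t _; rewrite mule_ge0// lee_fin.
- by apply: measurable_funTS; apply: emeasurable_funM => //; exact: measurable_cst.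
rewrite EFinD leeD//.
  by rewrite Rint_EFin ?Rint_cst// => t _; exact: cvg_cst.
rewrite ge0_integralZl//; last exact: measurable_funTS.
rewrite (EFinM (hardy_cst s K)) lee_wpmul2l ?lee_fin//.
by under eq_integral do rewrite F'E; exact: derivative_area.
Qed.

End estimate.

End polynomial_area.

(** * Passage to the limit and the inclusion of Hardy in Bergman spaces *)

Section bergman_of_hardy.
Context {R : realType}.
Local Open Scope complex_scope.
Local Notation mu := (@lebesgue_measure R).
Implicit Types (b : nat -> R[i]) (t x : R) (z : R[i]).

Let tpi0 : 0 <= 2 * pi :> R. Proof. by rewrite mulr_ge0// pi_ge0. Qed.
Let tpi1 : 0 < 2 * pi :> R. Proof. by rewrite mulr_gt0// pi_gt0. Qed.

Lemma measurable_le_indicator (a : R) : measurable_fun setT (fun x : R => (x <= a)%R%:R : R).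
Proof.
have -> : (fun x : R => (x <= a)%R%:R : R) = \1_(`]-oo, a]%classic).
  by apply/funext => x; rewrite indicE mem_setE in_itv.
exact: measurable_indic.
Qed.

Lemma limn_einf_le (u : (\bar R)^nat) (c : \bar R) : (forall n, (u n <= c)%E) -> (limn_einf u <= c)%E.
Proof.
move=> H; rewrite limn_einf_lim; apply: lime_le; first exact: is_cvg_einfs.
apply: nearW => n; apply: le_trans (H n); apply: ereal_inf_lbound; exists n => //=.
Qed.

Lemma csums_nc (u : nat -> R[i]) l : csums u l ->
  nc (\sum_(0 <= k < n) u k) @[n --> \oo] --> nc l.
Proof.
move=> H; apply/cvgrPdist_le => e e0; have [N HN] := H _ e0.
exists N => // n /= Nn; apply: le_trans (HN n Nn).
set x := \sum_(0 <= k < n) u k; rewrite ler_norml.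
have h1 := ncBD l (x - l); have h2 := ncBD x (l - x).
move: h1 h2; rewrite (_ : l + (x - l) = x); last by ring.
rewrite (_ : x + (l - x) = l); last by ring.
rewrite (ncB l x); move: (nc x) (nc l) (nc (x - l)) => a c d h1 h2; lra.
Qed.

Section square_mean.
Variables (h : R[i] -> R[i]) (M s : R).
Hypotheses (hh : holoD h) (s1 : 1 < s).
Hypothesis HM : forall r, 2^-1 <= r -> r < 1 ->
  \int[mu]_(t in `[0, 2 * pi]) nc (h (r%:C * unit_pt t)) ^+ 2 <= M.

Let b := tcoef h.
Let A := M / (2 * pi).
Let rad n : R := 1 - (n.+2%:R)^-1.
(** The polynomial estimate reaches only radii below [1], so the disk is truncated at [rad n] while
    the degree grows; both approximations disappear together in Fatou's lemma. *)
Let Phi n z := (nc z <= rad n)%R%:R * ((1 + nc (ptrunc b n.+1 z) ^+ 2) `^ s * (1 - nc z ^+ 2) `^ (s - 2)).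
Let Cst := 2 / (s - 1) * (2 * pi * (1 + A) `^ s + hardy_cst s (((A + 2) / 2) ^+ 2) * (2 * pi * A)).

Let HA n : \sum_(0 <= k < n) nc (b k) ^+ 2 <= A.
Proof. by rewrite /A ler_pdivlMr// mulrC; exact: bessel_limit. Qed.

Let rad0 n : 0 < rad n.
Proof. by rewrite subr_gt0 invf_lt1 ?ltr0n// ltr1n. Qed.

Let rad1 n : rad n < 1.
Proof. by rewrite gtrBl invr_gt0 ltr0n. Qed.

Let Phi0 n z : 0 <= Phi n z.
Proof. by rewrite mulr_ge0// mulr_ge0// powR_ge0. Qed.

Let mPhi n : measurable_fun (@disk2 R) (fun w : R * R => Phi n (w.1 +i* w.2)).
Proof.
have mS : cmeas (fun w : R * R => ptrunc b n.+1 (w.1 +i* w.2)).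
  by apply: cmeas_sum => k; apply: cmeasM; [exact: cmeas_cst|apply: cmeas_exprn; exact: cmeas_point].
have mn := cmeas_nc (@cmeas_point R).
apply: measurable_funTS; apply: measurable_funM.
  exact: (measurableT_comp (measurable_le_indicator _) mn).
apply: measurable_funM; apply: (measurableT_comp (measurable_powR _)).
  by apply: measurable_funD; [exact: measurable_cst|apply: measurable_funX; exact: cmeas_nc].
by apply: measurable_funB; [exact: measurable_cst|apply: measurable_funX].
Qed.

Let cS n (r t : R) : {for t, continuous (fun t => (1 + nc (ptrunc b n.+1 (r%:C * unit_pt t)) ^+ 2) `^ s)}.
Proof.
apply: (@continuous_powR_comp R (fun t => 1 + nc (ptrunc b n.+1 (r%:C * unit_pt t)) ^+ 2)).
- exact: lt_trans s1.
- by move=> x; rewrite addr_ge0// sqr_ge0.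
apply: cvgD; first exact: cvg_cst.
by apply: cvgM; apply: pcont_nc; apply: pcont_circ; exact: ptrunc_ccont.
Qed.

Let PhiE n r t : 0 <= r -> Phi n (r%:C * unit_pt t) =
  (r <= rad n)%R%:R * ((1 + nc (ptrunc b n.+1 (r%:C * unit_pt t)) ^+ 2) `^ s * (1 - r ^+ 2) `^ (s - 2)).
Proof. by move=> r0; rewrite /Phi nc_circ. Qed.

Let cPhi n r t : 0 <= r < 1 -> {for t, continuous (fun t => Phi n (r%:C * unit_pt t))}.
Proof.
move=> /andP[r0 r1].
have -> : (fun t => Phi n (r%:C * unit_pt t)) = fun t => (r <= rad n)%R%:R *
    ((1 + nc (ptrunc b n.+1 (r%:C * unit_pt t)) ^+ 2) `^ s * (1 - r ^+ 2) `^ (s - 2)).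
  by apply/funext => x; rewrite PhiE.
apply: cvgM; first exact: cvg_cst.
by apply: cvgM; [exact: cS|exact: cvg_cst].
Qed.

Let weight_le (r : R) : 0 <= r < 1 -> (1 - r ^+ 2) `^ (s - 2) <= 2 `^ `|s - 2| * (1 - r) `^ (s - 2).
Proof.
move=> /andP[r0 r1]; have -> : 1 - r ^+ 2 = (1 + r) * (1 - r) by ring.
have r2 : 0 <= 1 + r by rewrite addr_ge0.
have r3 : 0 <= 1 - r by rewrite subr_ge0 ltW.
rewrite (powRM (s - 2) r2 r3); apply: ler_wpM2r; first exact: powR_ge0.
have r1' : 1 <= 1 + r by rewrite lerDl.
apply: (@le_trans _ _ ((1 + r) `^ `|s - 2|)).
  by apply: ler_powR => //; exact: ler_norm.
by apply: powR_le => //; lra.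
Qed.

(** Polar coordinates bring [polynomial_area] into play; passing from [1 - r] to [1 - r ^+ 2] in the
    weight costs the factor [2^|s - 2|], whatever the sign of the exponent. *)
Lemma truncated_area n :
  (\int[mu \x mu]_(w in @disk2 R) (Phi n (w.1 +i* w.2))%:E <= (2 `^ `|s - 2| * Cst)%:E)%E.
Proof.
apply: (le_trans (polar_upper (@mPhi n) measurable_disk2 (@Phi0 n) (@cPhi n))).
have mQ := measurable_circle_mean (@mPhi n) measurable_disk2 (@Phi0 n).
have Q0 (r : R) : 0 <= r -> (0 <= r%:E * \int[mu]_(t in `[0%R, (2 * pi)%R]) (Phi n (r%:C * unit_pt t))%:E)%E.
  by move=> r0; rewrite mule_ge0 ?lee_fin//; apply: integral_ge0 => t _; rewrite lee_fin.
have sub : `[0, rad n]%classic `<=` (`[0, 1[%classic : set R).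
  by move=> x /=; rewrite !in_itv /= => /andP[-> /le_lt_trans]; apply.
have -> : (\int[mu]_(r in `[0%R, 1%R[) (r%:E * \int[mu]_(t in `[0%R, (2 * pi)%R]) (Phi n (r%:C * unit_pt t))%:E) =
  \int[mu]_(r in `[0%R, rad n]) (r%:E * \int[mu]_(t in `[0%R, (2 * pi)%R]) (Phi n (r%:C * unit_pt t))%:E))%E.
  rewrite [LHS]integral_mkcond [RHS]integral_mkcond; apply: eq_integral => r _.
  rewrite /patch !mem_setE !in_itv /=; case: ifPn => [/andP[r0 r1]|r01]; last first.
    by case: ifPn => // r2; move: r01; have := sub r; rewrite /= !in_itv /= => /(_ r2) ->.
  case: ifPn => //; rewrite r0 /= => rn.
  rewrite (eq_integral (fun=> 0%E)) ?integral0 ?mule0// => t _.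
  by rewrite PhiE// (negbTE rn) mul0r.
pose F (p : R * R) := ((1 + nc (ptrunc b n.+1 (p.1%:C * unit_pt p.2)) ^+ 2) `^ s * (1 - p.1) `^ (s - 2))%:E.
have F0 p : (0 <= F p)%E by rewrite lee_fin mulr_ge0// powR_ge0.
have mF : measurable_fun setT F.
  apply/measurable_EFinP; apply: measurable_funM.
    apply: (measurableT_comp (measurable_powR _)); apply: measurable_funD; first exact: measurable_cst.
    by apply: measurable_funX; apply: cmeas_nc; exact: cmeas_ptrunc_polar.
  apply: (measurableT_comp (measurable_powR _)); apply: measurable_funB; first exact: measurable_cst.
  exact: measurable_fst.
have FE x t : F (x, t) = ((1 + nc (ptrunc b n.+1 (x%:C * unit_pt t)) ^+ 2) `^ s * (1 - x) `^ (s - 2))%:E by [].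
have PA := polynomial_area n HA s1 (rad0 n) (rad1 n).
have {}PA : (\int[mu]_(x in `[0%R, rad n]) \int[mu]_(t in `[0%R, (2 * pi)%R]) F (x, t) <= Cst%:E)%E by exact: PA.
clearbody F.
have mJ := measurable_itv_l (measurable_itv `[0, 2 * pi]) mF F0.
apply: (@le_trans _ _ (\int[mu]_(x in `[0%R, rad n])
   ((2 `^ `|s - 2|)%:E * \int[mu]_(t in `[0%R, (2 * pi)%R]) F (x, t)))%E); last first.
  rewrite ge0_integralZl//; last 2 first.
  - exact: measurable_funTS.
  - by move=> x _; exact: integral_ge0.
  by rewrite EFinM lee_wpmul2l// lee_fin powR_ge0.
apply: ge0_le_integral => //.
- by move=> x /=; rewrite in_itv /= => /andP[x0 _]; exact: Q0.
- exact: measurable_funS mQ.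
- apply: measurable_funTS; apply: emeasurable_funM => //; exact: measurable_cst.
move=> x /=; rewrite in_itv /= => /andP[x0 xn].
have x1 : x < 1 by exact: le_lt_trans (rad1 n).
have x01 : 0 <= x < 1 by rewrite x0.
under [X in (_ <= _ * X)%E]eq_integral do rewrite FE.
rewrite !Rint_EFin; last 2 first.
- by move=> t _; apply: cvgM; [exact: cS|exact: cvg_cst].
- by move=> t _; exact: cPhi.
rewrite -!EFinM lee_fin -[X in _ <= X]RintegralZl//; last first.
  by apply: cont_integrable => t _; apply: cvgM; [exact: cS|exact: cvg_cst].
apply: (@le_trans _ _ (\int[mu]_(t in `[0, 2 * pi]) Phi n (x%:C * unit_pt t))).
  by rewrite ler_piMl ?(ltW x1)//; apply: Rintegral_ge0 => t _.
apply: le_Rintegral => //.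
- by apply: cont_integrable => t _; exact: cPhi.
- by apply: cont_integrable => t _; apply: cvgM; [exact: cvg_cst|apply: cvgM; [exact: cS|exact: cvg_cst]].
move=> t _; rewrite PhiE// xn mul1r mulrCA ler_wpM2l ?powR_ge0//; exact: weight_le.
Qed.

(** [bessel_limit] turns the bound on square means into one on the Taylor coefficients; the uniform
    bounds on the truncations pass to [h] by Fatou. *)
Lemma square_mean_area :
  (\int[mu \x mu]_(w in @disk2 R)
    ((1 + nc (h (w.1 +i* w.2)) ^+ 2) `^ s * (1 - nc (w.1 +i* w.2) ^+ 2) `^ (s - 2))%:E < +oo)%E.
Proof.
have [hp ch] := holoD_punct hh.
apply: (@le_lt_trans _ _ (2 `^ `|s - 2| * Cst)%:E); last exact: ltry.
have := @fatou _ _ R (mu \x mu)%E (@disk2 R) measurable_disk2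
  (fun n w => (Phi n (w.1 +i* w.2))%:E).
have E (w : R * R) : disk2 w ->
    ((1 + nc (h (w.1 +i* w.2)) ^+ 2) `^ s * (1 - nc (w.1 +i* w.2) ^+ 2) `^ (s - 2))%:E =
    limn_einf (fun n => (Phi n (w.1 +i* w.2))%:E).
  move=> w1; set z := w.1 +i* w.2; have z1 : nc z < 1 by exact: w1.
  suff C : (Phi n z)%:E @[n --> \oo] --> ((1 + nc (h z) ^+ 2) `^ s * (1 - nc z ^+ 2) `^ (s - 2))%:E.
    by rewrite is_cvg_limn_einfE; [symmetry; exact/cvg_lim|apply/cvg_ex; eexists; exact: C].
  apply: cvg_EFin; first by near=> n.
  rewrite /comp /=.
  have cn : nc (ptrunc b n.+1 z) @[n --> \oo] --> nc (h z).
    have c0 := csums_nc (taylor hp ch z1).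
    by move: c0; rewrite -(cvg_shiftS (fun n => nc (\sum_(0 <= k < n) tcoef h k * z ^+ k))).
  have cp : (1 + nc (ptrunc b n.+1 z) ^+ 2) `^ s @[n --> \oo] --> (1 + nc (h z) ^+ 2) `^ s.
    have cl : {for 1 + nc (h z) ^+ 2, continuous (fun x : R => x `^ s)}.
      apply: differentiable_continuous; apply/derivable1_diffP.
      by apply: derivable_powR; rewrite in_itv /= andbT ltr_wpDr// sqr_ge0.
    have cm : 1 + nc (ptrunc b n.+1 z) ^+ 2 @[n --> \oo] --> 1 + nc (h z) ^+ 2.
      by apply: cvgD; [exact: cvg_cst|apply: cvgM].
    exact: (continuous_cvg _ cl cm).
  rewrite -[X in _ --> X]mul1r; apply: cvgM; last by apply: cvgM => //; exact: cvg_cst.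
  apply: cvg_near_cst; near=> n.
  suff -> : nc z <= rad n by [].
  have d0 : 0 < 1 - nc z by rewrite subr_gt0.
  rewrite /rad lerBrDr addrC -lerBrDr -[X in _ <= X]invrK lef_pV2 ?posrE ?invr_gt0 ?ltr0n//.
  apply: (@le_trans _ _ n%:R); last by rewrite ler_nat; exact: leqW (leqnSn n).
  by near: n; exact: nbhs_infty_ger.
move=> /(_ (fun n => _) (fun n w _ => _)) H.
apply: (@le_trans _ _ (\int[mu \x mu]_(w in @disk2 R) limn_einf (fun n => (Phi n (w.1 +i* w.2))%:E))%E).
  by rewrite le_eqVlt; apply/orP; left; apply/eqP; apply: eq_integral => w; rewrite inE => /E.
apply: (le_trans (H _ _)).
- by move=> n; apply/measurable_EFinP; exact: mPhi.
- by move=> n w; rewrite lee_fin.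
- by apply: limn_einf_le => n; exact: truncated_area.
Unshelve. all: by end_near.
Qed.

End square_mean.

(** A branch [k] of [((f - f 0) / z)^(q/2)], up to a constant, has bounded square means. Since
    [p / q <= s], the power [|f|^p] is dominated by [(1 + |k|^2)^s], and [s - 2] is [alpha]. *)
Theorem bergman_of_hardy f (p alpha q M : R) : holoD f -> injD f -> 0 < p -> -1 < alpha -> 0 < q ->
  p <= q * (alpha + 2) ->
  (forall r, 0 < r < 1 ->
    (\int[mu]_(t in `[0%R, (2 * pi)%R]) (nc (f (r%:C * unit_pt t)) `^ q)%:E <= M%:E)%E) ->
  (\int[mu \x mu]_(w in @disk2 R)
     (nc (f (w.1 +i* w.2)) `^ p * (1 - nc (w.1 +i* w.2) ^+ 2) `^ alpha)%:E < +oo)%E.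
Proof.
move=> hf fi p0 al q0 pq HM.
pose s := alpha + 2; have s1 : 1 < s by rewrite /s -ltrBlDr (le_lt_trans _ al)//; lra.
have [k [c c0 [hk kE]]] := power_branch (q / 2) hf fi.
pose a := nc (f 0); have a0 : 0 <= a by exact: nc_ge0.
pose G z := nc (f z - f 0) / nc z.
have G0 z : 0 <= G z by rewrite divr_ge0// nc_ge0.
have k2 z : nc z < 1 -> z != 0 -> nc (k z) ^+ 2 = c ^+ 2 * G z `^ q.
  move=> z1 z0; rewrite kE// exprMn -powR_exprn ?G0//; congr (_ * _).
  rewrite -(powR_mulrn 2 (G0 z)) -powRrM; congr (_ `^ _); by field.
(* Radii at least [1/2] keep the division by [|z|] harmless: it costs a factor [2^q], and splitting
   the sum with [|f 0|] costs another, whence [4^q]. *)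
have k2M r : 2^-1 <= r -> r < 1 ->
    \int[mu]_(t in `[0, 2 * pi]) nc (k (r%:C * unit_pt t)) ^+ 2 <= c ^+ 2 * 4 `^ q * (M + 2 * pi * a `^ q).
  move=> r2 r1; have r0 : 0 < r by apply: lt_le_trans r2; rewrite invr_gt0.
  have nr t : nc (r%:C * unit_pt t) = r by rewrite nc_circ// ltW.
  have cf t : {for t, continuous (fun t => nc (f (r%:C * unit_pt t)) `^ q)}.
    apply: continuous_powR_comp => //; first by move=> x; exact: nc_ge0.
    apply: pcont_nc; apply: pcont_circ; apply: cholo_ccont; apply: hf; by rewrite nr.
  have := HM r; rewrite r0 r1 Rint_EFin// lee_fin => /(_ isT) HMr.
  apply: (@le_trans _ _ (\int[mu]_(t in `[0, 2 * pi]) (c ^+ 2 * 4 `^ q * (nc (f (r%:C * unit_pt t)) `^ q + a `^ q)))).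
    apply: le_Rintegral => //.
    - apply: cont_integrable => t _; apply: cvgM; apply: pcont_nc; apply: pcont_circ; apply: cholo_ccont;
      by apply: hk; rewrite nr.
    - apply: cont_integrable => t _; apply: cvgM; first exact: cvg_cst.
      by apply: cvgD; [exact: cf|exact: cvg_cst].
    move=> t _; rewrite k2 ?nr//; last by rewrite -nc_gt0 nr.
    rewrite -mulrA ler_wpM2l ?sqr_ge0//.
    apply: (@le_trans _ _ ((2 * (nc (f (r%:C * unit_pt t)) + a)) `^ q)).
      apply: powR_le; rewrite ?(ltW q0)// /G nr ler_pdivrMr//.
      apply: (@le_trans _ _ (nc (f (r%:C * unit_pt t)) + a)).
        by apply: (le_trans (ncD _ _)); rewrite ncN.
      have : 0 <= nc (f (r%:C * unit_pt t)) + a by rewrite addr_ge0 ?nc_ge0.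
      by move: (_ + a) => u u0; nra.
    rewrite powRM ?addr_ge0 ?nc_ge0//.
    have -> : 4 `^ q = 2 `^ q * 2 `^ q :> R by rewrite -powRM//; congr (_ `^ _); ring.
    by rewrite -mulrA ler_wpM2l ?powR_ge0// powR_addr_le// nc_ge0.
  rewrite RintegralZl//; last by apply: cont_integrable => t _; apply: cvgD; [exact: cf|exact: cvg_cst].
  apply: ler_wpM2l; first by rewrite mulr_ge0 ?sqr_ge0 ?powR_ge0.
  rewrite RintegralD//; last 2 first.
  - by apply: cont_integrable => t _; exact: cf.
  - by apply: cont_integrable => t _; exact: cvg_cst.
  by rewrite Rint_cst lerD2r.
have fin := square_mean_area hk s1 k2M.
have ps : p / q <= s by rewrite ler_pdivrMr// mulrC.
pose C := 2 `^ p * ((c ^+ 2)^-1 `^ (p / q) + a `^ p).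
have C0 : 0 <= C by rewrite mulr_ge0 ?addr_ge0 ?powR_ge0.
(* At [z = 0] the modulus of [k] was not computed, but there [f z = f 0] and the term [a^p] of [C]
   suffices. *)
have fle z : nc z < 1 -> nc (f z) `^ p <= C * (1 + nc (k z) ^+ 2) `^ s.
  move=> z1; set K := nc (k z) ^+ 2; have K0 : 0 <= K by exact: sqr_ge0.
  have K1 : 1 <= (1 + K) `^ s.
    by rewrite -[X in X <= _](powRr0 (1 + K)); apply: ler_powR; [rewrite lerDl|exact: (ltW (lt_trans ltr01 s1))].
  have p20 : 0 <= 2 `^ p :> R by exact: powR_ge0.
  have [z0|z0] := eqVneq z 0.
    rewrite z0 -/a /C -mulrA mulrDl.
    have h1 : a `^ p <= a `^ p * (1 + K) `^ s by rewrite ler_peMr ?powR_ge0.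
    have h2 : 0 <= (c ^+ 2)^-1 `^ (p / q) * (1 + K) `^ s by rewrite mulr_ge0 ?powR_ge0.
    have h3 : 1 <= 2 `^ p :> R.
      by rewrite -[X in X <= _](powRr0 2); apply: ler_powR; [rewrite ler1n|exact: ltW].
    apply: (@le_trans _ _ (1 * (a `^ p))); first by rewrite mul1r.
    by apply: ler_pM => //; [exact: powR_ge0|apply: (le_trans h1); rewrite lerDr].
  have n0 : 0 < nc z by rewrite nc_gt0.
  have fG : nc (f z) <= G z + a.
    have e1 : nc (f z) <= nc (f z - f 0) + a by rewrite -[in X in X <= _](subrK (f 0) (f z)); exact: ncD.
    apply: (le_trans e1); rewrite lerD2r /G ler_pdivlMr// ler_piMr ?nc_ge0//; exact: ltW.
  apply: (@le_trans _ _ ((G z + a) `^ p)); first by apply: powR_le => //; [exact: ltW|exact: nc_ge0].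
  apply: (le_trans (powR_addr_le p0 (G0 z) a0)); rewrite /C -mulrA ler_wpM2l// mulrDl.
  apply: lerD; last by rewrite ler_peMr ?powR_ge0.
  have GE : G z `^ p = (c ^+ 2)^-1 `^ (p / q) * K `^ (p / q).
    rewrite -powRM ?invr_ge0 ?sqr_ge0// /K k2// mulKf ?expf_neq0 ?gt_eqF//.
    by rewrite -powRrM; congr (_ `^ _); field; rewrite gt_eqF.
  rewrite GE ler_wpM2l ?powR_ge0//; apply: (@le_trans _ _ ((1 + K) `^ (p / q))).
    by apply: powR_le => //; [rewrite divr_ge0// ltW|rewrite lerDr].
  by apply: ler_powR => //; rewrite lerDl.
have [F [mF FE]] := holo_cmeas hf; have [K [mK KE]] := holo_cmeas hk.
have mn := cmeas_nc (@cmeas_point R).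
have mw (e : R) : measurable_fun setT (fun w : R * R => (1 - nc (w.1 +i* w.2) ^+ 2) `^ e).
  apply: (measurableT_comp (measurable_powR _)).
  by apply: measurable_funB; [exact: measurable_cst|apply: measurable_funX].
have mk : measurable_fun (@disk2 R) (fun w : R * R =>
    ((1 + nc (k (w.1 +i* w.2)) ^+ 2) `^ s * (1 - nc (w.1 +i* w.2) ^+ 2) `^ (s - 2))%:E).
  apply/measurable_EFinP.
  apply: (@eq_measurable_fun _ _ _ _ _ (fun w : R * R => (1 + nc (K w) ^+ 2) `^ s * (1 - nc (w.1 +i* w.2) ^+ 2) `^ (s - 2))).
    by move=> w; rewrite inE => w1; rewrite KE.
  apply: measurable_funTS; apply: measurable_funM => //.
  apply: (measurableT_comp (measurable_powR _)).
  by apply: measurable_funD; [exact: measurable_cst|apply: measurable_funX; exact: cmeas_nc].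
have mf : measurable_fun (@disk2 R) (fun w : R * R =>
    (nc (f (w.1 +i* w.2)) `^ p * (1 - nc (w.1 +i* w.2) ^+ 2) `^ alpha)%:E).
  apply/measurable_EFinP.
  apply: (@eq_measurable_fun _ _ _ _ _ (fun w : R * R => nc (F w) `^ p * (1 - nc (w.1 +i* w.2) ^+ 2) `^ alpha)).
    by move=> w; rewrite inE => w1; rewrite FE.
  apply: measurable_funTS; apply: measurable_funM => //.
  by apply: (measurableT_comp (measurable_powR _)); exact: cmeas_nc.
apply: (@le_lt_trans _ _ (C%:E * \int[mu \x mu]_(w in @disk2 R)
    ((1 + nc (k (w.1 +i* w.2)) ^+ 2) `^ s * (1 - nc (w.1 +i* w.2) ^+ 2) `^ (s - 2))%:E)%E); last first.
  by rewrite lte_mul_pinfty ?lee_fin.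
rewrite -ge0_integralZl//; last 2 first.
- exact: measurable_disk2.
- by move=> w _; rewrite lee_fin mulr_ge0// powR_ge0.
apply: ge0_le_integral => //.
- exact: measurable_disk2.
- by move=> w _; rewrite lee_fin mulr_ge0// powR_ge0.
- by apply: emeasurable_funM => //; exact: measurable_cst.
move=> w w1; rewrite -EFinM lee_fin.
have -> : s - 2 = alpha by rewrite /s; ring.
by rewrite mulrA ler_wpM2r ?powR_ge0// fle.
Qed.

End bergman_of_hardy.

(** * Translation to the function spaces of the statement *)

Section statement.
Context {R : realType}.
Local Open Scope complex_scope.
Local Notation mu := (@lebesgue_measure R).
Implicit Types (f : R[i] -> R[i]).

Lemma unit_diskE (z : R[i]) : unit_disk z = (nc z < 1) :> Prop.
Proof. by rewrite /unit_disk /= ncE -[1]/(1%:C) ltcR. Qed.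

Lemma holomorphic_holoD f : holomorphic_on (@unit_disk R) f <-> holoD f.
Proof.
split=> H z z1.
  by apply/derivable_cdiff; apply: H; rewrite unit_diskE.
by apply/derivable_cdiff; apply: H; rewrite -unit_diskE.
Qed.

Lemma conformal_injD f : @conformal_disk R f <-> holoD f /\ injD f.
Proof.
rewrite /conformal_disk /=; split=> -[hf fi]; split; try exact/holomorphic_holoD.
  by move=> z w z1 w1; apply: fi; rewrite inE unit_diskE.
by move=> z w; rewrite !inE !unit_diskE; exact: fi.
Qed.

Lemma disk2E : [set w : R * R | unit_disk (w.1 +i* w.2)] = @disk2 R.
Proof. by apply/seteqP; split=> w /=; rewrite unit_diskE. Qed.

Lemma hardy_bound f (q : R) : hardy q f <-> holoD f /\
  exists M : R, forall r, 0 < r < 1 ->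
  (\int[mu]_(t in `[0%R, (2 * pi)%R]) (nc (f (r%:C * unit_pt t)) `^ q)%R%:E <= M%:E)%E.
Proof.
rewrite /hardy /=; split=> -[hf H]; split; try exact/holomorphic_holoD.
  set E := ereal_sup _ in H.
  have ub r : 0 < r < 1 ->
      (\int[mu]_(t in `[0%R, (2 * pi)%R]) (nc (f (r%:C * unit_pt t)) `^ q)%R%:E <= E)%E.
    move=> r01; apply: ereal_sup_ubound; exists r; first by rewrite /= in_itv.
    by apply: eq_integral => t _; rewrite polarE.
  have E0 : (0 <= E)%E.
    apply: le_trans (ub 2^-1 _); first by apply: integral_ge0 => t _; rewrite lee_fin powR_ge0.
    by rewrite invr_gt0 ltr0n invf_lt1 ?ltr1n.
  by exists (fine E) => r /ub; rewrite fineK// ge0_fin_numE.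
have [M HM] := H; apply: (@le_lt_trans _ _ M%:E); last exact: ltry.
apply: ge_ereal_sup => x [r /=]; rewrite in_itv /= => r01 <- {x}.
apply: le_trans (HM r r01); rewrite le_eqVlt; apply/orP; left; apply/eqP.
by apply: eq_integral => t _; rewrite polarE.
Qed.

End statement.

Unset Implicit Arguments.

Theorem corollary1p5 (R : realType) :
  (forall p alpha : R, 0 < p -> -1 < alpha ->
     forall q : R, q \in `]0, p / (alpha + 2)[ ->
     bergman p alpha `&` @conformal_disk R `<=` hardy q `&` @conformal_disk R)
  /\
  (forall q : R, 0 < q ->
     forall p alpha : R, 0 < p -> -1 < alpha ->
     p / (alpha + 2) \in `]0, q] ->
     hardy q `&` @conformal_disk R `<=` bergman p alpha `&` @conformal_disk R).
Proof.
split=> [p alpha p0 al q|q q0 p alpha p0 al];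
  (have s0 : 0 < alpha + 2 by rewrite -ltrBlDr (lt_trans _ al)//; lra);
  rewrite in_itv /= => /andP[h1 h2] f [Hf cf]; split=> //;
  have /conformal_injD[hf fi] := cf.
  move: Hf => [_]; rewrite /= disk2E => fin.
  have [C C0 HC] := bergman_growth hf fi p0 al fin.
  apply/hardy_bound; split=> //.
  (* The growth exponent is [(alpha + 2) / p], so the condition of [hardy_of_growth] on [q] is
     precisely [q < p / (alpha + 2)]. *)
  apply: (hardy_of_growth hf fi C0 _ h1 _ HC); first by rewrite divr_gt0.
  by rewrite mulrA ltr_pdivrMr// mul1r -ltr_pdivlMr.
split; first exact/holomorphic_holoD.
have [_ [M HM]] := (hardy_bound f q).1 Hf.
rewrite /= disk2E; apply: (bergman_of_hardy hf fi p0 al q0 _ HM).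
by rewrite -ler_pdivrMr.
Qed.
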